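(* Let $k\in(0,1)$ and let $\mu,\nu^2$ be nonnegative real constants. Assume $u_0\in\mathcal{C}^2(\mathbb{R})$, $u_1\in\mathcal{C}^1(\mathbb{R})$ and $g\in\mathcal{C}^{0,1}_{t,x}([1,\infty)\times\mathbb{R})$. Then the solution $u$ to the Cauchy problem $$\begin{cases} \partial_t^2 u- t^{-2k} \partial_x^2 u +\mu \, t^{-1}\partial_t u+\nu^2 \, t^{-2} u=g(t,x), & x\in \mathbb{R}, \ t>1,\\ u(1,x)=u_0(x), & x\in \mathbb{R}, \\ \partial_t u(1,x)=u_1(x), & x\in \mathbb{R},\end{cases}$$ is given by the representation formula $$\begin{aligned} u(t,x) &= \frac{1}{2}t^{\frac{k-\mu}{2}}\big(u_0(x+A_k(t))+u_0(x-A_k(t))\big)+\int_{x-A_k(t)}^{x+A_k(t)} u_0(y) K_0\big(t,x;y;\mu,\nu^2,k\big)\, \mathrm{d}y \\ & \quad +\int_{x-A_k(t)}^{x+A_k(t)} u_1(y)K_1\big(t,x;y;\mu,\nu^2,k\big)\, \mathrm{d}y + \int_1^t \int_{x-\phi_k(t)+\phi_k(b)}^{x+\phi_k(t)-\phi_k(b)} g(b,y) E\big(t,x;b,y;\mu,\nu^2,k\big) \, \mathrm{d}y\, \mathrm{d}b. \end{aligned}$$ Here the kernel function $E$ is defined by $$\begin{aligned} E\big(t,x;b,y;\mu,\nu^2,k\big) & = c\, t^{-\frac{\mu}{2}+\frac{1-\sqrt{\delta}}{2}} b^{\frac{\mu}{2}+\frac{1-\sqrt{\delta}}{2}} \left((\phi_k(t)+\phi_k(b))^2-(y-x)^2\right)^{-\gamma}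 \\ & \qquad \times \mathsf{F}\left(\gamma,\gamma;1; \frac{(\phi_k(t)-\phi_k(b))^2-(y-x)^2}{(\phi_k(t)+\phi_k(b))^2-(y-x)^2} \right),\end{aligned}$$ where $$\delta=(\mu-1)^2-4\nu^2,\qquad c = 2^{-\frac{\sqrt{\delta}}{1-k}}(1-k)^{-1+\frac{\sqrt{\delta}}{1-k}},\qquad \gamma = \frac{1}{2}-\frac{\sqrt{\delta}}{2(1-k)},$$ and the kernel functions $K_0,K_1$ are given by $$K_0\big(t,x;y;\mu,\nu^2,k\big) = \mu E\big(t,x;1,y;\mu,\nu^2,k\big)-\frac{\partial}{\partial b}\, E\big(t,x;b,y;\mu,\nu^2,k\big) \Big|_{b=1},$$ $$K_1\big(t,x;y;\mu,\nu^2,k\big) = E\big(t,x;1,y;\mu,\nu^2,k\big).$$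
   Context: Notation. $\phi_k(t)=\frac{t^{1-k}}{1-k}$ and $A_k(t)=\phi_k(t)-\phi_k(1)=\int_1^t\tau^{-k}\,\mathrm{d}\tau$. $\mathsf{F}(\alpha_1,\alpha_2;\beta;z)$ denotes the Gauss hypergeometric function. $g\in\mathcal{C}^{0,1}_{t,x}([1,\infty)\times\mathbb{R})$ means that $g$ is continuous in $(t,x)$ and continuously differentiable with respect to $x$. When $\delta<0$, $\sqrt{\delta}$ denotes a (purely imaginary) complex square root of $\delta$, and powers of positive real numbers with complex exponents are defined via the real logarithm. *)

(* Defs.v *)
From Stdlib Require Import Reals Factorial.
From Coquelicot Require Import Coquelicot.

Local Open Scope R_scope.

(** * Complex-valued functions *)

(** [x ^ w = exp (w * ln x)] for [0 < x] and a complex exponent [w]. *)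
Definition RCpower (x : R) (w : C) : C :=
  (exp (Re w * ln x) * cos (Im w * ln x),
   exp (Re w * ln x) * sin (Im w * ln x)).

(** Integral and derivative of complex-valued functions of a real variable,
    [C] being regarded as a normed space over [R]. *)
Definition CRInt (f : R -> C) (a b : R) : C :=
  RInt (V := C_R_CompleteNormedModule) f a b.

Definition CRDerive (f : R -> C) (x : R) : C :=
  iota (T := C_R_CompleteNormedModule)
    (fun l => is_derive (K := R_AbsRing) (V := C_R_NormedModule) f x l).

Fixpoint pochhammer (a : C) (n : nat) : C :=
  match n with
  | O => RtoC 1
  | S m => (pochhammer a m * (a + RtoC (INR m)))%C
  end.

(** Sum of the Gauss series. Meaningful for [Cmod z < 1] and [b] not a
    nonpositive integer; no analytic continuation is performed. The argument
    [z] used in [kernelE] below lies in [[0, 1)] on the domains of integration. *)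
Definition hypergeom (a1 a2 b z : C) : C :=
  iota (T := C_CompleteNormedModule)
    (fun l => is_pseries (K := C_AbsRing) (V := C_NormedModule)
       (fun n => (pochhammer a1 n * pochhammer a2 n
                  / (pochhammer b n * RtoC (INR (fact n))))%C) z l).

(** [sd] is the nonnegative root if [0 <= delta], and either one of the two
    purely imaginary roots if [delta < 0]. *)
Definition is_sqrt (delta : R) (sd : C) : Prop :=
  (sd * sd)%C = RtoC delta /\ (0 <= delta -> sd = RtoC (sqrt delta)).

(** * Regularity *)

Definition C_line (n : nat) (f : R -> R) : Prop :=
  forall m x, (m <= n)%nat -> ex_derive_n f m x /\ continuous (Derive_n f m) x.

(** Functions on [[1, +oo) x R] are total functions [f t x] whose values for
    [t < 1] are irrelevant. *)
Definition slab (p : R * R) : Prop := 1 <= fst p.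

Definition slab_continuous (f : R -> R -> R) : Prop :=
  continuous_on slab (fun p : R * R => f (fst p) (snd p)).

(** Time derivative relative to [[1, +oo)]: two-sided for [1 < t], right
    derivative for [t = 1]. *)
Definition is_dt (f : R -> R -> R) (t x l : R) : Prop :=
  filterdiff (fun s => f s x) (within (fun s => 1 <= s) (locally t))
    (fun h => scal h l).

Definition is_dx (f : R -> R -> R) (t x l : R) : Prop :=
  is_derive (fun y => f t y) x l.

(** Class [C^n] on [[1, +oo) x R], up to the boundary [t = 1]. *)
Fixpoint C_slab (n : nat) (f : R -> R -> R) : Prop :=
  slab_continuous f /\
  match n with
  | O => True
  | S m => exists ft fx : R -> R -> R,
      (forall t x, 1 <= t -> is_dt f t x (ft t x) /\ is_dx f t x (fx t x)) /\
      C_slab m ft /\ C_slab m fx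
  end.

(** Class [C^{0,1}_{t,x}] on [[1, +oo) x R]. *)
Definition C01_slab (g : R -> R -> R) : Prop :=
  slab_continuous g /\
  exists gx : R -> R -> R,
    (forall t x, 1 <= t -> is_dx g t x (gx t x)) /\ slab_continuous gx.

(** * The Cauchy problem *)

Definition is_solution (k mu nu2 : R) (u0 u1 : R -> R) (g u : R -> R -> R)
  : Prop :=
  C_slab 2 u /\
  (forall t x, 1 < t ->
     Derive_n (fun s => u s x) 2 t
     - Rpower t (- (2 * k)) * Derive_n (fun y => u t y) 2 x
     + mu * / t * Derive (fun s => u s x) t
     + nu2 * / t ^ 2 * u t x = g t x) /\
  (forall x, u 1 x = u0 x) /\
  (forall x, is_dt u 1 x (u1 x)).

(** * Kernels and representation formula *)

Definition phi (k t : R) : R := Rpower t (1 - k) / (1 - k).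

Definition A (k t : R) : R := phi k t - phi k 1.

Definition delta (mu nu2 : R) : R := (mu - 1) ^ 2 - 4 * nu2.

(** In the kernels, [sd] is the chosen square root of [delta mu nu2]; they
    depend on [nu2] only through it. *)
Definition cst (k : R) (sd : C) : C :=
  (RCpower 2 (- (sd / RtoC (1 - k)))
   * RCpower (1 - k) (- RtoC 1 + sd / RtoC (1 - k)))%C.

Definition gam (k : R) (sd : C) : C :=
  (RtoC (1 / 2) - sd / RtoC (2 * (1 - k)))%C.

Definition kernelE (k mu : R) (sd : C) (t x b y : R) : C :=
  let P := (phi k t + phi k b) ^ 2 - (y - x) ^ 2 in
  let M := (phi k t - phi k b) ^ 2 - (y - x) ^ 2 in
  (cst k sd
   * RCpower t (RtoC (- (mu / 2)) + (RtoC 1 - sd) / RtoC 2)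
   * RCpower b (RtoC (mu / 2) + (RtoC 1 - sd) / RtoC 2)
   * RCpower P (- gam k sd)
   * hypergeom (gam k sd) (gam k sd) (RtoC 1) (RtoC (M / P)))%C.

Definition kernelK0 (k mu : R) (sd : C) (t x y : R) : C :=
  (RtoC mu * kernelE k mu sd t x 1 y
   - CRDerive (fun b => kernelE k mu sd t x b y) 1)%C.

Definition kernelK1 (k mu : R) (sd : C) (t x y : R) : C :=
  kernelE k mu sd t x 1 y.

Definition representation (k mu : R) (sd : C) (u0 u1 : R -> R)
  (g : R -> R -> R) (t x : R) : C :=
  (RtoC (1 / 2 * Rpower t ((k - mu) / 2) * (u0 (x + A k t) + u0 (x - A k t))%R)
   + CRInt (fun y => RtoC (u0 y) * kernelK0 k mu sd t x y)
       (x - A k t)%R (x + A k t)%R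
   + CRInt (fun y => RtoC (u1 y) * kernelK1 k mu sd t x y)
       (x - A k t)%R (x + A k t)%R
   + CRInt (fun b =>
       CRInt (fun y => RtoC (g b y) * kernelE k mu sd t x b y)
         (x - phi k t + phi k b)%R (x + phi k t - phi k b)%R)
       1 t)%C.

(* Main.v *)
Require Import Defs.
From Stdlib Require Import Reals Factorial Lra Lia ClassicalEpsilon.
From Coquelicot Require Import Coquelicot.

Local Open Scope R_scope.
Set Bullet Behavior "Strict Subproofs".

(**
In the time variable [s = phi t] and for [v = t ^ ((mu - k) / 2) u], the equation
becomes the wave equation [v_ss - v_xx + N / s^2 v = h] with an inverse-square
potential, where [N = (1 - delta / (1 - k)^2) / 4 = gam (1 - gam)] is real even when
[gam] is not. Both halves of the theorem are proved in these reduced variables.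

Representation. Fix the apex [(S, x)] and put
[zeta = ((S - b)^2 - (y - x)^2) / (4 S b)]. If [Phi] solves
[z (1 + z) Phi'' + (1 + 2 z) Phi' + N Phi = 0] with [Phi 0 = 1], then
[R = Phi (zeta)] solves the homogeneous reduced equation in [(b, y)] and equals [1]
on the two characteristics through the apex: it is the Riemann function. For a
solution [v], let [green b] be the representation formula, without source, that uses
the data of [v] at time [b]. At [b = S] it is [v (S, x)]. Differentiating in [b] the
integral with moving endpoints, replacing second time derivatives by the two equations
and integrating by parts in [y] leaves only [1/2] times the integral of [h R]
(is_derive_green). Integrating from the initial time to [S] gives
riemann_representation, hence the formula for every solution,
and uniqueness with it.

The kernel. Pfaff's transformation turns the Gauss series of the statement into
[Phi (z) = (1 + z)^(- gam) F (gam, gam; 1; z / (1 + z))], and the powers in front of it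
collapse to [1/2 t^((k - mu) / 2) b^((k + mu) / 2)] (kernelE_riemann). That [Phi] solves
the Legendre equation follows from the recurrence of the coefficients. For complex
[gam] the imaginary part of [Phi] is a solution regular at [0] that vanishes there, so
it is zero by an energy estimate (legendre_regular_unique); every kernel is therefore
real on the domain of integration.

Existence. The reduced problem is the Volterra equation [v = c + D (h - q v)], where
[c] is d'Alembert's solution with the given data, [q = N / s^2] and [D] is Duhamel's
integral of the flat wave equation. Picard iteration converges geometrically on each
cone of dependence, for an exponentially weighted norm. As [D] commutes with [d/dx],
the iterates of the [x]-derivatives solve the same kind of equation, so the limit is
[C^1] in [x]; and [D] maps continuous sources that are [C^1] in [x] to [C^2] functions,
which makes [v] of class [C^2] (wave_solution_exists).
*)

(** * Derivatives of complex-valued functions of a real variable *)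

(** Componentwise, so that real differentiation lemmas apply directly; the rules below
    let the Legendre equation be checked by complex [field] computations. *)
Definition is_Cderive (f : R -> C) (x : R) (l : C) : Prop :=
  is_derive (fun t => Re (f t)) x (Re l) /\
  is_derive (fun t => Im (f t)) x (Im l).

Lemma is_derive_eq (f : R -> R) (x l l' : R) :
  is_derive f x l -> l = l' -> is_derive f x l'.
Proof. intros H <-; exact H. Qed.

Lemma Derive_val (f : R -> R) (x l : R) :
  is_derive f x l -> Derive (fun y : R => f y) x = l.
Proof. apply is_derive_unique. Qed.

Lemma Cderive_eq (f : R -> C) (x : R) (l l' : C) :
  is_Cderive f x l -> l = l' -> is_Cderive f x l'.
Proof. intros H <-; exact H. Qed.

Lemma Cderive_const (c : C) (x : R) : is_Cderive (fun _ => c) x (RtoC 0).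
Proof.
  split; [exact (is_derive_const (V := R_NormedModule) (Re c) x)|].
  exact (is_derive_const (V := R_NormedModule) (Im c) x).
Qed.

Lemma Cderive_RtoC (f : R -> R) (x l : R) :
  is_derive f x l -> is_Cderive (fun t => RtoC (f t)) x (RtoC l).
Proof.
  intros H; split; [exact H|].
  exact (is_derive_const (V := R_NormedModule) 0 x).
Qed.

Lemma Cderive_plus (f g : R -> C) (x : R) (l m : C) :
  is_Cderive f x l -> is_Cderive g x m -> is_Cderive (fun t => (f t + g t)%C) x (l + m)%C.
Proof.
  intros [H1 H2] [H3 H4]; split.
  - apply (is_derive_plus (V := R_NormedModule)); assumption.
  - apply (is_derive_plus (V := R_NormedModule)); assumption.
Qed.

Lemma Cderive_mult (f g : R -> C) (x : R) (l m : C) :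
  is_Cderive f x l -> is_Cderive g x m ->
  is_Cderive (fun t => (f t * g t)%C) x (l * g x + f x * m)%C.
Proof.
  intros [H1 H2] [H3 H4]; split.
  - eapply is_derive_eq.
    + apply (is_derive_minus (V := R_NormedModule)); apply Derive.is_derive_mult;
      [exact H1|exact H3|exact H2|exact H4].
    + unfold minus, plus, opp, Re, Im; simpl; ring.
  - eapply is_derive_eq.
    + apply (is_derive_plus (V := R_NormedModule)); apply Derive.is_derive_mult;
      [exact H1|exact H4|exact H2|exact H3].
    + unfold plus, Re, Im; simpl; ring.
Qed.

Lemma Cderive_comp (f : R -> C) (g : R -> R) (x m : R) (l : C) :
  is_Cderive f (g x) l -> is_derive g x m ->
  is_Cderive (fun t => f (g t)) x (l * RtoC m)%C.
Proof.
  intros [H1 H2] H; split.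
  - eapply is_derive_eq.
    + exact (is_derive_comp (V := R_NormedModule) _ g x _ _ H1 H).
    + unfold scal, Re; simpl; unfold mult; simpl; ring.
  - eapply is_derive_eq.
    + exact (is_derive_comp (V := R_NormedModule) _ g x _ _ H2 H).
    + unfold scal, Im; simpl; unfold mult; simpl; ring.
Qed.

Lemma Cderive_RCpower (w : C) (x : R) : 0 < x ->
  is_Cderive (fun t => RCpower t w) x (w * RCpower x w / RtoC x)%C.
Proof.
  intros Hx; destruct w as [p q]; split; unfold RCpower, Re, Im; simpl.
  - auto_derive; [tauto|]. field; lra.
  - auto_derive; [tauto|]. field; lra.
Qed.

(** * The Gauss series on the real interval (-1, 1) *)

Definition gauss_coef (g : C) (n : nat) : C :=
  (pochhammer g n * pochhammer g n
                  / (pochhammer (RtoC 1) n * RtoC (INR (fact n))))%C.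

Lemma pochhammer_1 (n : nat) : pochhammer (RtoC 1) n = RtoC (INR (fact n)).
Proof.
  induction n as [|n IH]; [reflexivity|].
  simpl pochhammer; rewrite IH.
  rewrite fact_simpl, mult_INR, S_INR, RtoC_mult, RtoC_plus; ring.
Qed.

Lemma RtoC_neq0 (x : R) : x <> 0 -> RtoC x <> RtoC 0.
Proof. intros H E; apply H, RtoC_inj, E. Qed.

(** The first-order recurrence of the coefficients, which is the hypergeometric equation
    term by term and also controls their growth. *)
Lemma gauss_coef_S (g : C) (n : nat) :
  (RtoC (INR n + 1) * RtoC (INR n + 1) * gauss_coef g (S n)
   = (g + RtoC (INR n)) * (g + RtoC (INR n)) * gauss_coef g n)%C.
Proof.
  unfold gauss_coef; rewrite !pochhammer_1, fact_simpl, mult_INR, S_INR.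
  simpl pochhammer; rewrite RtoC_mult.
  field; split; apply RtoC_neq0.
  - apply not_eq_sym, Rlt_not_eq, lt_0_INR, lt_O_fact.
  - pose proof (pos_INR n); lra.
Qed.

Lemma gauss_coef_0 (g : C) : gauss_coef g 0 = RtoC 1.
Proof. unfold gauss_coef; simpl. field. Qed.

Lemma gauss_coef_S_mod (g : C) (n : nat) :
  (INR n + 1) * (INR n + 1) * Cmod (gauss_coef g (S n))
  <= (Cmod g + INR n) * (Cmod g + INR n) * Cmod (gauss_coef g n).
Proof.
  pose proof (f_equal Cmod (gauss_coef_S g n)) as E.
  pose proof (pos_INR n) as Hn.
  rewrite !Cmod_mult, Cmod_R, (Rabs_pos_eq (INR n + 1)) in E by lra.
  rewrite E.
  pose proof (Cmod_triangle g (RtoC (INR n))) as T.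
  rewrite Cmod_R, Rabs_pos_eq in T by assumption.
  pose proof (Cmod_ge_0 (gauss_coef g n)).
  pose proof (Cmod_ge_0 (g + RtoC (INR n))).
  apply Rmult_le_compat_r; [assumption|].
  apply Rmult_le_compat; assumption.
Qed.

Lemma eventually_nonincreasing_bounded (u : nat -> R) (n0 : nat) :
  (forall n, (n0 <= n)%nat -> u (S n) <= u n) ->
  exists M, forall n, u n <= M.
Proof.
  intros H.
  assert (B : exists M, forall n, (n <= n0)%nat -> u n <= M).
  { clear H; induction n0 as [|m [M IH]].
    - exists (u O); intros n Hn; replace n with O by lia; lra.
    - exists (Rmax M (u (S m))); intros n Hn.
      destruct (Nat.eq_dec n (S m)) as [->|Hd]; [apply Rmax_r|].
      eapply Rle_trans; [apply IH; lia|apply Rmax_l]. }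
  destruct B as [M HM]; exists M.
  assert (D : forall j, u (n0 + j)%nat <= M).
  { induction j as [|j IH].
    - apply HM; lia.
    - replace (n0 + S j)%nat with (S (n0 + j)) by lia.
      eapply Rle_trans; [apply H; lia|exact IH]. }
  intros n; destruct (Compare_dec.le_lt_dec n n0) as [L|L]; [auto|].
  replace n with (n0 + (n - n0))%nat by lia; apply D.
Qed.

(** The ratio of consecutive coefficients tends to [1] in modulus, so they are dominated
    by every geometric sequence of ratio above [1]. Writing that ratio as [1 / (q * q)]
    avoids square roots, and bounds replace quotients because [g] may be a nonpositive
    integer, in which case the coefficients eventually vanish. *)
Lemma gauss_coef_bounded (g : C) (q : R) : 0 < q < 1 ->
  exists M, forall n, Cmod (gauss_coef g n) * (q * q) ^ n <= M.
Proof.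
  intros Hq.
  (* From [n >= |g| / (1 - q)] on, [q (|g| + n) <= n + 1]. *)
  destruct (nfloor_ex (Cmod g / (1 - q))) as [n0 [_ Hn0]].
  { apply Rdiv_le_0_compat; [apply Cmod_ge_0|lra]. }
  apply (eventually_nonincreasing_bounded _ (S n0)); intros n Hn.
  pose proof (gauss_coef_S_mod g n) as E.
  apply le_INR in Hn; rewrite S_INR in Hn.
  assert (Hc : Cmod g <= INR n * (1 - q)).
  { apply (Rmult_lt_compat_r (1 - q)) in Hn0; [|lra].
    unfold Rdiv in Hn0; rewrite Rmult_assoc, Rinv_l in Hn0 by lra.
    nra. }
  pose proof (pos_INR n). pose proof (Cmod_ge_0 g).
  pose proof (Cmod_ge_0 (gauss_coef g n)). pose proof (Cmod_ge_0 (gauss_coef g (S n))).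
  assert (Hq2 : q * (Cmod g + INR n) <= INR n + 1) by nra.
  assert (Hk : Cmod (gauss_coef g (S n)) * (q * q) <= Cmod (gauss_coef g n)).
  { apply (Rmult_le_reg_l ((INR n + 1) * (INR n + 1))); [nra|].
    apply Rle_trans with ((q * (Cmod g + INR n)) * (q * (Cmod g + INR n))
                          * Cmod (gauss_coef g n)).
    - replace ((q * (Cmod g + INR n)) * (q * (Cmod g + INR n)) * Cmod (gauss_coef g n))
        with ((q * q) * ((Cmod g + INR n) * (Cmod g + INR n) * Cmod (gauss_coef g n)))
        by ring.
      replace ((INR n + 1) * (INR n + 1) * (Cmod (gauss_coef g (S n)) * (q * q)))
        with ((q * q) * ((INR n + 1) * (INR n + 1) * Cmod (gauss_coef g (S n)))) by ring.
      apply Rmult_le_compat_l; [nra|exact E].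
    - apply Rmult_le_compat_r; [assumption|].
      apply Rmult_le_compat; nra. }
  replace (Cmod (gauss_coef g (S n)) * (q * q) ^ S n)
    with (Cmod (gauss_coef g (S n)) * (q * q) * (q * q) ^ n) by (simpl; ring).
  apply Rmult_le_compat_r; [apply pow_le; nra|exact Hk].
Qed.

Lemma CV_radius_gt_of_geom_bounded (a : nat -> R) (z : R) :
  (forall q, 0 < q < 1 -> exists M, forall n, Rabs (a n) * (q * q) ^ n <= M) ->
  Rabs z < 1 -> Rbar_lt (Rabs z) (CV_radius a).
Proof.
  intros H Hz.
  set (q := (Rabs z + 3) / 4).
  pose proof (Rabs_pos z) as Hz0.
  assert (Hq : 0 < q < 1) by (unfold q; lra).
  assert (Hqq : Rabs z < q * q) by (unfold q; nra).
  destruct (H q Hq) as [M HM].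
  apply Rbar_lt_le_trans with (Finite (q * q)); [exact Hqq|].
  apply (proj1 (CV_radius_bounded a)).
  exists M; intros n.
  rewrite Rabs_mult, <- RPow_abs, (Rabs_pos_eq (q * q)) by nra.
  apply HM.
Qed.

Lemma gauss_coef_Re_radius (g : C) (z : R) : Rabs z < 1 ->
  Rbar_lt (Rabs z) (CV_radius (fun n => Re (gauss_coef g n))).
Proof.
  apply CV_radius_gt_of_geom_bounded; intros q Hq.
  destruct (gauss_coef_bounded g q Hq) as [M HM]; exists M; intros n.
  eapply Rle_trans; [|apply (HM n)].
  apply Rmult_le_compat_r; [apply pow_le; nra|apply re_le_Cmod].
Qed.

Lemma im_le_Cmod (c : C) : Rabs (Im c) <= Cmod c.
Proof.
  eapply Rle_trans; [|apply Rmax_Cmod]. apply Rmax_r.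
Qed.

Lemma gauss_coef_Im_radius (g : C) (z : R) : Rabs z < 1 ->
  Rbar_lt (Rabs z) (CV_radius (fun n => Im (gauss_coef g n))).
Proof.
  apply CV_radius_gt_of_geom_bounded; intros q Hq.
  destruct (gauss_coef_bounded g q Hq) as [M HM]; exists M; intros n.
  eapply Rle_trans; [|apply (HM n)].
  apply Rmult_le_compat_r; [apply pow_le; nra|apply im_le_Cmod].
Qed.

Fixpoint PS_iter_derive (m : nat) (a : nat -> R) : nat -> R :=
  match m with O => a | S m => PS_derive (PS_iter_derive m a) end.

(** [m]-th derivative of the sum of the Gauss series [F (g, g; 1; z)] for real [z]. *)
Definition gauss (g : C) (m : nat) (z : R) : C :=
  (PSeries (PS_iter_derive m (fun n => Re (gauss_coef g n))) z,
   PSeries (PS_iter_derive m (fun n => Im (gauss_coef g n))) z).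

Lemma PS_iter_derive_radius (a : nat -> R) (m : nat) :
  CV_radius (PS_iter_derive m a) = CV_radius a.
Proof.
  induction m as [|m IH]; [reflexivity|]; simpl.
  rewrite CV_radius_derive; exact IH.
Qed.

Lemma Cderive_gauss (g : C) (m : nat) (z : R) : Rabs z < 1 ->
  is_Cderive (gauss g m) z (gauss g (S m) z).
Proof.
  intros Hz; split; apply is_derive_PSeries; rewrite PS_iter_derive_radius.
  - apply gauss_coef_Re_radius, Hz.
  - apply gauss_coef_Im_radius, Hz.
Qed.

Lemma is_pseries_PS_iter_derive (a : nat -> R) (m : nat) (z : R) :
  Rbar_lt (Rabs z) (CV_radius a) ->
  is_pseries (PS_iter_derive m a) z (PSeries (PS_iter_derive m a) z).
Proof.
  intros H; apply PSeries_correct, CV_radius_inside.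
  rewrite PS_iter_derive_radius; exact H.
Qed.

(** [ring] on equations whose type is only convertible to [R]. *)
Ltac Rring := match goal with |- ?x = ?y => change (@eq R x y) end; ring.
Lemma is_pseries_x_derive (a : nat -> R) (z l : R) :
  is_pseries (PS_derive a) z l ->
  is_pseries (fun n => INR n * a n) z (z * l).
Proof.
  intros H; apply is_pseries_incr_1 in H.
  eapply is_pseries_ext; [|exact H].
  intros [|n]; simpl; unfold PS_incr_1, PS_derive; simpl; [|reflexivity].
  change (0 = 0 * a 0%nat); ring.
Qed.

(** Real form of the hypergeometric equation: with [theta = z d/dz] it reads
    [d/dz (theta F) = (theta + g)^2 F], and [a], [b] are the real and imaginary parts of
    the coefficients for [g = p + i q]. Exchanging them and changing the sign of [q] gives
    the imaginary part. *)
Lemma gauss_ode_aux (a b : nat -> R) (p q z a0 a1 a2 b0 b1 : R) :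
  (forall n, (INR n + 1) * (INR n + 1) * a (S n)
     = (INR n * INR n + 2 * p * INR n + (p * p - q * q)) * a n
       - (2 * q * INR n + 2 * p * q) * b n) ->
  is_pseries a z a0 -> is_pseries (PS_derive a) z a1 ->
  is_pseries (PS_derive (PS_derive a)) z a2 ->
  is_pseries b z b0 -> is_pseries (PS_derive b) z b1 ->
  z * a2 + a1 = z * (z * a2) + z * a1 + 2 * p * (z * a1) + (p * p - q * q) * a0
    - 2 * q * (z * b1) - 2 * p * q * b0.
Proof.
  intros Hrec Ha Ha1 Ha2 Hb Hb1.
  assert (sc : forall c u l, is_pseries u z l ->
            is_pseries (fun n => c * u n) z (c * l)).
  { intros c u l H.
    apply (is_pseries_scal c u z l); [unfold mult; simpl; ring|exact H]. }
  assert (pl : forall u v l m, is_pseries u z l -> is_pseries v z m ->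
            is_pseries (fun n => u n + v n) z (l + m)).
  { intros u v l m H1 H2; exact (is_pseries_plus u v z l m H1 H2). }
  pose proof (is_pseries_x_derive _ _ _ Ha1) as X1.
  pose proof (is_pseries_x_derive _ _ _ Ha2) as X2.
  pose proof (is_pseries_x_derive _ _ _ Hb1) as Y1.
  assert (X3 : is_pseries (fun n => INR n * (INR n * a n)) z (z * (z * a2 + a1))).
  { apply is_pseries_x_derive.
    eapply is_pseries_ext; [|apply (pl _ _ _ _ X2 Ha1)].
    intros n; unfold PS_derive; rewrite !S_INR; Rring. }
  pose proof (pl _ _ _ _ X2 Ha1) as L.
  pose proof (pl _ _ _ _ X3 (pl _ _ _ _ (sc (2 * p) _ _ X1)
     (pl _ _ _ _ (sc (p * p - q * q) _ _ Ha)
      (pl _ _ _ _ (sc (- 2 * q) _ _ Y1) (sc (- 2 * p * q) _ _ Hb))))) as Rr.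
  apply is_pseries_unique in L; apply is_pseries_unique in Rr.
  match type of L with PSeries ?f _ = _ =>
    match type of Rr with PSeries ?g _ = _ =>
      assert (E : PSeries f z = PSeries g z) end end.
  { apply PSeries_ext; intros n.
    unfold PS_derive; rewrite !S_INR.
    pose proof (Hrec n) as Hn; lra. }
  rewrite L, Rr in E; rewrite E; ring.
Qed.

Lemma gauss_ode (g : C) (z : R) : Rabs z < 1 ->
  (RtoC z * gauss g 2 z + gauss g 1 z
   = RtoC z * (RtoC z * gauss g 2 z) + RtoC z * gauss g 1 z
     + RtoC 2 * g * (RtoC z * gauss g 1 z) + g * g * gauss g 0 z)%C.
Proof.
  intros Hz.
  assert (HR := gauss_coef_Re_radius g z Hz); assert (HI := gauss_coef_Im_radius g z Hz).
  destruct g as [p q].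
  pose proof (fun m => is_pseries_PS_iter_derive _ m z HR) as SR.
  pose proof (fun m => is_pseries_PS_iter_derive _ m z HI) as SI.
  assert (EC : forall n,
    (INR n + 1) * (INR n + 1) * Re (gauss_coef (p, q) (S n))
     = (INR n * INR n + 2 * p * INR n + (p * p - q * q)) * Re (gauss_coef (p, q) n)
       - (2 * q * INR n + 2 * p * q) * Im (gauss_coef (p, q) n) /\
    (INR n + 1) * (INR n + 1) * Im (gauss_coef (p, q) (S n))
     = (INR n * INR n + 2 * p * INR n + (p * p - q * q)) * Im (gauss_coef (p, q) n)
       + (2 * q * INR n + 2 * p * q) * Re (gauss_coef (p, q) n)).
  { intros n; pose proof (gauss_coef_S (p, q) n) as H.
    destruct (gauss_coef (p, q) n) as [x y], (gauss_coef (p, q) (S n)) as [x' y'].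
    unfold Cmult, Cplus, RtoC in H; simpl in H.
    injection H as H1 H2; simpl; split; lra. }
  pose proof (gauss_ode_aux _ _ p q z _ _ _ _ _ (fun n => proj1 (EC n))
     (SR 0%nat) (SR 1%nat) (SR 2%nat) (SI 0%nat) (SI 1%nat)) as E1.
  assert (EC2 : forall n,
    (INR n + 1) * (INR n + 1) * Im (gauss_coef (p, q) (S n))
     = (INR n * INR n + 2 * p * INR n + (p * p - - q * - q)) * Im (gauss_coef (p, q) n)
       - (2 * - q * INR n + 2 * p * - q) * Re (gauss_coef (p, q) n)).
  { intros n; rewrite (proj2 (EC n)); ring. }
  pose proof (gauss_ode_aux _ _ p (- q) z _ _ _ _ _ EC2
     (SI 0%nat) (SI 1%nat) (SI 2%nat) (SR 0%nat) (SR 1%nat)) as E2.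
  unfold gauss, Cmult, Cplus, RtoC; apply injective_projections; cbn [fst snd]; cbv beta.
  - cbv beta in E1. lra.
  - cbv beta in E2. lra.
Qed.

Lemma pow_n_RtoC (z : R) (n : nat) :
  pow_n (K := C_Ring) (RtoC z) n = RtoC (z ^ n).
Proof.
  induction n as [|n IH]; [reflexivity|].
  simpl; rewrite IH, RtoC_mult; reflexivity.
Qed.

Lemma sum_n_C (u : nat -> C) (n : nat) :
  sum_n (G := C_AbelianMonoid) u n
  = (sum_n (fun k => Re (u k)) n, sum_n (fun k => Im (u k)) n).
Proof.
  induction n as [|n IH].
  - rewrite !sum_O; unfold Re, Im; apply surjective_pairing.
  - rewrite !sum_Sn, IH; reflexivity.
Qed.

Lemma is_pseries_C (a : nat -> C) (z l m : R) :
  is_pseries (fun n => Re (a n)) z l -> is_pseries (fun n => Im (a n)) z m ->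
  is_pseries (K := C_AbsRing) (V := C_NormedModule) a (RtoC z) (l, m).
Proof.
  intros H1 H2; unfold is_pseries, is_series in *.
  eapply filterlim_ext.
  { intros n; symmetry; apply sum_n_C. }
  eapply (filterlim_filter_le_2 (G := filter_prod (locally l) (locally m))).
  2: apply filterlim_pair.
  - intros P [eps HP]. 
    eapply Filter_prod with (Q := ball l eps) (R := ball m eps).
    + apply locally_ball.
    + apply locally_ball.
    + intros x y Hx Hy; apply HP; split; assumption.
  - eapply filterlim_ext; [|exact H1].
    intros n; apply sum_n_ext; intros k; rewrite pow_n_RtoC.
    unfold scal; simpl; unfold mult; simpl; rewrite pow_n_pow; unfold Re, Im; Rring.
  - eapply filterlim_ext; [|exact H2].
    intros n; apply sum_n_ext; intros k; rewrite pow_n_RtoC.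
    unfold scal; simpl; unfold mult; simpl; rewrite pow_n_pow; unfold Re, Im; Rring.
Qed.

Lemma hypergeom_gauss (g : C) (z : R) : Rabs z < 1 ->
  hypergeom g g (RtoC 1) (RtoC z) = gauss g 0 z.
Proof.
  intros Hz; unfold hypergeom.
  assert (P : is_pseries (K := C_AbsRing) (V := C_NormedModule) (gauss_coef g) (RtoC z)
                (gauss g 0 z)).
  { apply is_pseries_C; apply (is_pseries_PS_iter_derive _ 0);
      [apply gauss_coef_Re_radius|apply gauss_coef_Im_radius]; exact Hz. }
  apply (iota_unique (V := C_CompleteNormedModule)); [|exact P].
  intros y Hy.
  exact (filterlim_locally_unique (K := C_AbsRing) (V := C_NormedModule)
    (F := eventually) _ y (gauss g 0 z) Hy P).
Qed.

(** * The regular Legendre function *)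

(** Pfaff's transformation of the Gauss series, [F (g, 1 - g; 1; - t)], and its first two
    derivatives. *)
Definition pfaff (g : C) (t : R) : C :=
  (RCpower (1 + t) (- g) * gauss g 0 (t / (1 + t)))%C.

Definition pfaff1 (g : C) (t : R) : C :=
  (RCpower (1 + t) (- g)
   * (- g * RtoC (/ (1 + t)) * gauss g 0 (t / (1 + t))
      + RtoC (/ (1 + t) ^ 2) * gauss g 1 (t / (1 + t))))%C.

Definition pfaff2 (g : C) (t : R) : C :=
  (RCpower (1 + t) (- g)
   * (g * (g + 1) * RtoC (/ (1 + t) ^ 2) * gauss g 0 (t / (1 + t))
      + - (2 * g + 2) * RtoC (/ (1 + t) ^ 3) * gauss g 1 (t / (1 + t))
      + RtoC (/ (1 + t) ^ 4) * gauss g 2 (t / (1 + t))))%C.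

(** The threshold [- 1 / 2] leaves room on both sides of [t = 0], the value on the
    characteristics. *)
Lemma pfaff_arg_lt1 (t : R) : - (1 / 2) < t -> Rabs (t / (1 + t)) < 1.
Proof.
  intros Ht; apply Rabs_def1.
  - apply (Rmult_lt_reg_r (1 + t)); [lra|].
    unfold Rdiv; rewrite Rmult_assoc, Rinv_l; lra.
  - apply (Rmult_lt_reg_r (1 + t)); [lra|].
    unfold Rdiv; rewrite Rmult_assoc, Rinv_l; lra.
Qed.

Lemma Cderive_gauss_arg (g : C) (m : nat) (t : R) : - (1 / 2) < t ->
  is_Cderive (fun t => gauss g m (t / (1 + t))) t
    (gauss g (S m) (t / (1 + t)) * RtoC (/ (1 + t) ^ 2))%C.
Proof.
  intros Ht; apply (Cderive_comp (gauss g m) (fun t => t / (1 + t))).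
  - apply Cderive_gauss, pfaff_arg_lt1, Ht.
  - auto_derive; [lra|]. field; lra.
Qed.

Lemma Cderive_shifted_power (g : C) (t : R) : - (1 / 2) < t ->
  is_Cderive (fun t => RCpower (1 + t) g) t
    (g * RCpower (1 + t) g * RtoC (/ (1 + t)))%C.
Proof.
  intros Ht; eapply Cderive_eq.
  - apply (Cderive_comp (fun x => RCpower x g) (fun t => 1 + t) t 1).
    + apply Cderive_RCpower; lra.
    + auto_derive; [exact I|ring].
  - rewrite RtoC_inv by lra. field. apply RtoC_neq0; lra.
Qed.

Lemma Cderive_inv_pow (m : nat) (t : R) : - (1 / 2) < t ->
  is_Cderive (fun t => RtoC (/ (1 + t) ^ m)) t (RtoC (- INR m * / (1 + t) ^ S m)).
Proof.
  intros Ht; apply Cderive_RtoC.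
  assert (Hp : (1 + t) ^ m <> 0) by (apply pow_nonzero; lra).
  auto_derive; [exact Hp|].
  destruct m as [|m]; [simpl; field; lra|].
  cbn [Init.Nat.pred]; rewrite S_INR in *; simpl pow in *.
  field; split; [|lra]. intros E; apply Hp; rewrite E; ring.
Qed.

Lemma Cderive_pfaff (g : C) (t : R) : - (1 / 2) < t ->
  is_Cderive (pfaff g) t (pfaff1 g t).
Proof.
  intros Ht; eapply Cderive_eq.
  - apply Cderive_mult; [apply Cderive_shifted_power|apply Cderive_gauss_arg]; exact Ht.
  - unfold pfaff1; ring.
Qed.

Lemma Cderive_pfaff1 (g : C) (t : R) : - (1 / 2) < t ->
  is_Cderive (pfaff1 g) t (pfaff2 g t).
Proof.
  intros Ht; eapply Cderive_eq.
  - apply Cderive_mult; [apply Cderive_shifted_power; exact Ht|].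
    apply Cderive_plus.
    + apply Cderive_mult; [|apply Cderive_gauss_arg; exact Ht].
      apply Cderive_mult; [apply Cderive_const|].
      eapply Cderive_eq; [apply Cderive_RtoC; auto_derive; [lra|reflexivity]|reflexivity].
    + apply Cderive_mult; [apply Cderive_inv_pow|apply Cderive_gauss_arg]; exact Ht.
  - unfold pfaff2; simpl INR.
    assert (Hw : RtoC (1 + t) <> 0%C) by (apply RtoC_neq0; lra).
    rewrite ?RtoC_mult, ?RtoC_opp, !RtoC_inv, ?RtoC_pow, ?RtoC_mult, !RtoC_plus in *
      by first [lra | apply pow_nonzero; lra | apply Rgt_not_eq; nra].
    field; exact Hw.
Qed.

Lemma Cderive_pfaff2 (g : C) (t : R) : - (1 / 2) < t ->
  exists l, is_Cderive (pfaff2 g) t l.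
Proof.
  intros Ht; eexists.
  apply Cderive_mult; [apply Cderive_shifted_power; exact Ht|].
  apply Cderive_plus; [apply Cderive_plus|];
    (apply Cderive_mult; [|apply Cderive_gauss_arg; exact Ht]).
  - apply Cderive_mult; [apply Cderive_const|apply Cderive_inv_pow; exact Ht].
  - apply Cderive_mult; [apply Cderive_const|apply Cderive_inv_pow; exact Ht].
  - apply Cderive_inv_pow; exact Ht.
Qed.

Lemma pfaff_ode (g : C) (t : R) : - (1 / 2) < t ->
  (RtoC (t * (1 + t)) * pfaff2 g t + RtoC (1 + 2 * t) * pfaff1 g t
   + g * (1 - g) * pfaff g t)%C = RtoC 0.
Proof.
  intros Ht; pose proof (gauss_ode g _ (pfaff_arg_lt1 t Ht)) as H.
  unfold pfaff, pfaff1, pfaff2.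
  set (z := t / (1 + t)) in *.
  generalize dependent (gauss g 0 z); generalize dependent (gauss g 1 z).
  generalize dependent (gauss g 2 z); intros G2 G1 G0 H.
  generalize (RCpower (1 + t) (- g)); intros pw.
  assert (Hw : RtoC (1 + t) <> 0%C) by (apply RtoC_neq0; lra).
  assert (Hz : RtoC z = (RtoC t / RtoC (1 + t))%C).
  { unfold z; rewrite RtoC_div by lra; reflexivity. }
  rewrite Hz in H.
  rewrite !RtoC_inv, ?RtoC_pow, ?RtoC_mult by (try apply pow_nonzero; lra).
  rewrite !RtoC_plus, RtoC_mult in *.
  generalize dependent (RtoC t); intros x H Hw.
  match type of H with ?L = ?R =>
    transitivity (pw / (RtoC 1 + x) * (L - R))%C end.
  - field; exact Hw.
  - rewrite H; field; exact Hw.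
Qed.

(** [e t * exp (- K t)] is nonincreasing. *)
Lemma gronwall_nonpos (e e' : R -> R) (K T : R) : 0 <= T ->
  (forall t, 0 <= t <= T -> is_derive e t (e' t)) ->
  (forall t, 0 <= t <= T -> e' t <= K * e t) ->
  e 0 = 0 -> e T <= 0.
Proof.
  intros HT He Hle H0.
  destruct (Req_dec T 0) as [->|HT0]; [lra|].
  destruct (MVT_gen (fun t => e t * exp (- K * t)) 0 T
     (fun t => (e' t - K * e t) * exp (- K * t))) as [c [Hc E]].
  - rewrite Rmin_left, Rmax_right by lra; intros x Hx.
    eapply is_derive_eq.
    + apply Derive.is_derive_mult; [apply He; lra|].
      auto_derive; [exact I|reflexivity].
    + cbv beta; ring.
  - rewrite Rmin_left, Rmax_right by lra; intros x Hx.
    apply continuity_pt_mult.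
    + apply continuity_pt_filterlim, (ex_derive_continuous e).
      exists (e' x); apply He; lra.
    + apply continuity_pt_filterlim, (ex_derive_continuous (fun t => exp (- K * t))).
      auto_derive; exact I.
  - rewrite Rmin_left, Rmax_right in Hc by lra.
    rewrite H0 in E.
    assert (Hneg : e' c - K * e c <= 0) by (specialize (Hle c Hc); lra).
    pose proof (exp_pos (- K * c)) as P1; pose proof (exp_pos (- K * T)) as P2.
    apply (Rmult_le_reg_r (exp (- K * T))); [exact P2|].
    assert (0 <= (K * e c - e' c) * exp (- K * c) * T)
      by (repeat apply Rmult_le_pos; lra).
    lra.
Qed.

(** The energy [t (1 + t) f'^2 + f^2] satisfies a Gronwall inequality, and it vanishes at
    [0] because its first term degenerates there: the singular point takes the place of
    the missing condition on [f' 0]. *)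
Lemma legendre_regular_unique (N : R) (f f1 f2 : R -> R) :
  (forall t, 0 <= t -> is_derive f t (f1 t)) ->
  (forall t, 0 <= t -> is_derive f1 t (f2 t)) ->
  (forall t, 0 <= t ->
     t * (1 + t) * f2 t + (1 + 2 * t) * f1 t + N * f t = 0) ->
  f 0 = 0 -> forall t, 0 <= t -> f t = 0.
Proof.
  intros D1 D2 ODE H0 T HT.
  set (e := fun t => t * (1 + t) * (f1 t) ^ 2 + (f t) ^ 2).
  assert (He : e T <= 0).
  { apply (gronwall_nonpos e
      (fun t => (1 + 2 * t) * (f1 t) ^ 2 + t * (1 + t) * (2 * f1 t * f2 t)
                + 2 * f t * f1 t) ((1 - N) ^ 2) T HT).
    - intros t Ht; unfold e.
      pose proof (D1 t (proj1 Ht)) as A1; pose proof (D2 t (proj1 Ht)) as A2.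
      auto_derive.
      + split; [exists (f2 t); exact A2|split; [exists (f1 t); exact A1|exact I]].
      + rewrite (Derive_val f t _ A1), (Derive_val f1 t _ A2); ring.
    - intros t Ht; unfold e.
      pose proof (ODE t (proj1 Ht)) as O.
      assert (E : t * (1 + t) * (2 * f1 t * f2 t)
                  = 2 * f1 t * (- (1 + 2 * t) * f1 t - N * f t)).
      { replace (- (1 + 2 * t) * f1 t - N * f t) with (t * (1 + t) * f2 t) by lra.
        ring. }
      rewrite E.
      pose proof (pow2_ge_0 (f1 t - (1 - N) * f t)).
      pose proof (pow2_ge_0 (f1 t)). pose proof (pow2_ge_0 (f t)).
      pose proof (pow2_ge_0 (1 - N)).
      assert (0 <= (1 - N) ^ 2 * (t * (1 + t) * f1 t ^ 2)).
      { apply Rmult_le_pos; [assumption|]. apply Rmult_le_pos; [nra|assumption]. }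
      assert (0 <= t * f1 t ^ 2) by (apply Rmult_le_pos; [lra|assumption]).
      nra.
    - unfold e; rewrite H0; ring. }
  unfold e in He.
  assert (0 <= T * (1 + T) * f1 T ^ 2).
  { apply Rmult_le_pos; [nra|apply pow2_ge_0]. }
  pose proof (pow2_ge_0 (f T)).
  apply Rsqr_0_uniq; unfold Rsqr; simpl in *; lra.
Qed.

Lemma gauss_0 (g : C) : gauss g 0 0 = RtoC 1.
Proof.
  unfold gauss; cbn [PS_iter_derive]; rewrite !PSeries_0.
  cbv beta; rewrite gauss_coef_0; reflexivity.
Qed.

Lemma real_combination_eq0 (x y N : R) (a b c : C) :
  (RtoC x * a + RtoC y * b + RtoC N * c)%C = RtoC 0 ->
  x * Re a + y * Re b + N * Re c = 0 /\ x * Im a + y * Im b + N * Im c = 0.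
Proof.
  destruct a as [a1 a2], b as [b1 b2], c as [c1 c2].
  unfold Cmult, Cplus, RtoC; simpl; intros H; injection H as H1 H2; lra.
Qed.

(** The Legendre function [F (g, 1 - g; 1; - t)] with [N = g (1 - g)], known only through
    its equation, its value at [0] and its regularity at that singular point. *)
Record riemann_profile (N : R) (Phi Phi1 Phi2 : R -> R) : Prop := {
  rp_d1 : forall t, - (1 / 2) < t -> is_derive Phi t (Phi1 t);
  rp_d2 : forall t, - (1 / 2) < t -> is_derive Phi1 t (Phi2 t);
  rp_c2 : forall t, - (1 / 2) < t -> continuous Phi2 t;
  rp_ode : forall t, - (1 / 2) < t ->
     t * (1 + t) * Phi2 t + (1 + 2 * t) * Phi1 t + N * Phi t = 0;
  rp_0 : Phi 0 = 1 }.

(** The Pfaff transform is real: its imaginary part is the regular solution with value [0]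
    at [0]. *)
Lemma riemann_profile_exists (g : C) (N : R) :
  (g * (1 - g))%C = RtoC N ->
  exists Phi Phi1 Phi2 : R -> R, riemann_profile N Phi Phi1 Phi2 /\
    forall t, 0 <= t ->
      (RCpower (1 + t) (- g) * hypergeom g g (RtoC 1) (RtoC (t / (1 + t))))%C
      = RtoC (Phi t).
Proof.
  intros HN.
  assert (O : forall t, - (1 / 2) < t ->
    (RtoC (t * (1 + t)) * pfaff2 g t + RtoC (1 + 2 * t) * pfaff1 g t
   + RtoC N * pfaff g t)%C = RtoC 0).
  { intros t Ht; rewrite <- HN; apply pfaff_ode, Ht. }
  assert (E0 : pfaff g 0 = RtoC 1).
  { unfold pfaff; replace (0 / (1 + 0)) with 0 by field.
    rewrite gauss_0; unfold RCpower.
    rewrite Rplus_0_r, ln_1, !Rmult_0_r, exp_0, cos_0, sin_0.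
    rewrite Rmult_1_l, Rmult_1_l; fold (RtoC 1); ring. }
  exists (fun t => Re (pfaff g t)), (fun t => Re (pfaff1 g t)),
    (fun t => Re (pfaff2 g t)); split; [split|].
  - intros t Ht; apply Cderive_pfaff, Ht.
  - intros t Ht; apply Cderive_pfaff1, Ht.
  - intros t Ht; destruct (Cderive_pfaff2 g t Ht) as [l [H _]].
    apply (ex_derive_continuous (fun t => Re (pfaff2 g t))); exists (Re l); exact H.
  - intros t Ht; apply real_combination_eq0, O, Ht.
  - rewrite E0; reflexivity.
  - intros t Ht; rewrite hypergeom_gauss by (apply pfaff_arg_lt1; lra).
    change (pfaff g t = RtoC (Re (pfaff g t))).
    apply injective_projections; [reflexivity|].
    change (Im (pfaff g t) = 0).
    apply (legendre_regular_unique N (fun t => Im (pfaff g t))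
      (fun t => Im (pfaff1 g t)) (fun t => Im (pfaff2 g t))); [| | | |exact Ht].
    + intros s Hs; apply Cderive_pfaff; lra.
    + intros s Hs; apply Cderive_pfaff1; lra.
    + intros s Hs; assert (Hs' : - (1 / 2) < s) by lra.
      apply real_combination_eq0, O, Hs'.
    + rewrite E0; reflexivity.
Qed.

(** * Joint continuity and integrals depending on a parameter *)

(** The parameter ranges over any uniform space, so that the same statements serve for
    one or two parameters. *)
Definition jcont {U : UniformSpace} (f : U -> R -> R) (p : U) (y : R) : Prop :=
  continuous (fun q : U * R => f (fst q) (snd q)) (p, y).

Lemma cont_fst {U V : UniformSpace} (p : U * V) : continuous fst p.
Proof. destruct p; apply continuous_fst. Qed.

Lemma cont_snd {U V : UniformSpace} (p : U * V) : continuous snd p.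
Proof. destruct p; apply continuous_snd. Qed.

Lemma cont_pair {T U V : UniformSpace} (f : T -> U) (g : T -> V) (t : T) :
  continuous f t -> continuous g t -> continuous (fun t => (f t, g t)) t.
Proof.
  intros Hf Hg P [eps HP].
  assert (A1 := Hf _ (locally_ball (f t) eps)).
  assert (A2 := Hg _ (locally_ball (g t) eps)).
  unfold filtermap in *.
  generalize (filter_and _ _ A1 A2); apply filter_imp.
  intros x [B1 B2]; apply HP; split; assumption.
Qed.

Lemma jcont_comp {T U : UniformSpace} (f : U -> R -> R) (a : T -> U) (b : T -> R)
  (t : T) :
  jcont f (a t) (b t) -> continuous a t -> continuous b t ->
  continuous (fun t => f (a t) (b t)) t.
Proof.
  intros Hf Ha Hb.
  apply (continuous_comp (fun t => (a t, b t))
    (fun q : U * R => f (fst q) (snd q))); [apply cont_pair; assumption|exact Hf].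
Qed.

Lemma jcont_snd {U : UniformSpace} (f : U -> R -> R) (p : U) (y : R) :
  jcont f p y -> continuous (f p) y.
Proof.
  intros H; apply (jcont_comp f (fun _ => p) (fun y => y)); [exact H| |].
  - apply continuous_const.
  - apply continuous_id.
Qed.

(** Tube lemma: by compactness of [[0, 1]], continuity along [{p} x [0, 1]] is uniform in
    the parameter. *)
Lemma jcont_tube {U : UniformSpace} (f : U -> R -> R) (p : U) :
  (forall y, 0 <= y <= 1 -> jcont f p y) ->
  forall eps : posreal,
  locally p (fun q => forall y, 0 <= y <= 1 -> Rabs (f q y - f p y) <= eps).
Proof.
  intros H eps.
  assert (D : forall y, exists d : posreal, 0 <= y <= 1 ->
     forall q z, ball p d q -> Rabs (z - y) < d -> Rabs (f q z - f p y) < eps / 2).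
  { intros y; destruct (Rle_dec 0 y) as [h0|h0].
    2: exists (mkposreal 1 Rlt_0_1); intros [? _]; contradiction.
    destruct (Rle_dec y 1) as [h1|h1].
    2: exists (mkposreal 1 Rlt_0_1); intros [_ ?]; contradiction.
    assert (He : 0 < eps / 2) by (pose proof (cond_pos eps); lra).
    destruct (H y (conj h0 h1) _ (locally_ball (f p y) (mkposreal _ He)))
      as [d Hd].
    exists d; intros _ q z Hq Hz.
    apply (Hd (q, z)); split; assumption. }
  set (delta := fun y => proj1_sig (constructive_indefinite_description _ (D y))).
  assert (Hdelta := fun y => proj2_sig (constructive_indefinite_description _ (D y))).
  destruct (compactness_value_1d 0 1 delta) as [d Hd].
  exists d; intros q Hq y Hy.
  destruct (Rle_dec (Rabs (f q y - f p y)) eps) as [h|h]; [exact h|exfalso].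
  apply (Hd y Hy); intros [t [Ht [Hyt Hdt]]].
  apply h.
  assert (B1 : Rabs (f q y - f p t) < eps / 2).
  { apply (Hdelta t Ht); [|exact Hyt]. eapply ball_le; [exact Hdt|exact Hq]. }
  assert (B2 : Rabs (f p y - f p t) < eps / 2).
  { apply (Hdelta t Ht); [|exact Hyt]. apply ball_center. }
  replace (f q y - f p y) with ((f q y - f p t) - (f p y - f p t)) by ring.
  eapply Rle_trans; [apply Rabs_triang|]. rewrite Rabs_Ropp. lra.
Qed.

Lemma continuous_RInt_01 {U : UniformSpace} (f : U -> R -> R) (p : U) :
  (forall q y, 0 <= y <= 1 -> jcont f q y) ->
  continuous (fun q => RInt (f q) 0 1) p.
Proof.
  intros H.
  assert (Hex : forall q, ex_RInt (f q) 0 1).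
  { intros q; apply (ex_RInt_continuous (V := R_CompleteNormedModule)).
    rewrite Rmin_left, Rmax_right by lra.
    intros z Hz; apply jcont_snd, H, Hz. }
  intros P [eps HP].
  assert (He : 0 < eps / 2) by (pose proof (cond_pos eps); lra).
  change (locally p (fun q => P (RInt (f q) 0 1))).
  generalize (jcont_tube f p (H p) (mkposreal _ He)); apply filter_imp.
  intros q Hq; apply HP; simpl in Hq.
  change (Rabs (RInt (f q) 0 1 - RInt (f p) 0 1) < eps).
  apply Rle_lt_trans with ((1 - 0) * (eps / 2)); [|pose proof (cond_pos eps); lra].
  rewrite <- (RInt_minus (V := R_CompleteNormedModule)) by apply Hex.
  apply abs_RInt_le_const; [lra| |exact Hq].
  apply (ex_RInt_minus (V := R_CompleteNormedModule)); apply Hex.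
Qed.

(** Rescaling the interval of integration to [[0, 1]] reduces to fixed bounds. *)
Lemma continuous_RInt_param {U : UniformSpace} (f : U -> R -> R) (a b : U -> R)
  (p : U) :
  (forall q, continuous a q) -> (forall q, continuous b q) ->
  (forall q y, Rmin (a q) (b q) <= y <= Rmax (a q) (b q) -> jcont f q y) ->
  continuous (fun q => RInt (f q) (a q) (b q)) p.
Proof.
  intros Ha Hb Hf.
  assert (Hseg : forall q y, 0 <= y <= 1 ->
    Rmin (a q) (b q) <= (b q - a q) * y + a q <= Rmax (a q) (b q)).
  { intros q y Hy; destruct (Rle_dec (a q) (b q)).
    - rewrite Rmin_left, Rmax_right by lra; nra.
    - rewrite Rmin_right, Rmax_left by lra; nra. }
  apply (continuous_ext
    (fun q => RInt (fun y => (b q - a q) * f q ((b q - a q) * y + a q)) 0 1)).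
  { intros q.
    pose proof (RInt_comp_lin (V := R_CompleteNormedModule) (f q) (b q - a q) (a q) 0 1)
      as E.
    replace ((b q - a q) * 0 + a q) with (a q) in E by ring.
    replace ((b q - a q) * 1 + a q) with (b q) in E by ring.
    apply E, (ex_RInt_continuous (V := R_CompleteNormedModule)).
    intros z Hz; apply jcont_snd, Hf, Hz. }
  apply continuous_RInt_01; intros q y Hy; unfold jcont.
  assert (Ca : continuous (fun r : U * R => a (fst r)) (q, y)).
  { apply (continuous_comp fst a); [apply cont_fst|apply Ha]. }
  assert (Cb : continuous (fun r : U * R => b (fst r)) (q, y)).
  { apply (continuous_comp fst b); [apply cont_fst|apply Hb]. }
  assert (Cd : continuous (fun r : U * R => b (fst r) - a (fst r)) (q, y)).
  { apply (continuous_minus (V := R_NormedModule)); assumption. }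
  apply (continuous_mult (K := R_AbsRing)); [exact Cd|].
  apply (jcont_comp f (fun r : U * R => fst r)
    (fun r => (b (fst r) - a (fst r)) * snd r + a (fst r))).
  - apply Hf, Hseg, Hy.
  - apply cont_fst.
  - apply (continuous_plus (V := R_NormedModule)); [|exact Ca].
    apply (continuous_mult (K := R_AbsRing)); [exact Cd|apply cont_snd].
Qed.

Lemma jcont_2d (f : R -> R -> R) (x y : R) : jcont f x y <-> continuity_2d_pt f x y.
Proof. symmetry; apply continuity_2d_pt_filterlim. Qed.

(** Leibniz's rule. The regularity is required only near the interval of integration: the
    Riemann function is smooth on a neighbourhood of the characteristic triangle but not
    on the plane. *)
Lemma is_derive_RInt_moving (f f1 : R -> R -> R) (a b : R -> R) (x da db : R)
  (eps : posreal) :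
  a x <= b x -> is_derive a x da -> is_derive b x db ->
  (forall z y, Rabs (z - x) < eps -> a x - eps <= y <= b x + eps ->
     is_derive (fun z => f z y) z (f1 z y) /\ jcont f1 z y /\
     continuous (f z) y) ->
  is_derive (fun z => RInt (f z) (a z) (b z)) x
    (RInt (f1 x) (a x) (b x) - f x (a x) * da + f x (b x) * db).
Proof.
  intros Hab Da Db H.
  assert (He := cond_pos eps).
  assert (Hx : Rabs (x - x) < eps).
  { replace (x - x) with 0 by ring; rewrite Rabs_R0; exact He. }
  assert (Hh : 0 < eps / 2) by lra.
  set (e2 := mkposreal _ Hh).
  assert (Ex : forall u v z, a x - eps <= u -> u <= v -> v <= b x + eps ->
    Rabs (z - x) < eps -> ex_RInt (f z) u v).
  { intros u v z h1 h2 h3 hz.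
    apply (ex_RInt_continuous (V := R_CompleteNormedModule)).
    rewrite Rmin_left, Rmax_right by assumption.
    intros y Hy; apply H; [exact hz|lra]. }
  assert (Lx : locally x (fun z => Rabs (z - x) < eps)) by (exists eps; tauto).
  assert (DD : forall z y, Rabs (z - x) < eps -> a x - eps < y < b x + eps ->
     continuity_2d_pt (fun u v => Derive (fun z => f z v) u) z y).
  { intros z y Hz Hy.
    apply (continuity_2d_pt_ext_loc f1).
    - set (d := Rmin (eps - Rabs (z - x)) (Rmin (y - (a x - eps)) (b x + eps - y))).
      assert (Hd : 0 < d) by (unfold d; repeat apply Rmin_pos; lra).
      exists (mkposreal _ Hd); intros u v Hu Hv; simpl in Hu, Hv.
      assert (d <= eps - Rabs (z - x)) by apply Rmin_l.
      assert (d <= y - (a x - eps)).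
      { eapply Rle_trans; [apply Rmin_r|apply Rmin_l]. }
      assert (d <= b x + eps - y).
      { eapply Rle_trans; [apply Rmin_r|apply Rmin_r]. }
      symmetry; apply is_derive_unique, H.
      + replace (u - x) with ((u - z) + (z - x)) by ring.
        eapply Rle_lt_trans; [apply Rabs_triang|lra].
      + apply Rabs_def2 in Hv; lra.
    - apply jcont_2d, H; [exact Hz|lra]. }
  assert (L2 : forall y, a x <= y <= b x -> locally_2d (fun x' t =>
     continuity_2d_pt (fun u v : R => Derive (fun z : R => f z v) u) x' t) x y).
  { intros y Hy; exists e2; simpl; intros u v Hu Hv; apply DD; [lra|].
    apply Rabs_def2 in Hv; lra. }
  eapply is_derive_eq.
  { apply (is_derive_RInt_param_bound_comp f a b x da db); try assumption.
    - revert Lx; apply filter_imp; intros z Hz; apply Ex; lra.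
    - exists e2; simpl. revert Lx; apply filter_imp; intros z Hz; apply Ex; lra.
    - exists e2; simpl. revert Lx; apply filter_imp; intros z Hz; apply Ex; lra.
    - exists e2; simpl. revert Lx; apply filter_imp; intros z Hz t.
      rewrite Rmin_left, Rmax_right by lra; intros Ht.
      exists (f1 z t); apply H; lra.
    - rewrite Rmin_left, Rmax_right by lra; intros t Ht; apply DD; lra.
    - apply L2; lra.
    - apply L2; lra.
    - apply continuity_pt_filterlim, H; lra.
    - apply continuity_pt_filterlim, H; lra. }
  assert (E : RInt (fun t => Derive (fun u => f u t) x) (a x) (b x)
              = RInt (f1 x) (a x) (b x)).
  { apply RInt_ext; rewrite Rmin_left, Rmax_right by assumption.
    intros t Ht; apply is_derive_unique, H; lra. }
  rewrite E; ring.
Qed.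

(** Continuity of one partial derivative is enough for differentiability in two
    variables, hence for the chain rule along a curve. *)
Lemma is_derive_along (f f1 : R -> R -> R) (a b : R -> R) (x da db l2 : R) :
  is_derive a x da -> is_derive b x db ->
  locally (a x, b x)
    (fun q : R * R => is_derive (fun z => f z (snd q)) (fst q) (f1 (fst q) (snd q))) ->
  jcont f1 (a x) (b x) ->
  is_derive (f (a x)) (b x) l2 ->
  is_derive (fun z => f (a z) (b z)) x (f1 (a x) (b x) * da + l2 * db).
Proof.
  intros Da Db H1 C1 H2.
  apply is_derive_Reals.
  apply (derivable_pt_lim_comp_2d f a b x); try (apply is_derive_Reals; assumption).
  apply filterdiff_differentiable_pt_lim.
  exact (is_derive_filterdiff f (a x) (b x) f1 l2 H1 H2 C1).
Qed.

Lemma cont_plus {T : UniformSpace} (f g : T -> R) (t : T) :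
  continuous f t -> continuous g t -> continuous (fun t => f t + g t) t.
Proof. apply (continuous_plus (V := R_NormedModule)). Qed.

Lemma cont_minus {T : UniformSpace} (f g : T -> R) (t : T) :
  continuous f t -> continuous g t -> continuous (fun t => f t - g t) t.
Proof. apply (continuous_minus (V := R_NormedModule)). Qed.

Lemma cont_opp {T : UniformSpace} (f : T -> R) (t : T) :
  continuous f t -> continuous (fun t => - f t) t.
Proof. apply (continuous_opp (V := R_NormedModule)). Qed.

Lemma cont_mult {T : UniformSpace} (f g : T -> R) (t : T) :
  continuous f t -> continuous g t -> continuous (fun t => f t * g t) t.
Proof. apply (continuous_mult (K := R_AbsRing)). Qed.

Lemma cont_div {T : UniformSpace} (f g : T -> R) (t : T) :
  g t <> 0 -> continuous f t -> continuous g t -> continuous (fun t => f t / g t) t.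
Proof.
  intros H Hf Hg; apply cont_mult; [exact Hf|].
  apply (continuous_comp g Rinv); [exact Hg|].
  apply continuous_Rinv, H.
Qed.

Lemma cont_Rmax {T : UniformSpace} (f : T -> R) (c : R) (t : T) :
  continuous f t -> continuous (fun t => Rmax c (f t)) t.
Proof.
  intros H; apply (continuous_comp f (fun u => Rmax c u)); [exact H|].
  intros P [eps HP]; exists eps; intros y Hy; apply HP.
  change (Rabs (y - f t) < eps) in Hy; change (Rabs (Rmax c y - Rmax c (f t)) < eps).
  eapply Rle_lt_trans; [|exact Hy].
  unfold Rmax; repeat destruct Rle_dec; unfold Rabs; repeat destruct Rcase_abs; lra.
Qed.

Lemma cont_Rmin {T : UniformSpace} (f : T -> R) (c : R) (t : T) :
  continuous f t -> continuous (fun t => Rmin c (f t)) t.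
Proof.
  intros H; apply (continuous_ext (fun t => - Rmax (- c) (- f t))).
  - intros u; rewrite <- Ropp_Rmin, Ropp_involutive; reflexivity.
  - apply cont_opp, cont_Rmax, cont_opp, H.
Qed.

Definition clamp (a b z : R) : R := Rmin b (Rmax a z).

Lemma clamp_bounds (a b z : R) : a <= b -> a <= clamp a b z <= b.
Proof.
  intros H; unfold clamp; split; [|apply Rmin_l].
  apply Rmin_glb; [exact H|apply Rmax_l].
Qed.

Lemma clamp_id (a b z : R) : a <= z <= b -> clamp a b z = z.
Proof. intros H; unfold clamp; rewrite Rmax_right, Rmin_right; lra. Qed.

Lemma cont_clamp {T : UniformSpace} (f : T -> R) (a b : R) (t : T) :
  continuous f t -> continuous (fun t => clamp a b (f t)) t.
Proof. intros H; apply cont_Rmin, cont_Rmax, H. Qed.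

Ltac cont := repeat match goal with
  | H : ?P |- ?P => exact H
  | |- continuous (fun _ => ?c) _ => apply continuous_const
  | |- continuous (fun x => x) _ => apply continuous_id
  | |- continuous fst _ => apply cont_fst
  | |- continuous (fun x => fst x) _ => apply cont_fst
  | |- continuous snd _ => apply cont_snd
  | |- continuous (fun x => snd x) _ => apply cont_snd
  | |- continuous (fun x => @?f x + @?g x) _ => apply (cont_plus f g)
  | |- continuous (fun x => @?f x - @?g x) _ => apply (cont_minus f g)
  | |- continuous (fun x => - @?f x) _ => apply (cont_opp f)
  | |- continuous (fun x => @?f x * @?g x) _ => apply (cont_mult f g)
  | |- continuous (fun x => @?f x / @?g x) _ => apply (cont_div f g)
  | |- continuous (clamp ?a ?b) _ => apply (cont_clamp (fun x => x) a b)
  | |- continuous (fun x => clamp ?a ?b (@?f x)) _ => apply (cont_clamp f a b)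
  end.

(** A solution on the slab has only one-sided derivatives at the initial time, so the
    derivative is required on the open interval; clamping the variable expresses
    continuity up to the endpoints without one-sided limits. *)
Lemma ftc_open (F q : R -> R) (a b : R) : a <= b ->
  (forall z, continuous (fun z => F (clamp a b z)) z) ->
  (forall z, continuous (fun z => q (clamp a b z)) z) ->
  (forall z, a < z < b -> is_derive F z (q z)) ->
  F b - F a = RInt q a b.
Proof.
  intros Hab CF Cq HF.
  destruct (Req_dec a b) as [<-|Hne].
  { rewrite (RInt_point (V := R_CompleteNormedModule)).
    change (F a - F a = 0); ring. }
  set (qc := fun z => q (clamp a b z)).
  assert (Di : forall z, is_derive (fun z => RInt qc a z) z (qc z)).
  { intros z; apply (is_derive_RInt (V := R_CompleteNormedModule) qc _ a); [|apply Cq].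
    exists (mkposreal 1 Rlt_0_1); intros y _.
    apply (RInt_correct (V := R_CompleteNormedModule)).
    apply (ex_RInt_continuous (V := R_CompleteNormedModule)); intros; apply Cq. }
  destruct (MVT_gen (fun z => F (clamp a b z) - RInt qc a z) a b (fun _ => 0))
    as [c [_ E]].
  - rewrite Rmin_left, Rmax_right by exact Hab; intros z Hz.
    eapply is_derive_eq.
    + apply (is_derive_minus (V := R_NormedModule)); [|apply Di].
      apply (is_derive_ext_loc F); [|apply HF, Hz].
      assert (Hd : 0 < Rmin (z - a) (b - z)) by (apply Rmin_pos; lra).
      exists (mkposreal _ Hd); intros y Hy.
      change (Rabs (y - z) < Rmin (z - a) (b - z)) in Hy.
      apply Rabs_def2 in Hy.
      pose proof (Rmin_l (z - a) (b - z)); pose proof (Rmin_r (z - a) (b - z)).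
      rewrite clamp_id by lra; reflexivity.
    + unfold qc; rewrite clamp_id by lra.
      change (q z - q z = 0); ring.
  - intros z _; apply continuity_pt_filterlim.
    apply (cont_minus (fun z => F (clamp a b z))); [apply CF|].
    apply (ex_derive_continuous (fun z => RInt qc a z)); eexists; apply Di.
  - rewrite !clamp_id in E by lra.
    rewrite (RInt_point (V := R_CompleteNormedModule)) in E.
    change (zero (G := R_CompleteNormedModule)) with 0 in E.
    rewrite (RInt_ext q qc).
    + lra.
    + rewrite Rmin_left, Rmax_right by exact Hab; intros z Hz.
      unfold qc; rewrite clamp_id by lra; reflexivity.
Qed.

(** * The Riemann function *)

(** The invariant of the apex [(S, x)] and the point [(b, x + e)] on which the Riemann
    function depends; it is nonnegative inside the characteristic triangle and vanishes
    on its two characteristic sides. *)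
Definition zeta (S b e : R) : R := ((S - b) * (S - b) - e * e) / (4 * S * b).
Definition zeta_b (S b e : R) : R := - (S * S - e * e) / (4 * S * (b * b)) + / (4 * S).
Definition zeta_bb (S b e : R) : R := (S * S - e * e) / (2 * S * (b * b * b)).
Definition zeta_e (S b e : R) : R := - e / (2 * S * b).

Section Riemann.
Variables (N : R) (Phi Phi1 Phi2 : R -> R).
Hypothesis HPhi : riemann_profile N Phi Phi1 Phi2.

Definition riemann (S b e : R) : R := Phi (zeta S b e).
Definition riemann_b (S b e : R) : R := Phi1 (zeta S b e) * zeta_b S b e.
Definition riemann_e (S b e : R) : R := Phi1 (zeta S b e) * zeta_e S b e.
Definition riemann_bb (S b e : R) : R :=
  Phi2 (zeta S b e) * (zeta_b S b e * zeta_b S b e)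
  + Phi1 (zeta S b e) * zeta_bb S b e.
Definition riemann_ee (S b e : R) : R :=
  Phi2 (zeta S b e) * (zeta_e S b e * zeta_e S b e)
  + Phi1 (zeta S b e) * (- / (2 * S * b)).

(** [1 + 2 zeta = (S^2 + b^2 - e^2) / (2 S b)]: the strip [|e| < S] contains a neighbourhood
    of the triangle. *)
Lemma zeta_gt (S b e : R) : 0 < b -> Rabs e < S -> - (1 / 2) < zeta S b e.
Proof.
  intros Hb He; pose proof (Rabs_pos e).
  assert (e * e < S * S).
  { apply Rabs_def2 in He; nra. }
  assert (HS : 0 < S) by lra.
  replace (zeta S b e) with (- (1 / 2) + (S * S + b * b - e * e) / (4 * S * b))
    by (unfold zeta; field; lra).
  assert (0 < (S * S + b * b - e * e) / (4 * S * b)) by (apply Rdiv_lt_0_compat; nra).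
  lra.
Qed.

Lemma is_derive_zeta_b (S b e : R) : 0 < b -> 0 < S ->
  is_derive (fun b => zeta S b e) b (zeta_b S b e).
Proof.
  intros Hb HS; unfold zeta, zeta_b; auto_derive; [nra|].
  field; lra.
Qed.

Lemma is_derive_zeta_bb (S b e : R) : 0 < b -> 0 < S ->
  is_derive (fun b => zeta_b S b e) b (zeta_bb S b e).
Proof.
  intros Hb HS; unfold zeta_bb, zeta_b; auto_derive.
  - apply Rgt_not_eq; apply Rmult_lt_0_compat; nra.
  - field; lra.
Qed.

Lemma is_derive_zeta_e (S b e : R) : 0 < b -> 0 < S ->
  is_derive (fun e => zeta S b e) e (zeta_e S b e).
Proof.
  intros Hb HS; unfold zeta, zeta_e; auto_derive; [exact I|].
  field; lra.
Qed.

Lemma is_derive_zeta_ee (S b e : R) : 0 < b -> 0 < S ->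
  is_derive (fun e => zeta_e S b e) e (- / (2 * S * b)).
Proof.
  intros Hb HS; unfold zeta_e; auto_derive; [exact I|].
  field; lra.
Qed.

Lemma is_derive_compose (f f' g : R -> R) (x l : R) :
  is_derive f (g x) (f' (g x)) -> is_derive g x l ->
  is_derive (fun x => f (g x)) x (f' (g x) * l).
Proof.
  intros H1 H2; eapply is_derive_eq.
  - apply (is_derive_comp (V := R_NormedModule) f g); eassumption.
  - unfold scal; simpl; unfold mult; simpl; ring.
Qed.

Lemma riemann_dom (S b e : R) : 0 < b -> Rabs e < S -> 0 < S /\ - (1 / 2) < zeta S b e.
Proof.
  intros Hb He; split; [pose proof (Rabs_pos e); lra|apply zeta_gt; assumption].
Qed.

Lemma is_derive_riemann_b (S b e : R) : 0 < b -> Rabs e < S ->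
  is_derive (fun b => riemann S b e) b (riemann_b S b e).
Proof.
  intros Hb He; destruct (riemann_dom S b e Hb He) as [HS Hz].
  apply (is_derive_compose Phi Phi1 (fun b => zeta S b e)).
  - apply (rp_d1 _ _ _ _ HPhi), Hz.
  - apply is_derive_zeta_b; assumption.
Qed.

Lemma is_derive_riemann_bb (S b e : R) : 0 < b -> Rabs e < S ->
  is_derive (fun b => riemann_b S b e) b (riemann_bb S b e).
Proof.
  intros Hb He; destruct (riemann_dom S b e Hb He) as [HS Hz].
  eapply is_derive_eq.
  - apply (Derive.is_derive_mult (fun b => Phi1 (zeta S b e)) (fun b => zeta_b S b e)).
    + apply (is_derive_compose Phi1 Phi2 (fun b => zeta S b e)).
      * apply (rp_d2 _ _ _ _ HPhi), Hz.
      * apply is_derive_zeta_b; assumption.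
    + apply is_derive_zeta_bb; assumption.
  - unfold riemann_bb; ring.
Qed.

Lemma is_derive_riemann_e (S b e : R) : 0 < b -> Rabs e < S ->
  is_derive (fun e => riemann S b e) e (riemann_e S b e).
Proof.
  intros Hb He; destruct (riemann_dom S b e Hb He) as [HS Hz].
  apply (is_derive_compose Phi Phi1 (fun e => zeta S b e)).
  - apply (rp_d1 _ _ _ _ HPhi), Hz.
  - apply is_derive_zeta_e; assumption.
Qed.

Lemma is_derive_riemann_ee (S b e : R) : 0 < b -> Rabs e < S ->
  is_derive (fun e => riemann_e S b e) e (riemann_ee S b e).
Proof.
  intros Hb He; destruct (riemann_dom S b e Hb He) as [HS Hz].
  eapply is_derive_eq.
  - apply (Derive.is_derive_mult (fun e => Phi1 (zeta S b e)) (fun e => zeta_e S b e)).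
    + apply (is_derive_compose Phi1 Phi2 (fun e => zeta S b e)).
      * apply (rp_d2 _ _ _ _ HPhi), Hz.
      * apply is_derive_zeta_e; assumption.
    + apply is_derive_zeta_ee; assumption.
  - unfold riemann_ee; ring.
Qed.

(** The two identities [zeta_b^2 - zeta_e^2 = zeta (1 + zeta) / b^2] and
    [zeta_bb - zeta_ee = (1 + 2 zeta) / b^2] turn the wave equation into the Legendre
    equation. *)
Lemma riemann_wave (S b e : R) : 0 < b -> Rabs e < S ->
  riemann_bb S b e - riemann_ee S b e + N / (b * b) * riemann S b e = 0.
Proof.
  intros Hb He; destruct (riemann_dom S b e Hb He) as [HS Hz].
  pose proof (rp_ode _ _ _ _ HPhi _ Hz) as O.
  unfold riemann_bb, riemann_ee, riemann.
  set (z := zeta S b e) in *.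
  transitivity ((z * (1 + z) * Phi2 z + (1 + 2 * z) * Phi1 z + N * Phi z) / (b * b)).
  - replace (zeta_b S b e * zeta_b S b e) with
      (zeta_e S b e * zeta_e S b e + z * (1 + z) / (b * b))
      by (unfold z, zeta, zeta_b, zeta_e; field; lra).
    replace (zeta_bb S b e) with ((1 + 2 * z) / (b * b) - / (2 * S * b))
      by (unfold z, zeta, zeta_bb; field; lra).
    field; lra.
  - rewrite O; field; lra.
Qed.

(** On both characteristics the time derivative has the same value, and it matches the
    tangential condition that makes the boundary terms of Green's identity cancel. *)
Lemma riemann_characteristic (S b e : R) : 0 < b -> 0 < S -> e * e = (S - b) * (S - b) ->
  riemann S b e = 1 /\ riemann_b S b e = Phi1 0 * ((b - S) / (2 * S * b)).
Proof.
  intros Hb HS E.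
  assert (Z : zeta S b e = 0) by (unfold zeta; rewrite E; field; lra).
  unfold riemann, riemann_b; rewrite Z; split; [apply (rp_0 _ _ _ _ HPhi)|].
  unfold zeta_b; rewrite E; field; lra.
Qed.

Lemma cont_zeta {T : UniformSpace} (S : R) (b e : T -> R) (t : T) :
  0 < S -> 0 < b t -> continuous b t -> continuous e t ->
  continuous (fun t => zeta S (b t) (e t)) t /\
  continuous (fun t => zeta_b S (b t) (e t)) t /\
  continuous (fun t => zeta_bb S (b t) (e t)) t /\
  continuous (fun t => zeta_e S (b t) (e t)) t.
Proof.
  intros HS Hb Cb Ce; unfold zeta, zeta_b, zeta_bb, zeta_e.
  assert (0 < b t * b t) by nra. assert (0 < b t * b t * b t) by nra.
  repeat split; cont; try apply Rgt_not_eq; nra.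
Qed.

Lemma cont_riemann {T : UniformSpace} (S : R) (b e : T -> R) (t : T) :
  0 < b t -> Rabs (e t) < S -> continuous b t -> continuous e t ->
  continuous (fun t => riemann S (b t) (e t)) t /\
  continuous (fun t => riemann_b S (b t) (e t)) t /\
  continuous (fun t => riemann_bb S (b t) (e t)) t /\
  continuous (fun t => riemann_e S (b t) (e t)) t /\
  continuous (fun t => riemann_ee S (b t) (e t)) t.
Proof.
  intros Hb He Cb Ce; destruct (riemann_dom S (b t) (e t) Hb He) as [HS Hz].
  destruct (cont_zeta S b e t HS Hb Cb Ce) as [Z [Zb [Zbb Ze]]].
  assert (C0 : continuous (fun t => Phi (zeta S (b t) (e t))) t).
  { apply (continuous_comp (fun t => zeta S (b t) (e t)) Phi); [exact Z|].
    apply (ex_derive_continuous Phi); eexists; apply (rp_d1 _ _ _ _ HPhi), Hz. }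
  assert (C1 : continuous (fun t => Phi1 (zeta S (b t) (e t))) t).
  { apply (continuous_comp (fun t => zeta S (b t) (e t)) Phi1); [exact Z|].
    apply (ex_derive_continuous Phi1); eexists; apply (rp_d2 _ _ _ _ HPhi), Hz. }
  assert (C2 : continuous (fun t => Phi2 (zeta S (b t) (e t))) t).
  { apply (continuous_comp (fun t => zeta S (b t) (e t)) Phi2); [exact Z|].
    apply (rp_c2 _ _ _ _ HPhi), Hz. }
  unfold riemann, riemann_b, riemann_bb, riemann_e, riemann_ee.
  repeat split; cont; cont.
  apply (continuous_comp (fun t => 2 * S * b t) Rinv); [cont|].
  apply continuous_Rinv, Rgt_not_eq; nra.
Qed.

End Riemann.

(** * Green's identity on the characteristic triangle *)

Lemma jcont_path {T : UniformSpace} (f : R -> R -> R) (a b : T -> R) (t : T) :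
  (forall p y, jcont f p y) -> continuous a t -> continuous b t ->
  continuous (fun t => f (a t) (b t)) t.
Proof. intros H; apply jcont_comp, H. Qed.

Section Representation.
Variables (N s0 : R) (Phi Phi1 Phi2 : R -> R).
Hypothesis HPhi : riemann_profile N Phi Phi1 Phi2.
Hypothesis Hs0 : 0 < s0.
Variables v vs vx vss vxx h : R -> R -> R.
Hypothesis (Cv : forall p y, jcont v p y) (Cvs : forall p y, jcont vs p y)
  (Cvss : forall p y, jcont vss p y)
  (Cvxx : forall p y, jcont vxx p y) (Ch : forall p y, jcont h p y).
Hypothesis Dv : forall s x, s0 < s -> is_derive (fun s => v s x) s (vs s x).
Hypothesis Dvs : forall s x, s0 < s -> is_derive (fun s => vs s x) s (vss s x).
Hypothesis Dvx : forall s x, s0 < s -> is_derive (v s) x (vx s x).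
Hypothesis Dvxx : forall s x, s0 < s -> is_derive (vx s) x (vxx s x).
Hypothesis Hwave : forall s x, s0 < s ->
  vss s x - vxx s x + N / (s * s) * v s x = h s x.

Definition green_density (S x b y : R) : R :=
  vs b y * riemann Phi S b (y - x) - v b y * riemann_b Phi1 S b (y - x).

(** The source-free representation of [v (S, x)] by the data of [v] at time [b]. *)
Definition green (S x b : R) : R :=
  1 / 2 * (v b (x + (S - b)) + v b (x - (S - b)))
  + 1 / 2 * RInt (green_density S x b) (x - (S - b)) (x + (S - b)).

Definition source (S x b : R) : R :=
  1 / 2 * RInt (fun y => h b y * riemann Phi S b (y - x)) (x - (S - b)) (x + (S - b)).

(** Lagrange's identity: substituting both wave equations cancels the potential, and what
    remains besides the source is the [y]-derivative of [v_x R - v R_y]. *)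
Lemma green_integral (S x b : R) : s0 < b < S ->
  RInt (fun y => vss b y * riemann Phi S b (y - x) - v b y * riemann_bb Phi1 Phi2 S b (y - x))
    (x - (S - b)) (x + (S - b))
  = RInt (fun y => h b y * riemann Phi S b (y - x)) (x - (S - b)) (x + (S - b))
    + ((vx b (x + (S - b)) * riemann Phi S b (S - b)
        - v b (x + (S - b)) * riemann_e Phi1 S b (S - b))
       - (vx b (x - (S - b)) * riemann Phi S b (- (S - b))
          - v b (x - (S - b)) * riemann_e Phi1 S b (- (S - b)))).
Proof.
  intros Hb.
  assert (Hdom : forall y, Rmin (x - (S - b)) (x + (S - b)) <= y
                           <= Rmax (x - (S - b)) (x + (S - b)) -> Rabs (y - x) < S).
  { rewrite Rmin_left, Rmax_right by lra; intros y Hy; apply Rabs_def1; lra. }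
  assert (CR : forall y, Rabs (y - x) < S ->
     continuous (fun y => riemann Phi S b (y - x)) y /\
     continuous (fun y => riemann_e Phi1 S b (y - x)) y /\
     continuous (fun y => riemann_ee Phi1 Phi2 S b (y - x)) y).
  { intros y Hy.
    destruct (cont_riemann N Phi Phi1 Phi2 HPhi S (fun _ => b) (fun y => y - x) y)
      as (c1 & c2 & c3 & c4 & c5); cont; auto; lra. }
  assert (I2 : is_RInt (fun y => vxx b y * riemann Phi S b (y - x)
                         - v b y * riemann_ee Phi1 Phi2 S b (y - x))
     (x - (S - b)) (x + (S - b))
     ((vx b (x + (S - b)) * riemann Phi S b (S - b)
        - v b (x + (S - b)) * riemann_e Phi1 S b (S - b))
       - (vx b (x - (S - b)) * riemann Phi S b (- (S - b))
          - v b (x - (S - b)) * riemann_e Phi1 S b (- (S - b))))).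
  { set (W := fun y => vx b y * riemann Phi S b (y - x) - v b y * riemann_e Phi1 S b (y - x)).
    replace (vx b (x + (S - b)) * riemann Phi S b (S - b)
        - v b (x + (S - b)) * riemann_e Phi1 S b (S - b)) with (W (x + (S - b)))
      by (unfold W; replace (x + (S - b) - x) with (S - b) by ring; reflexivity).
    replace (vx b (x - (S - b)) * riemann Phi S b (- (S - b))
        - v b (x - (S - b)) * riemann_e Phi1 S b (- (S - b))) with (W (x - (S - b)))
      by (unfold W; replace (x - (S - b) - x) with (- (S - b)) by ring; reflexivity).
    apply (is_RInt_derive (V := R_CompleteNormedModule) W).
    - intros y Hy; specialize (Hdom y Hy).
      assert (Dsh : is_derive (fun y => y - x) y 1) by (auto_derive; [exact I|ring]).
      assert (D1 : is_derive (fun y => riemann Phi S b (y - x)) y (riemann_e Phi1 S b (y - x))).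
      { eapply is_derive_eq.
        - apply (is_derive_compose (riemann Phi S b) (riemann_e Phi1 S b) (fun y => y - x));
            [|exact Dsh].
          apply (is_derive_riemann_e N Phi Phi1 Phi2 HPhi); [lra|exact Hdom].
        - ring. }
      assert (D2 : is_derive (fun y => riemann_e Phi1 S b (y - x)) y
                     (riemann_ee Phi1 Phi2 S b (y - x))).
      { eapply is_derive_eq.
        - apply (is_derive_compose (riemann_e Phi1 S b) (riemann_ee Phi1 Phi2 S b) (fun y => y - x));
            [|exact Dsh].
          apply (is_derive_riemann_ee N Phi Phi1 Phi2 HPhi); [lra|exact Hdom].
        - ring. }
      eapply is_derive_eq.
      + apply (is_derive_minus (V := R_NormedModule));
          apply Derive.is_derive_mult; [apply Dvxx; lra|exact D1|apply Dvx; lra|exact D2].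
      + unfold minus, plus, opp; simpl; ring.
    - intros y Hy; specialize (Hdom y Hy); destruct (CR y Hdom) as (c1 & c2 & c3).
      apply cont_minus; apply cont_mult; try assumption.
      + apply (jcont_snd vxx), Cvxx.
      + apply (jcont_snd v), Cv. }
  assert (I1 : ex_RInt (fun y => h b y * riemann Phi S b (y - x))
                 (x - (S - b)) (x + (S - b))).
  { apply (ex_RInt_continuous (V := R_CompleteNormedModule)).
    intros y Hy; destruct (CR y (Hdom y Hy)) as (c1 & c2 & c3).
    apply cont_mult; [apply (jcont_snd h), Ch|exact c1]. }
  apply (is_RInt_unique (V := R_CompleteNormedModule)).
  eapply (is_RInt_ext (V := R_NormedModule));
    [|apply (is_RInt_plus (V := R_NormedModule));
      [apply (RInt_correct (V := R_CompleteNormedModule)), I1|exact I2]].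
  intros y Hy; cbv beta.
  assert (Hy' : Rabs (y - x) < S) by (apply Hdom; lra).
  pose proof (riemann_wave N Phi Phi1 Phi2 HPhi S b (y - x) ltac:(lra) Hy') as Hw.
  pose proof (Hwave b y ltac:(lra)) as Hu.
  unfold plus; simpl.
  rewrite <- Hu.
  replace (riemann_bb Phi1 Phi2 S b (y - x)) with
    (riemann_ee Phi1 Phi2 S b (y - x) - N / (b * b) * riemann Phi S b (y - x)) by lra.
  ring.
Qed.

(** All boundary terms cancel: [v_b] because [R = 1] on the characteristics, [v_y] against
    Lagrange's identity, and [v] because [R] is constant along them. *)
Lemma is_derive_green (S x b : R) : s0 < b < S ->
  is_derive (green S x) b (source S x b).
Proof.
  intros Hb.
  (* Within this distance of the section at time [b], times stay above [s0] and
     [|y - x| < S]. *)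
  assert (He : 0 < Rmin (b / 4) ((b - s0) / 2)) by (apply Rmin_pos; lra).
  pose proof (Rmin_l (b / 4) ((b - s0) / 2)) as Hl.
  pose proof (Rmin_r (b / 4) ((b - s0) / 2)) as Hr.
  set (eps := mkposreal _ He).
  assert (Da : is_derive (fun b => x - (S - b)) b 1) by (auto_derive; [exact I|ring]).
  assert (Db : is_derive (fun b => x + (S - b)) b (-1)) by (auto_derive; [exact I|ring]).
  pose proof (is_derive_RInt_moving (green_density S x)
    (fun b y => vss b y * riemann Phi S b (y - x) - v b y * riemann_bb Phi1 Phi2 S b (y - x))
    (fun b => x - (S - b)) (fun b => x + (S - b)) b 1 (-1) eps) as DI.
  cbv beta in DI; rewrite (green_integral S x b Hb) in DI.
  specialize (DI ltac:(lra) Da Db).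
  assert (Dsum : forall y, s0 < b -> locally (b, y)
    (fun q : R * R => is_derive (fun z => v z (snd q)) (fst q) (vs (fst q) (snd q)))).
  { intros y _; assert (Hd : 0 < b - s0) by lra.
    exists (mkposreal _ Hd); intros [z w] [Hq _]; apply Dv; simpl in *.
    change (Rabs (z - b) < b - s0) in Hq; apply Rabs_def2 in Hq; lra. }
  pose proof (is_derive_along v vs (fun b => b) (fun b => x + (S - b)) b 1 (-1)
    (vx b (x + (S - b))) (is_derive_id b) Db (Dsum _ (proj1 Hb)) (Cvs _ _)
    (Dvx _ _ (proj1 Hb))) as Dp.
  pose proof (is_derive_along v vs (fun b => b) (fun b => x - (S - b)) b 1 1
    (vx b (x - (S - b))) (is_derive_id b) Da (Dsum _ (proj1 Hb)) (Cvs _ _)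
    (Dvx _ _ (proj1 Hb))) as Dm.
  cbv beta in Dp, Dm.
  unfold green.
  eapply is_derive_eq.
  - apply (is_derive_plus (V := R_NormedModule)).
    + apply is_derive_scal, (is_derive_plus (V := R_NormedModule)); [exact Dp|exact Dm].
    + apply is_derive_scal, DI; clear DI.
      intros z y Hz Hy; simpl in Hz, Hy; apply Rabs_def2 in Hz.
      assert (Hz0 : 0 < z) by lra.
      assert (Hyx : Rabs (y - x) < S) by (apply Rabs_def1; lra).
      split; [|split].
      * unfold green_density; eapply is_derive_eq.
        -- apply (is_derive_minus (V := R_NormedModule)); apply Derive.is_derive_mult.
           ++ apply Dvs; lra.
           ++ apply (is_derive_riemann_b N Phi Phi1 Phi2 HPhi S z (y - x) Hz0 Hyx).
           ++ apply Dv; lra.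
           ++ apply (is_derive_riemann_bb N Phi Phi1 Phi2 HPhi S z (y - x) Hz0 Hyx).
        -- unfold minus, plus, opp; simpl; ring.
      * unfold jcont.
        assert (Ce : continuous (fun q : R * R => snd q - x) (z, y))
          by (apply cont_minus; [apply cont_snd|apply continuous_const]).
        destruct (cont_riemann N Phi Phi1 Phi2 HPhi S fst (fun q : R * R => snd q - x) (z, y)
          Hz0 Hyx (cont_fst _) Ce) as (c1 & c2 & c3 & c4 & c5).
        apply cont_minus; apply cont_mult; try assumption.
        -- apply Cvss.
        -- apply Cv.
      * unfold green_density.
        assert (Ce : continuous (fun y : R => y - x) y)
          by (apply cont_minus; [apply continuous_id|apply continuous_const]).
        destruct (cont_riemann N Phi Phi1 Phi2 HPhi S (fun _ => z) (fun y => y - x) y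
          Hz0 Hyx (continuous_const _ _) Ce) as (c1 & c2 & c3 & c4 & c5).
        apply cont_minus; apply cont_mult; try assumption.
        -- apply (jcont_snd vs), Cvs.
        -- apply (jcont_snd v), Cv.
  - unfold source, green_density.
    destruct (riemann_characteristic N Phi Phi1 Phi2 HPhi S b (S - b)) as [E1 E2];
      [lra|lra|ring|].
    destruct (riemann_characteristic N Phi Phi1 Phi2 HPhi S b (- (S - b))) as [E3 E4];
      [lra|lra|ring|].
    assert (Z1 : zeta S b (S - b) = 0) by (unfold zeta; field; lra).
    assert (Z2 : zeta S b (- (S - b)) = 0) by (unfold zeta; field; lra).
    replace (x + (S - b) - x) with (S - b) by ring.
    replace (x - (S - b) - x) with (- (S - b)) by ring.
    unfold riemann_e; rewrite E1, E2, E3, E4, Z1, Z2.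
    unfold zeta_e, plus; simpl; field; lra.
Qed.

Lemma continuous_green (S x z : R) : s0 <= S ->
  continuous (fun b => green S x (clamp s0 S b)) z.
Proof.
  intros HS; unfold green.
  assert (Hcl := fun b => clamp_bounds s0 S b HS).
  assert (Ccl : forall z, continuous (fun b : R => clamp s0 S b) z).
  { intros w; apply (cont_clamp (fun b : R => b)), continuous_id. }
  apply cont_plus; apply cont_mult; try apply continuous_const.
  - apply cont_plus; apply (jcont_path v); cont; apply Ccl.
  - apply (continuous_RInt_param (fun b => green_density S x (clamp s0 S b))
      (fun b => x - (S - clamp s0 S b)) (fun b => x + (S - clamp s0 S b)) z);
      [intros; cont; apply Ccl|intros; cont; apply Ccl|].
    intros b y Hy; specialize (Hcl b).
    rewrite Rmin_left, Rmax_right in Hy by lra.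
    unfold jcont, green_density.
    assert (Cc : continuous (fun q : R * R => clamp s0 S (fst q)) (b, y))
      by (apply cont_clamp, cont_fst).
    destruct (cont_riemann N Phi Phi1 Phi2 HPhi S (fun q : R * R => clamp s0 S (fst q))
      (fun q : R * R => snd q - x) (b, y)) as (c1 & c2 & c3 & c4 & c5); simpl; cont.
    + lra.
    + apply Rabs_def1; lra.
    + apply (jcont_path vs); cont.
    + apply (jcont_path v); cont.
Qed.

Lemma continuous_source (S x z : R) : s0 <= S ->
  continuous (fun b => source S x (clamp s0 S b)) z.
Proof.
  intros HS; unfold source.
  assert (Hcl := fun b => clamp_bounds s0 S b HS).
  assert (Ccl : forall z, continuous (fun b : R => clamp s0 S b) z).
  { intros w; apply (cont_clamp (fun b : R => b)), continuous_id. }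
  apply cont_mult; try apply continuous_const.
  apply (continuous_RInt_param
      (fun b y => h (clamp s0 S b) y * riemann Phi S (clamp s0 S b) (y - x))
      (fun b => x - (S - clamp s0 S b)) (fun b => x + (S - clamp s0 S b)) z);
      [intros; cont; apply Ccl|intros; cont; apply Ccl|].
  intros b y Hy; specialize (Hcl b).
  rewrite Rmin_left, Rmax_right in Hy by lra.
  unfold jcont.
  assert (Cc : continuous (fun q : R * R => clamp s0 S (fst q)) (b, y))
      by (apply cont_clamp, cont_fst).
  destruct (cont_riemann N Phi Phi1 Phi2 HPhi S (fun q : R * R => clamp s0 S (fst q))
      (fun q : R * R => snd q - x) (b, y)) as (c1 & c2 & c3 & c4 & c5); simpl; cont.
  - lra.
  - apply Rabs_def1; lra.
  - apply (jcont_path h); cont.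
Qed.

Lemma riemann_representation (S x : R) : s0 <= S ->
  v S x = green S x s0 + RInt (source S x) s0 S.
Proof.
  intros HS.
  assert (E : green S x S - green S x s0 = RInt (source S x) s0 S).
  { apply ftc_open; [exact HS| | |].
    - intros z; apply continuous_green, HS.
    - intros z; apply continuous_source, HS.
    - intros z Hz; apply is_derive_green, Hz. }
  rewrite <- E.
  assert (E2 : green S x S = v S x).
  { unfold green; replace (S - S) with 0 by ring.
    rewrite Rminus_0_r, Rplus_0_r, (RInt_point (V := R_CompleteNormedModule)).
    change (zero (G := R_CompleteNormedModule)) with 0; field. }
  rewrite E2; ring.
Qed.

End Representation.

(** * Duhamel's integral for the flat wave equation *)

Definition jcontinuous (f : R -> R -> R) : Prop := forall s x, jcont f s x.

Definition has_dx (f fx : R -> R -> R) : Prop :=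
  forall s x, is_derive (f s) x (fx s x).

Definition has_ds (f fs : R -> R -> R) : Prop :=
  forall s x, is_derive (fun s => f s x) s (fs s x).

Lemma ex_RInt_cont (f : R -> R) (a b : R) :
  (forall x, continuous f x) -> ex_RInt f a b.
Proof.
  intros H; apply (ex_RInt_continuous (V := R_CompleteNormedModule)); intros; apply H.
Qed.

Lemma jcontinuous_snd (f : R -> R -> R) (s x : R) : jcontinuous f -> continuous (f s) x.
Proof. intros H; apply jcont_snd, H. Qed.

Lemma is_derive_RInt_moving_global (f f1 : R -> R -> R) (a b : R -> R) (x da db : R) :
  is_derive a x da -> is_derive b x db ->
  (forall z y, is_derive (fun z => f z y) z (f1 z y)) ->
  jcontinuous f -> jcontinuous f1 ->
  is_derive (fun z => RInt (f z) (a z) (b z)) x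
    (RInt (f1 x) (a x) (b x) - f x (a x) * da + f x (b x) * db).
Proof.
  intros Da Db D Cf C1.
  assert (H : forall (eps : posreal) z y u v, Rabs (z - x) < eps -> u - eps <= y <= v + eps ->
     is_derive (fun z => f z y) z (f1 z y) /\ jcont f1 z y /\ continuous (f z) y).
  { intros eps z y u v _ _; split; [apply D|split; [apply C1|apply jcontinuous_snd, Cf]]. }
  destruct (Rle_dec (a x) (b x)) as [h|h].
  - apply (is_derive_RInt_moving f f1 a b x da db (mkposreal 1 Rlt_0_1)); auto.
    intros; eapply H; eassumption.
  - eapply is_derive_eq.
    + apply (is_derive_ext (fun z => - RInt (f z) (b z) (a z))).
      { intros z; apply (opp_RInt_swap (V := R_CompleteNormedModule)).
        apply ex_RInt_cont; intros; apply jcontinuous_snd, Cf. }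
      apply (is_derive_opp (V := R_NormedModule)).
      apply (is_derive_RInt_moving f f1 b a x db da (mkposreal 1 Rlt_0_1)); auto; [lra|].
      intros; eapply H; eassumption.
    + rewrite <- (opp_RInt_swap (V := R_CompleteNormedModule) (f1 x) (a x) (b x)).
      * unfold opp; simpl; ring.
      * apply ex_RInt_cont; intros; apply jcontinuous_snd, C1.
Qed.

Section Transport.
Variable s0 : R.

(** Duhamel's integral for [w_s = sg w_x + f] with [w = 0] at [s0]. *)
Definition transport (sg : R) (f : R -> R -> R) (s x : R) : R :=
  RInt (fun b => f b (x + sg * (s - b))) s0 s.

Lemma jcontinuous_transport (sg : R) (f : R -> R -> R) :
  jcontinuous f -> jcontinuous (transport sg f).
Proof.
  intros Hf s x; unfold jcont, transport.
  apply (continuous_RInt_param (fun (q : R * R) b => f b (snd q + sg * (fst q - b)))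
    (fun _ => s0) fst (s, x)).
  - intros; cont.
  - intros; apply cont_fst.
  - intros q y _; unfold jcont.
    assert (C1 : continuous (fun r : R * R * R => fst (fst r)) (q, y)).
    { apply (continuous_comp fst fst); apply cont_fst. }
    assert (C2 : continuous (fun r : R * R * R => snd (fst r)) (q, y)).
    { apply (continuous_comp fst snd); [apply cont_fst|apply cont_snd]. }
    apply (jcont_path f (fun r : R * R * R => snd r)
      (fun r : R * R * R => snd (fst r) + sg * (fst (fst r) - snd r)) (q, y)); cont.
Qed.

Lemma transport_dx (sg : R) (f fx : R -> R -> R) :
  jcontinuous f -> jcontinuous fx -> has_dx f fx ->
  has_dx (transport sg f) (transport sg fx).
Proof.
  intros Cf Cx Hx s x; unfold transport.
  eapply is_derive_eq.
  - apply (is_derive_RInt_moving_global (fun x b => f b (x + sg * (s - b)))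
      (fun x b => fx b (x + sg * (s - b))) (fun _ => s0) (fun _ => s) x 0 0).
    + exact (is_derive_const (V := R_NormedModule) s0 x).
    + exact (is_derive_const (V := R_NormedModule) s x).
    + intros z y; eapply is_derive_eq.
      * apply (is_derive_compose (f y) (fx y) (fun z => z + sg * (s - y)) z 1); [apply Hx|].
        auto_derive; [exact I|ring].
      * ring.
    + intros u y; apply (jcont_path f); [exact Cf|cont|cont].
    + intros u y; apply (jcont_path fx); [exact Cx|cont|cont].
  - cbv beta; ring.
Qed.

Lemma transport_ds (sg : R) (f fx : R -> R -> R) :
  jcontinuous f -> jcontinuous fx -> has_dx f fx ->
  has_ds (transport sg f) (fun s x => f s x + sg * transport sg fx s x).
Proof.
  intros Cf Cx Hx s x; unfold transport.
  eapply is_derive_eq.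
  - apply (is_derive_RInt_moving_global (fun s b => f b (x + sg * (s - b)))
      (fun s b => sg * fx b (x + sg * (s - b))) (fun _ => s0) (fun s => s) s 0 1).
    + exact (is_derive_const (V := R_NormedModule) s0 s).
    + exact (is_derive_id (K := R_AbsRing) s).
    + intros z y; eapply is_derive_eq.
      * apply (is_derive_compose (f y) (fx y) (fun z => x + sg * (z - y)) z sg); [apply Hx|].
        auto_derive; [exact I|ring].
      * ring.
    + intros u y; apply (jcont_path f); [exact Cf|cont|cont].
    + intros u y; unfold jcont; cont.
      apply (jcont_path fx); [exact Cx|cont|cont].
  - cbv beta; replace (x + sg * (s - s)) with x by ring.
    assert (E : RInt (fun b => sg * fx b (x + sg * (s - b))) s0 s
                = sg * RInt (fun b => fx b (x + sg * (s - b))) s0 s).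
    { apply (RInt_scal (V := R_CompleteNormedModule)
        (fun b => fx b (x + sg * (s - b))) s0 s sg).
      apply ex_RInt_cont; intros b.
      apply (jcont_path fx); [exact Cx|cont|cont]. }
    rewrite E; ring.
Qed.

Definition space_primitive (f : R -> R -> R) (s x : R) : R := RInt (f s) 0 x.

Lemma space_primitive_dx (f : R -> R -> R) : jcontinuous f -> has_dx (space_primitive f) f.
Proof.
  intros Cf s x; unfold space_primitive.
  apply (is_derive_RInt (V := R_CompleteNormedModule) (f s) _ 0);
    [|apply jcontinuous_snd, Cf].
  exists (mkposreal 1 Rlt_0_1); intros y _.
  apply (RInt_correct (V := R_CompleteNormedModule)), ex_RInt_cont.
  intros; apply jcontinuous_snd, Cf.
Qed.

Lemma jcontinuous_space_primitive (f : R -> R -> R) : jcontinuous f -> jcontinuous (space_primitive f).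
Proof.
  intros Cf s x; unfold jcont, space_primitive.
  apply (continuous_RInt_param (fun (q : R * R) y => f (fst q) y)
    (fun _ => 0) snd (s, x)).
  - intros; cont.
  - intros; apply cont_snd.
  - intros q y _; unfold jcont.
    apply (jcont_path f (fun r : R * R * R => fst (fst r)) snd); [exact Cf| |cont].
    apply (continuous_comp fst fst); apply cont_fst.
Qed.

(** Solution of [w_ss - w_xx = f] with vanishing data at [s0], half the integral of [f] over
    the cone of dependence (duhamel_cone). Integrating first in space splits it into two
    transport integrals, in which the regularity of [f] in [x] yields that of [w] in both
    variables. *)
Definition duhamel (f : R -> R -> R) (s x : R) : R :=
  1 / 2 * (transport 1 (space_primitive f) s x - transport (-1) (space_primitive f) s x).
Definition duhamel_s (f : R -> R -> R) (s x : R) : R :=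
  1 / 2 * (transport 1 f s x + transport (-1) f s x).
Definition duhamel_x (f : R -> R -> R) (s x : R) : R :=
  1 / 2 * (transport 1 f s x - transport (-1) f s x).

Lemma jcontinuous_comb (a b : R) (f g : R -> R -> R) :
  jcontinuous f -> jcontinuous g -> jcontinuous (fun s x => a * f s x + b * g s x).
Proof.
  intros Hf Hg s x; unfold jcont; cont; [apply Hf|apply Hg].
Qed.

Lemma jcontinuous_ext (f g : R -> R -> R) :
  (forall s x, f s x = g s x) -> jcontinuous f -> jcontinuous g.
Proof.
  intros E Hf s x; unfold jcont.
  eapply continuous_ext; [|apply Hf]; intros q; apply E.
Qed.

Lemma jcontinuous_duhamel (f : R -> R -> R) : jcontinuous f -> jcontinuous (duhamel f).
Proof.
  intros Cf.
  apply (jcontinuous_ext (fun s x => 1 / 2 * transport 1 (space_primitive f) s x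
           + (- (1 / 2)) * transport (-1) (space_primitive f) s x)).
  - intros; unfold duhamel; ring.
  - apply jcontinuous_comb; apply jcontinuous_transport, jcontinuous_space_primitive, Cf.
Qed.

Lemma jcontinuous_duhamel_s (f : R -> R -> R) : jcontinuous f -> jcontinuous (duhamel_s f).
Proof.
  intros Cf.
  apply (jcontinuous_ext (fun s x => 1 / 2 * transport 1 f s x
           + (1 / 2) * transport (-1) f s x)).
  - intros; unfold duhamel_s; ring.
  - apply jcontinuous_comb; apply jcontinuous_transport, Cf.
Qed.

Lemma jcontinuous_duhamel_x (f : R -> R -> R) : jcontinuous f -> jcontinuous (duhamel_x f).
Proof.
  intros Cf.
  apply (jcontinuous_ext (fun s x => 1 / 2 * transport 1 f s x
           + (- (1 / 2)) * transport (-1) f s x)).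
  - intros; unfold duhamel_x; ring.
  - apply jcontinuous_comb; apply jcontinuous_transport, Cf.
Qed.

Lemma is_derive_half_sum (f g : R -> R) (x l m : R) :
  is_derive f x l -> is_derive g x m ->
  is_derive (fun x => 1 / 2 * (f x + g x)) x (1 / 2 * (l + m)).
Proof.
  intros; apply is_derive_scal, (is_derive_plus (V := R_NormedModule)); assumption.
Qed.

Lemma is_derive_half_diff (f g : R -> R) (x l m : R) :
  is_derive f x l -> is_derive g x m ->
  is_derive (fun x => 1 / 2 * (f x - g x)) x (1 / 2 * (l - m)).
Proof.
  intros; apply is_derive_scal, (is_derive_minus (V := R_NormedModule)); assumption.
Qed.

Lemma duhamel_dx (f : R -> R -> R) : jcontinuous f -> has_dx (duhamel f) (duhamel_x f).
Proof.
  intros Cf s x; apply is_derive_half_diff; apply transport_dx; try exact Cf;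
    (apply jcontinuous_space_primitive, Cf) || (apply space_primitive_dx, Cf).
Qed.

Lemma duhamel_ds (f : R -> R -> R) : jcontinuous f -> has_ds (duhamel f) (duhamel_s f).
Proof.
  intros Cf s x.
  assert (H := fun sg => transport_ds sg (space_primitive f) f (jcontinuous_space_primitive f Cf) Cf
                 (space_primitive_dx f Cf) s x).
  eapply is_derive_eq; [apply is_derive_half_diff; apply H|].
  unfold duhamel_s; field.
Qed.

Lemma duhamel_xx (f fx : R -> R -> R) : jcontinuous f -> jcontinuous fx -> has_dx f fx ->
  has_dx (duhamel_x f) (duhamel_x fx).
Proof. intros; intros s x; apply is_derive_half_diff; apply transport_dx; assumption. Qed.

Lemma duhamel_sx (f fx : R -> R -> R) : jcontinuous f -> jcontinuous fx -> has_dx f fx ->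
  has_dx (duhamel_s f) (duhamel_s fx).
Proof. intros; intros s x; apply is_derive_half_sum; apply transport_dx; assumption. Qed.

Lemma duhamel_xs (f fx : R -> R -> R) : jcontinuous f -> jcontinuous fx -> has_dx f fx ->
  has_ds (duhamel_x f) (duhamel_s fx).
Proof.
  intros Cf Cx Hx s x.
  assert (H := fun sg => transport_ds sg f fx Cf Cx Hx s x).
  eapply is_derive_eq; [apply is_derive_half_diff; apply H|].
  unfold duhamel_s; field.
Qed.

(** With [duhamel_xx] this is the equation [w_ss - w_xx = f]. *)
Lemma duhamel_ss (f fx : R -> R -> R) : jcontinuous f -> jcontinuous fx -> has_dx f fx ->
  has_ds (duhamel_s f) (fun s x => f s x + duhamel_x fx s x).
Proof.
  intros Cf Cx Hx s x.
  assert (H := fun sg => transport_ds sg f fx Cf Cx Hx s x).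
  eapply is_derive_eq; [apply is_derive_half_sum; apply H|].
  unfold duhamel_x; field.
Qed.

Lemma duhamel_at_start (f : R -> R -> R) (x : R) :
  duhamel f s0 x = 0 /\ duhamel_s f s0 x = 0.
Proof.
  unfold duhamel, duhamel_s, transport.
  rewrite !(RInt_point (V := R_CompleteNormedModule)).
  change (zero (G := R_CompleteNormedModule)) with 0; split; field.
Qed.

Lemma duhamel_cone (f : R -> R -> R) (s x : R) : jcontinuous f ->
  duhamel f s x = RInt (fun b => 1 / 2 * RInt (f b) (x - (s - b)) (x + (s - b))) s0 s.
Proof.
  intros Cf; unfold duhamel, transport.
  assert (Cp : forall sg b, continuous (fun b => space_primitive f b (x + sg * (s - b))) b).
  { intros sg b; apply (jcont_path (space_primitive f));
      [apply jcontinuous_space_primitive, Cf|cont|cont]. }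
  assert (M : forall u v, 1 / 2 * (u - v) = scal (1 / 2) (minus u v)) by reflexivity.
  rewrite M, <- (RInt_minus (V := R_CompleteNormedModule)), <- (RInt_scal (V := R_CompleteNormedModule)).
  - apply (RInt_ext (V := R_CompleteNormedModule)); intros b _.
    unfold space_primitive.
    pose proof (RInt_Chasles (V := R_CompleteNormedModule) (f b) 0
      (x - (s - b)) (x + (s - b))) as E.
    replace (x + 1 * (s - b)) with (x + (s - b)) by ring.
    replace (x + -1 * (s - b)) with (x - (s - b)) by ring.
    rewrite <- E by (apply ex_RInt_cont; intros; apply jcontinuous_snd, Cf).
    unfold scal, minus, plus, opp; simpl; unfold mult; simpl; ring.
  - apply (ex_RInt_minus (V := R_CompleteNormedModule)); apply ex_RInt_cont; apply Cp.
  - apply ex_RInt_cont; apply Cp.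
  - apply ex_RInt_cont; apply Cp.
Qed.

(** On each horizontal slice of the cone the fundamental theorem of calculus integrates
    [fx], so that Duhamel's integral commutes with [d/dx]. *)
Lemma duhamel_of_dx (f fx : R -> R -> R) (s x : R) :
  jcontinuous f -> jcontinuous fx -> has_dx f fx ->
  duhamel_x f s x = duhamel fx s x.
Proof.
  intros Cf Cx Hx; rewrite duhamel_cone by exact Cx; unfold duhamel_x, transport.
  assert (Cp : forall sg b, continuous (fun b => f b (x + sg * (s - b))) b).
  { intros sg b; apply (jcont_path f); [exact Cf|cont|cont]. }
  assert (M : forall u v, 1 / 2 * (u - v) = scal (1 / 2) (minus u v)) by reflexivity.
  rewrite M, <- (RInt_minus (V := R_CompleteNormedModule)), <- (RInt_scal (V := R_CompleteNormedModule)).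
  - apply (RInt_ext (V := R_CompleteNormedModule)); intros b _.
    assert (E : RInt (fx b) (x - (s - b)) (x + (s - b))
                = f b (x + (s - b)) - f b (x - (s - b))).
    { apply (is_RInt_unique (V := R_CompleteNormedModule)).
      apply (is_RInt_derive (V := R_CompleteNormedModule) (f b) (fx b)).
      - intros; apply Hx.
      - intros; apply jcontinuous_snd, Cx. }
    rewrite E.
    replace (x + 1 * (s - b)) with (x + (s - b)) by ring.
    replace (x + -1 * (s - b)) with (x - (s - b)) by ring.
    reflexivity.
  - apply (ex_RInt_minus (V := R_CompleteNormedModule)); apply ex_RInt_cont; apply Cp.
  - apply ex_RInt_cont; apply Cp.
  - apply ex_RInt_cont; apply Cp.
Qed.

End Transport.

(** * Volterra equation for a time-dependent potential *)

(** Uniform continuity bounds the growth of [g] by one unit per step of length [d / 2]. *)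
Lemma unit_steps_bound (g : R -> R) (a b d : R) : 0 < d ->
  (forall s s', a <= s <= b -> a <= s' <= b -> Rabs (s - s') < d ->
     Rabs (g s - g s') < 1) ->
  forall k s, a <= s <= b -> s <= a + INR k * (d / 2) ->
    Rabs (g s) <= Rabs (g a) + INR k.
Proof.
  intros Hd H; induction k as [|k IH]; intros s Hs Hk.
  - simpl in *; replace s with a by lra; lra.
  - rewrite S_INR in *.
    destruct (Rle_dec s (a + INR k * (d / 2))) as [h|h].
    + specialize (IH s Hs h); lra.
    + assert (Hk0 := pos_INR k).
      assert (0 <= INR k * (d / 2)) by (apply Rmult_le_pos; lra).
      specialize (IH (a + INR k * (d / 2)) ltac:(lra) ltac:(lra)).
      assert (Hg : Rabs (g s - g (a + INR k * (d / 2))) < 1).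
      { apply H; [lra|lra|]. apply Rabs_def1; lra. }
      replace (g s) with ((g s - g (a + INR k * (d / 2))) + g (a + INR k * (d / 2)))
        by ring.
      eapply Rle_trans; [apply Rabs_triang|lra].
Qed.

Lemma steps_enough (a b d : R) : 0 < d -> exists k, b <= a + INR k * (d / 2).
Proof.
  intros Hd; destruct (Rle_dec b a) as [h|h].
  - exists O; simpl; lra.
  - destruct (nfloor_ex ((b - a) / (d / 2))) as [k [_ Hk]].
    { apply Rdiv_le_0_compat; lra. }
    exists (S k); rewrite S_INR.
    apply (Rmult_lt_compat_r (d / 2)) in Hk; [|lra].
    unfold Rdiv at 1 in Hk; rewrite Rmult_assoc, Rinv_l in Hk by lra; lra.
Qed.

Lemma jcontinuous_bounded (f : R -> R -> R) (a b c d : R) : a <= b -> c <= d ->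
  jcontinuous f ->
  exists M, forall s x, a <= s <= b -> c <= x <= d -> Rabs (f s x) <= M.
Proof.
  intros Hab Hcd Cf.
  destruct (uniform_continuity_2d f a b c d) with (eps := mkposreal 1 Rlt_0_1)
    as [dl Hdl].
  { intros; apply jcont_2d, Cf. }
  simpl in Hdl; assert (Hd := cond_pos dl).
  destruct (steps_enough a b dl Hd) as [k Hk].
  destruct (steps_enough c d dl Hd) as [m Hm].
  exists (Rabs (f a c) + INR m + INR k); intros s x Hs Hx.
  assert (Z : forall z, Rabs (z - z) < dl).
  { intros z; replace (z - z) with 0 by ring; rewrite Rabs_R0; exact Hd. }
  assert (H1 : Rabs (f a x) <= Rabs (f a c) + INR m).
  { apply (unit_steps_bound (f a) c d dl Hd); [|exact Hx|lra].
    intros y y' Hy Hy' Hyy; apply Hdl; try lra; auto. }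
  assert (H2 : Rabs (f s x) <= Rabs (f a x) + INR k).
  { apply (unit_steps_bound (fun s => f s x) a b dl Hd); [|exact Hs|lra].
    intros y y' Hy Hy' Hyy; apply Hdl; try lra; auto. }
  lra.
Qed.

Lemma is_RInt_exp_scaled (a b C K : R) : 0 < K ->
  is_RInt (fun z => C * exp (2 * K * (z - a))) a b
    (C / (2 * K) * (exp (2 * K * (b - a)) - 1)).
Proof.
  intros HK.
  replace (C / (2 * K) * (exp (2 * K * (b - a)) - 1)) with
    (minus (C / (2 * K) * exp (2 * K * (b - a))) (C / (2 * K) * exp (2 * K * (a - a)))).
  - apply (is_RInt_derive (V := R_CompleteNormedModule)
      (fun z => C / (2 * K) * exp (2 * K * (z - a)))
      (fun z => C * exp (2 * K * (z - a)))).
    + intros z _; auto_derive; [exact I|]. unfold Rminus; field; lra.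
    + intros z _; apply (ex_derive_continuous (fun z => C * exp (2 * K * (z - a)))).
      auto_derive; exact I.
  - replace (2 * K * (a - a)) with 0 by ring; rewrite exp_0.
    unfold minus, plus, opp; simpl; ring.
Qed.

Section Picard.
Variable s0 : R.
Variable q : R -> R.
Hypothesis Cq : forall s, continuous q s.

(** A source bounded by [C exp (2 K (s - s0))] on a cone of size [rho] gives an integral
    smaller by the factor [rho / (2 K)]: the exponential weight turns one integration in
    time into a contraction. *)
Lemma duhamel_diff_bound (f1 f2 : R -> R -> R) (rho C K : R) :
  0 < K -> 0 <= C -> jcontinuous f1 -> jcontinuous f2 ->
  (forall b y, s0 <= b -> Rabs y + (b - s0) <= rho ->
     Rabs (f1 b y - f2 b y) <= C * exp (2 * K * (b - s0))) ->
  forall s x, s0 <= s -> Rabs x + (s - s0) <= rho ->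
    Rabs (duhamel s0 f1 s x - duhamel s0 f2 s x)
    <= rho * C / (2 * K) * exp (2 * K * (s - s0)).
Proof.
  intros HK HC C1 C2 H s x Hs Hx.
  assert (Hrho : 0 <= rho) by (pose proof (Rabs_pos x); lra).
  rewrite !duhamel_cone by assumption.
  assert (Cc : forall f, jcontinuous f -> ex_RInt
    (fun b => 1 / 2 * RInt (f b) (x - (s - b)) (x + (s - b))) s0 s).
  { intros f Cf; apply ex_RInt_cont; intros b; apply cont_mult; [cont|].
    apply (continuous_RInt_param f (fun b => x - (s - b)) (fun b => x + (s - b)) b).
    - intros; cont.
    - intros; cont.
    - intros; apply Cf. }
  apply Rle_trans with (rho * C / (2 * K) * (exp (2 * K * (s - s0)) - 1)).
  2: { assert (0 <= rho * C / (2 * K)) by (apply Rdiv_le_0_compat; nra). nra. }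
  pose proof (RInt_minus (V := R_CompleteNormedModule) _ _ s0 s (Cc f1 C1) (Cc f2 C2)) as E.
  unfold minus at 2 in E; unfold plus at 1, opp at 1 in E; simpl in E.
  unfold Rminus at 1; rewrite <- E.
  change (norm (RInt (fun b => minus
     (1 / 2 * RInt (f1 b) (x - (s - b)) (x + (s - b)))
     (1 / 2 * RInt (f2 b) (x - (s - b)) (x + (s - b)))) s0 s)
     <= rho * C / (2 * K) * (exp (2 * K * (s - s0)) - 1)).
  eapply (norm_RInt_le (V := R_NormedModule)); [exact Hs| | |].
  2: { apply (RInt_correct (V := R_CompleteNormedModule)).
       apply (ex_RInt_minus (V := R_CompleteNormedModule)); apply Cc; assumption. }
  2: { apply is_RInt_exp_scaled, HK. }
  intros b Hb.
  assert (He := exp_pos (2 * K * (b - s0))).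
  assert (Ei : forall f, jcontinuous f -> ex_RInt (f b) (x - (s - b)) (x + (s - b))).
  { intros f Cf; apply ex_RInt_cont; intros; apply jcontinuous_snd, Cf. }
  assert (B : Rabs (RInt (fun y => minus (f1 b y) (f2 b y)) (x - (s - b)) (x + (s - b)))
     <= (x + (s - b) - (x - (s - b))) * (C * exp (2 * K * (b - s0)))).
  { apply abs_RInt_le_const; [lra| |].
    - apply (ex_RInt_minus (V := R_CompleteNormedModule)); apply Ei; assumption.
    - intros y Hy; apply H; [lra|].
      assert (Rabs y <= Rabs x + (s - b)).
      { replace y with (x + (y - x)) by ring.
        eapply Rle_trans; [apply Rabs_triang|].
        apply Rplus_le_compat_l, Rabs_le; lra. }
      lra. }
  rewrite (RInt_minus (V := R_CompleteNormedModule)) in B by (apply Ei; assumption).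
  change (Rabs (1 / 2 * RInt (f1 b) (x - (s - b)) (x + (s - b))
    - 1 / 2 * RInt (f2 b) (x - (s - b)) (x + (s - b)))
    <= rho * C * exp (2 * K * (b - s0))).
  change (Rabs (RInt (f1 b) (x - (s - b)) (x + (s - b))
    - RInt (f2 b) (x - (s - b)) (x + (s - b)))
    <= (x + (s - b) - (x - (s - b))) * (C * exp (2 * K * (b - s0)))) in B.
  rewrite <- Rmult_minus_distr_l, Rabs_mult, (Rabs_pos_eq (1 / 2)) by lra.
  assert (0 <= C * exp (2 * K * (b - s0))) by (apply Rmult_le_pos; lra).
  pose proof (Rabs_pos x).
  assert ((s - b) * (C * exp (2 * K * (b - s0))) <= rho * (C * exp (2 * K * (b - s0))))
    by (apply Rmult_le_compat_r; lra).
  lra.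
Qed.

(** The right-hand side of [w = c + D (f - q w)]. Freezing the time at [s0] in the past makes
    it a map on functions of the whole plane without changing the equation for [s >= s0]. *)
Definition picard_map (c f w : R -> R -> R) (s x : R) : R :=
  c (Rmax s0 s) x + duhamel s0 (fun b y => f b y - q b * w b y) (Rmax s0 s) x.

Fixpoint picard_iter (c f : R -> R -> R) (n : nat) : R -> R -> R :=
  match n with
  | O => fun _ _ => 0
  | S n => picard_map c f (picard_iter c f n)
  end.

Lemma jcontinuous_source (f w : R -> R -> R) : jcontinuous f -> jcontinuous w ->
  jcontinuous (fun b y => f b y - q b * w b y).
Proof.
  intros Cf Cw s x; unfold jcont; cont.
  - apply Cf.
  - apply (continuous_comp fst q); [apply cont_fst|apply Cq].
  - apply Cw.
Qed.

Lemma jcontinuous_frozen (f : R -> R -> R) : jcontinuous f ->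
  jcontinuous (fun s x => f (Rmax s0 s) x).
Proof.
  intros Cf s x; apply (jcont_path f (fun r : R * R => Rmax s0 (fst r)) snd);
    [exact Cf|apply cont_Rmax, cont_fst|apply cont_snd].
Qed.

Lemma jcontinuous_picard_map (c f w : R -> R -> R) : jcontinuous c -> jcontinuous f ->
  jcontinuous w -> jcontinuous (picard_map c f w).
Proof.
  intros Cc Cf Cw s x; unfold jcont, picard_map; apply cont_plus.
  - apply (jcontinuous_frozen c Cc).
  - apply (jcontinuous_frozen (duhamel s0 (fun b y => f b y - q b * w b y))).
    apply jcontinuous_duhamel, jcontinuous_source; assumption.
Qed.

Lemma jcontinuous_picard_iter (c f : R -> R -> R) (n : nat) : jcontinuous c -> jcontinuous f ->
  jcontinuous (picard_iter c f n).
Proof.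
  intros Cc Cf; induction n as [|n IH].
  - intros s x; apply continuous_const.
  - apply jcontinuous_picard_map; assumption.
Qed.

(** Since [q] depends on time only, differentiating an iterate in [x] gives the iterate for
    the differentiated data. *)
Lemma picard_dx (c cx f fx : R -> R -> R) (n : nat) :
  jcontinuous c -> jcontinuous cx -> jcontinuous f -> jcontinuous fx ->
  has_dx c cx -> has_dx f fx -> has_dx (picard_iter c f n) (picard_iter cx fx n).
Proof.
  intros Cc Ccx Cf Cfx Hc Hf; induction n as [|n IH]; intros s x.
  - exact (is_derive_const (V := R_NormedModule) 0 x).
  - assert (C1 := jcontinuous_source f _ Cf (jcontinuous_picard_iter c f n Cc Cf)).
    assert (C2 := jcontinuous_source fx _ Cfx (jcontinuous_picard_iter cx fx n Ccx Cfx)).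
    apply (is_derive_plus (V := R_NormedModule)); [apply Hc|].
    rewrite <- (duhamel_of_dx s0 (fun b y => f b y - q b * picard_iter c f n b y) _ _ _ C1 C2).
    + apply duhamel_dx, C1.
    + intros b y; apply (is_derive_minus (V := R_NormedModule)); [apply Hf|].
      apply is_derive_scal, IH.
Qed.

(** Points whose domain of dependence stays in a fixed bounded set, on which all bounds are
    uniform. *)
Definition cone (rho s x : R) : Prop := Rabs x + (Rmax s0 s - s0) <= rho.

(** The choice [K = rho Q] in duhamel_diff_bound makes the contraction factor [1 / 2]. *)
Lemma picard_map_contract (c f w1 w2 : R -> R -> R) (rho Q B : R) :
  0 < rho -> 0 < Q -> 0 <= B ->
  (forall b, s0 <= b <= s0 + rho -> Rabs (q b) <= Q) ->
  jcontinuous f -> jcontinuous w1 -> jcontinuous w2 ->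
  (forall s x, cone rho s x ->
     Rabs (w1 s x - w2 s x) <= B * exp (2 * (rho * Q) * (Rmax s0 s - s0))) ->
  forall s x, cone rho s x ->
     Rabs (picard_map c f w1 s x - picard_map c f w2 s x)
     <= B / 2 * exp (2 * (rho * Q) * (Rmax s0 s - s0)).
Proof.
  intros Hrho HQ HB Hq Cf C1 C2 H s x Hsx; unfold picard_map, cone in *.
  match goal with |- Rabs (?a + ?b - (?a + ?c)) <= _ =>
    replace (a + b - (a + c)) with (b - c) by ring end.
  replace (B / 2) with (rho * (Q * B) / (2 * (rho * Q))) by (field; lra).
  apply duhamel_diff_bound; try assumption.
  - nra.
  - nra.
  - apply jcontinuous_source; assumption.
  - apply jcontinuous_source; assumption.
  - intros b y Hb Hy.
    replace (f b y - q b * w1 b y - (f b y - q b * w2 b y))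
      with (- (q b * (w1 b y - w2 b y))) by ring.
    rewrite Rabs_Ropp, Rabs_mult, Rmult_assoc.
    apply Rmult_le_compat; try apply Rabs_pos.
    + apply Hq; pose proof (Rabs_pos y); lra.
    + specialize (H b y); rewrite Rmax_right in H by exact Hb; apply H, Hy.
  - apply Rmax_l.
Qed.

Lemma q_bounded (rho : R) : 0 < rho ->
  exists Q, 0 < Q /\ forall b, s0 <= b <= s0 + rho -> Rabs (q b) <= Q.
Proof.
  intros Hrho.
  destruct (jcontinuous_bounded (fun b _ => q b) s0 (s0 + rho) 0 0) as [M HM];
    [lra|lra| |].
  - intros s x; apply (continuous_comp fst q); [apply cont_fst|apply Cq].
  - exists (Rmax M 1); split.
    + pose proof (Rmax_r M 1); lra.
    + intros b Hb; eapply Rle_trans; [apply (HM b 0 Hb); lra|apply Rmax_l].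
Qed.

Lemma picard_increment (c f : R -> R -> R) (rho : R) : 0 < rho ->
  jcontinuous c -> jcontinuous f ->
  exists M, 0 <= M /\ forall n s x, cone rho s x ->
    Rabs (picard_iter c f (S n) s x - picard_iter c f n s x) <= M * (1 / 2) ^ n.
Proof.
  intros Hrho Cc Cf.
  destruct (q_bounded rho Hrho) as [Q [HQ Hq]].
  assert (C1 := jcontinuous_picard_iter c f 1 Cc Cf).
  destruct (jcontinuous_bounded (picard_iter c f 1) s0 (s0 + rho) (- rho) rho) as [B0 HB0];
    [lra|lra|exact C1|].
  set (B := Rmax B0 0).
  assert (HB : 0 <= B) by apply Rmax_r.
  assert (Hn : forall n s x, cone rho s x ->
     Rabs (picard_iter c f (S n) s x - picard_iter c f n s x)
     <= B * (1 / 2) ^ n * exp (2 * (rho * Q) * (Rmax s0 s - s0))).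
  { induction n as [|n IH].
    - intros s x Hsx; unfold cone in Hsx.
      pose proof (Rabs_pos x); pose proof (Rmax_l s0 s).
      change (picard_iter c f 0 s x) with 0; rewrite Rminus_0_r.
      assert (HB1 : Rabs (picard_iter c f 1 s x) <= B).
      { replace (picard_iter c f 1 s x) with (picard_iter c f 1 (Rmax s0 s) x).
        - eapply Rle_trans; [apply HB0; [lra|]|apply Rmax_l].
          apply Rabs_le_between; lra.
        - simpl; unfold picard_map; rewrite (Rmax_right s0 (Rmax s0 s)) by apply Rmax_l.
          reflexivity. }
      assert (He : 1 <= exp (2 * (rho * Q) * (Rmax s0 s - s0))).
      { eapply Rle_trans; [|apply exp_ineq1_le].
        assert (0 <= 2 * (rho * Q) * (Rmax s0 s - s0))
          by (apply Rmult_le_pos; [nra|lra]).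
        lra. }
      simpl pow; nra.
    - intros s x Hsx.
      replace (B * (1 / 2) ^ S n) with (B * (1 / 2) ^ n / 2) by (simpl; field).
      apply (picard_map_contract c f (picard_iter c f (S n)) (picard_iter c f n) rho Q); auto.
      + apply Rmult_le_pos; [exact HB|apply pow_le; lra].
      + apply jcontinuous_picard_iter; assumption.
      + apply jcontinuous_picard_iter; assumption. }
  exists (B * exp (2 * (rho * Q) * rho)); split.
  - apply Rmult_le_pos; [exact HB|left; apply exp_pos].
  - intros n s x Hsx; eapply Rle_trans; [apply Hn, Hsx|].
    unfold cone in Hsx; pose proof (Rabs_pos x).
    replace (B * exp (2 * (rho * Q) * rho) * (1 / 2) ^ n)
      with (B * (1 / 2) ^ n * exp (2 * (rho * Q) * rho)) by ring.
    apply Rmult_le_compat_l.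
    + apply Rmult_le_pos; [exact HB|apply pow_le; lra].
    + assert (Hle : 2 * (rho * Q) * (Rmax s0 s - s0) <= 2 * (rho * Q) * rho)
        by (apply Rmult_le_compat_l; [nra|lra]).
      destruct Hle as [Hlt|Heq]; [left; apply exp_increasing, Hlt|rewrite Heq; lra].
Qed.

Lemma geometric_steps_close (u : nat -> R) (M : R) : 0 <= M ->
  (forall n, Rabs (u (S n) - u n) <= M * (1 / 2) ^ n) ->
  forall n m, Rabs (u (n + m)%nat - u n) <= 2 * M * (1 / 2) ^ n.
Proof.
  intros HM H n m.
  assert (E : Rabs (u (n + m)%nat - u n) <= 2 * M * (1 / 2) ^ n * (1 - (1 / 2) ^ m)).
  { induction m as [|m IH].
    - rewrite Nat.add_0_r; replace (u n - u n) with 0 by ring.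
      rewrite Rabs_R0; simpl; lra.
    - replace (n + S m)%nat with (S (n + m)) by lia.
      replace (u (S (n + m)) - u n) with
        ((u (S (n + m)) - u (n + m)%nat) + (u (n + m)%nat - u n)) by ring.
      eapply Rle_trans; [apply Rabs_triang|].
      specialize (H (n + m)%nat); rewrite pow_add in H; simpl pow; lra. }
  eapply Rle_trans; [exact E|].
  assert (0 <= (1 / 2) ^ m) by (apply pow_le; lra).
  assert (0 <= 2 * M * (1 / 2) ^ n)
    by (apply Rmult_le_pos; [lra|apply pow_le; lra]).
  nra.
Qed.

Lemma half_pow_small (M eps : R) : 0 <= M -> 0 < eps ->
  exists n0, forall n, (n0 <= n)%nat -> M * (1 / 2) ^ n < eps.
Proof.
  intros HM He.
  assert (L : is_lim_seq (fun n => M * (1 / 2) ^ n) 0).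
  { replace (Finite 0) with (Rbar_mult M 0) by (simpl; f_equal; ring).
    apply is_lim_seq_scal_l, is_lim_seq_geom; rewrite Rabs_pos_eq; lra. }
  apply is_lim_seq_spec in L; destruct (L (mkposreal eps He)) as [n0 H].
  exists n0; intros n Hn; specialize (H n Hn); simpl in H.
  rewrite Rminus_0_r in H; apply Rabs_def2 in H; lra.
Qed.

Lemma geometric_steps_limit (u : nat -> R) (M : R) : 0 <= M ->
  (forall n, Rabs (u (S n) - u n) <= M * (1 / 2) ^ n) ->
  forall n, Rabs (real (Lim_seq u) - u n) <= 2 * M * (1 / 2) ^ n.
Proof.
  intros HM H.
  assert (C := geometric_steps_close u M HM H).
  assert (X : ex_finite_lim_seq u).
  { apply ex_lim_seq_cauchy_corr; intros eps.
    destruct (half_pow_small (2 * M) (eps / 2)) as [n0 Hn0];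
      [lra|pose proof (cond_pos eps); lra|].
    exists n0; intros n m Hn Hm.
    specialize (Hn0 n0 (Nat.le_refl _)).
    pose proof (C n0 (n - n0)%nat) as A1; pose proof (C n0 (m - n0)%nat) as A2.
    replace (n0 + (n - n0))%nat with n in A1 by lia.
    replace (n0 + (m - n0))%nat with m in A2 by lia.
    replace (u n - u m) with ((u n - u n0) - (u m - u n0)) by ring.
    eapply Rle_lt_trans; [apply Rabs_triang|]. rewrite Rabs_Ropp; lra. }
  apply Lim_seq_correct' in X; intros n.
  assert (L : is_lim_seq (fun m => Rabs (u (m + n)%nat - u n))
            (Rabs (real (Lim_seq u) - u n))).
  { apply (is_lim_seq_abs _ (Finite (real (Lim_seq u) - u n))).
    apply is_lim_seq_minus'; [|apply is_lim_seq_const].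
    apply (is_lim_seq_incr_n u n), X. }
  apply (is_lim_seq_le _ _ (Finite _) (Finite _)) with (2 := L)
    (3 := is_lim_seq_const (2 * M * (1 / 2) ^ n)).
  intros m; rewrite Nat.add_comm; apply C.
Qed.

Definition picard_limit (c f : R -> R -> R) (s x : R) : R :=
  real (Lim_seq (fun n => picard_iter c f n s x)).

Lemma picard_limit_close (c f : R -> R -> R) (rho : R) : 0 < rho ->
  jcontinuous c -> jcontinuous f ->
  exists M, 0 <= M /\ forall n s x, cone rho s x ->
    Rabs (picard_limit c f s x - picard_iter c f n s x) <= M * (1 / 2) ^ n.
Proof.
  intros Hrho Cc Cf; destruct (picard_increment c f rho Hrho Cc Cf) as [M [HM H]].
  exists (2 * M); split; [lra|]; intros n s x Hsx.
  apply (geometric_steps_limit (fun n => picard_iter c f n s x) M HM).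
  intros m; apply H, Hsx.
Qed.

Lemma jcontinuous_picard_limit (c f : R -> R -> R) :
  jcontinuous c -> jcontinuous f -> jcontinuous (picard_limit c f).
Proof.
  intros Cc Cf s x.
  set (rho := Rabs x + 1 + (Rmax s0 s + 1 - s0)).
  assert (Hm := Rmax_l s0 s); assert (Hx := Rabs_pos x).
  assert (Hrho : 0 < rho) by (unfold rho; lra).
  destruct (picard_limit_close c f rho Hrho Cc Cf) as [M [HM H]].
  intros P [eps HP].
  change (locally (s, x) (fun r : R * R => P (picard_limit c f (fst r) (snd r)))).
  assert (He := cond_pos eps).
  assert (He4 : 0 < eps / 4) by lra.
  destruct (half_pow_small M (eps / 4) HM He4) as [n Hn].
  specialize (Hn n (Nat.le_refl _)).
  assert (A1 := jcontinuous_picard_iter c f n Cc Cf s x _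
    (locally_ball (picard_iter c f n s x) (mkposreal _ He4))).
  change (locally (s, x) (fun r : R * R =>
    ball (picard_iter c f n s x) (mkposreal _ He4) (picard_iter c f n (fst r) (snd r)))) in A1.
  assert (A2 : locally (s, x) (fun r : R * R => Rabs (fst r - s) < 1 /\ Rabs (snd r - x) < 1)).
  { exists (mkposreal 1 Rlt_0_1); intros [a b] [Ha Hb]; split; [exact Ha|exact Hb]. }
  generalize (filter_and _ _ A1 A2); apply filter_imp.
  intros [a b] [B1 [B2 B3]]; simpl in *; apply HP.
  change (Rabs (picard_iter c f n a b - picard_iter c f n s x) < eps / 4) in B1.
  change (Rabs (picard_limit c f a b - picard_limit c f s x) < eps).
  assert (I1 : cone rho s x) by (unfold cone, rho; lra).
  assert (I2 : cone rho a b).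
  { unfold cone, rho.
    assert (Rabs b <= Rabs x + 1).
    { replace b with (x + (b - x)) by ring.
      eapply Rle_trans; [apply Rabs_triang|lra]. }
    assert (Rmax s0 a <= Rmax s0 s + 1).
    { apply Rabs_def2 in B2; apply Rmax_lub; [lra|].
      pose proof (Rmax_r s0 s); lra. }
    lra. }
  pose proof (H n s x I1) as D1; pose proof (H n a b I2) as D2.
  replace (picard_limit c f a b - picard_limit c f s x) with
    ((picard_limit c f a b - picard_iter c f n a b) + (picard_iter c f n a b - picard_iter c f n s x)
     - (picard_limit c f s x - picard_iter c f n s x)) by ring.
  eapply Rle_lt_trans; [apply Rabs_triang|]; rewrite Rabs_Ropp.
  eapply Rle_lt_trans; [apply Rplus_le_compat_r, Rabs_triang|]. lra.
Qed.

Lemma eq_of_arbitrarily_close (a b M : R) : 0 <= M ->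
  (forall n, Rabs (a - b) <= M * (1 / 2) ^ n) -> a = b.
Proof.
  intros HM H; destruct (Req_dec a b) as [E|E]; [exact E|exfalso].
  assert (Hp : 0 < Rabs (a - b)) by (apply Rabs_pos_lt; lra).
  destruct (half_pow_small M _ HM Hp) as [n Hn].
  specialize (Hn n (Nat.le_refl _)); specialize (H n); lra.
Qed.

Lemma picard_limit_fixed (c f : R -> R -> R) (s x : R) :
  jcontinuous c -> jcontinuous f ->
  picard_limit c f s x = picard_map c f (picard_limit c f) s x.
Proof.
  intros Cc Cf.
  set (rho := Rabs x + 1 + (Rmax s0 s - s0)).
  assert (Hm := Rmax_l s0 s); assert (Hx := Rabs_pos x).
  assert (Hrho : 0 < rho) by (unfold rho; lra).
  assert (I1 : cone rho s x) by (unfold cone, rho; lra).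
  destruct (picard_limit_close c f rho Hrho Cc Cf) as [M [HM H]].
  destruct (q_bounded rho Hrho) as [Q [HQ Hq]].
  set (e := exp (2 * (rho * Q) * (Rmax s0 s - s0))).
  assert (Hep : 0 < e) by apply exp_pos.
  apply (eq_of_arbitrarily_close _ _ (M + M * e)); [nra|].
  intros n.
  assert (A1 : Rabs (picard_map c f (picard_limit c f) s x - picard_map c f (picard_iter c f n) s x)
     <= M * (1 / 2) ^ n / 2 * e).
  { assert (Hpn : 0 <= (1 / 2) ^ n) by (apply pow_le; lra).
    apply (picard_map_contract c f _ _ rho Q); auto.
    - apply Rmult_le_pos; assumption.
    - apply jcontinuous_picard_limit; assumption.
    - apply jcontinuous_picard_iter; assumption.
    - intros a b Hab; eapply Rle_trans; [apply H, Hab|].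
      assert (1 <= exp (2 * (rho * Q) * (Rmax s0 a - s0))).
      { pose proof (Rmax_l s0 a).
        eapply Rle_trans; [|apply exp_ineq1_le].
        assert (0 <= 2 * (rho * Q) * (Rmax s0 a - s0))
          by (apply Rmult_le_pos; nra). lra. }
      assert (0 <= M * (1 / 2) ^ n) by (apply Rmult_le_pos; assumption).
      nra. }
  pose proof (H (S n) s x I1) as A2.
  change (picard_iter c f (S n) s x) with (picard_map c f (picard_iter c f n) s x) in A2.
  assert (Hpn : 0 <= M * (1 / 2) ^ n) by (apply Rmult_le_pos; [exact HM|apply pow_le; lra]).
  replace (picard_limit c f s x - picard_map c f (picard_limit c f) s x) with
    ((picard_limit c f s x - picard_map c f (picard_iter c f n) s x)
     - (picard_map c f (picard_limit c f) s x - picard_map c f (picard_iter c f n) s x)) by ring.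
  eapply Rle_trans; [apply Rabs_triang|]; rewrite Rabs_Ropp.
  simpl pow in A2.
  assert (0 <= M * (1 / 2) ^ n * e) by (apply Rmult_le_pos; lra).
  lra.
Qed.

(** The limits inherit the relation between the iterates in integrated form, which passes
    to the limit under locally uniform convergence. *)
Lemma picard_limit_dx (c cx f fx : R -> R -> R) :
  jcontinuous c -> jcontinuous cx -> jcontinuous f -> jcontinuous fx ->
  has_dx c cx -> has_dx f fx -> has_dx (picard_limit c f) (picard_limit cx fx).
Proof.
  intros Cc Ccx Cf Cfx Hc Hf.
  assert (CL := jcontinuous_picard_limit cx fx Ccx Cfx).
  assert (E : forall s x, picard_limit c f s x
    = picard_limit c f s 0 + space_primitive (picard_limit cx fx) s x).
  { intros s x.
    set (rho := Rabs x + 1 + (Rmax s0 s - s0)).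
    assert (Hm := Rmax_l s0 s); assert (Hx := Rabs_pos x).
    assert (Hrho : 0 < rho) by (unfold rho; lra).
    destruct (picard_limit_close c f rho Hrho Cc Cf) as [M [HM H]].
    destruct (picard_limit_close cx fx rho Hrho Ccx Cfx) as [M' [HM' H']].
    apply (eq_of_arbitrarily_close _ _ (2 * M + Rabs x * M')); [nra|].
    intros n.
    assert (Cn := jcontinuous_picard_iter cx fx n Ccx Cfx).
    assert (En : picard_iter c f n s x - picard_iter c f n s 0 = RInt (picard_iter cx fx n s) 0 x).
    { symmetry; apply (is_RInt_unique (V := R_CompleteNormedModule)).
      apply (is_RInt_derive (V := R_CompleteNormedModule) (picard_iter c f n s) (picard_iter cx fx n s)).
      - intros y _; apply (picard_dx c cx f fx n); assumption.
      - intros y _; apply jcontinuous_snd, Cn. }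
    assert (EI : Rabs (RInt (picard_iter cx fx n s) 0 x - space_primitive (picard_limit cx fx) s x)
       <= Rabs x * (M' * (1 / 2) ^ n)).
    { unfold space_primitive.
      change (Rabs (minus (RInt (picard_iter cx fx n s) 0 x) (RInt (picard_limit cx fx s) 0 x))
        <= Rabs x * (M' * (1 / 2) ^ n)).
      assert (X1 : ex_RInt (picard_iter cx fx n s) 0 x)
        by (apply ex_RInt_cont; intros; apply jcontinuous_snd, Cn).
      assert (X2 : ex_RInt (picard_limit cx fx s) 0 x)
        by (apply ex_RInt_cont; intros; apply jcontinuous_snd, CL).
      rewrite <- (RInt_minus (V := R_CompleteNormedModule)) by assumption.
      assert (X3 : ex_RInt (fun y => minus (picard_iter cx fx n s y) (picard_limit cx fx s y)) 0 x)
        by (apply (ex_RInt_minus (V := R_CompleteNormedModule)); assumption).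
      assert (Bd : forall y, Rabs y <= Rabs x ->
        Rabs (minus (picard_iter cx fx n s y) (picard_limit cx fx s y)) <= M' * (1 / 2) ^ n).
      { intros y Hy.
        change (Rabs (picard_iter cx fx n s y - picard_limit cx fx s y) <= M' * (1 / 2) ^ n).
        rewrite Rabs_minus_sym; apply H'; unfold cone, rho; lra. }
      destruct (Rle_dec 0 x) as [h|h].
      - replace (Rabs x) with (x - 0) by (rewrite Rabs_pos_eq; lra).
        apply abs_RInt_le_const; [exact h|exact X3|].
        intros y Hy; apply Bd; rewrite !Rabs_pos_eq; lra.
      - replace (Rabs x) with (0 - x) by (rewrite Rabs_left; lra).
        rewrite <- (opp_RInt_swap (V := R_CompleteNormedModule))
          by (apply (ex_RInt_swap (V := R_CompleteNormedModule)), X3).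
        change (Rabs (- RInt (fun y => minus (picard_iter cx fx n s y) (picard_limit cx fx s y)) x 0)
          <= (0 - x) * (M' * (1 / 2) ^ n)).
        rewrite Rabs_Ropp; apply abs_RInt_le_const;
          [lra|apply (ex_RInt_swap (V := R_CompleteNormedModule)), X3|].
        intros y Hy; apply Bd; rewrite !Rabs_left1; lra. }
    rewrite <- En in EI.
    pose proof (H n s x ltac:(unfold cone, rho; lra)) as A1.
    pose proof (H n s 0 ltac:(unfold cone, rho; rewrite Rabs_R0; lra)) as A2.
    replace (picard_limit c f s x - (picard_limit c f s 0 + space_primitive (picard_limit cx fx) s x))
      with ((picard_limit c f s x - picard_iter c f n s x)
            - (picard_limit c f s 0 - picard_iter c f n s 0)
            + (picard_iter c f n s x - picard_iter c f n s 0 - space_primitive (picard_limit cx fx) s x)) by ring.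
    eapply Rle_trans; [apply Rabs_triang|].
    eapply Rle_trans; [apply Rplus_le_compat_r, Rabs_triang|]; rewrite Rabs_Ropp.
    lra. }
  intros s x.
  apply (is_derive_ext (fun x => picard_limit c f s 0 + space_primitive (picard_limit cx fx) s x)).
  { intros y; symmetry; apply E. }
  eapply is_derive_eq.
  - apply (is_derive_plus (V := R_NormedModule)).
    + exact (is_derive_const (V := R_NormedModule) (picard_limit c f s 0) x).
    + apply space_primitive_dx, CL.
  - unfold plus, zero; simpl; ring.
Qed.

End Picard.

(** * Existence in the reduced variables *)

Lemma jcontinuous_travelling (G : R -> R) (sg s0 : R) :
  (forall x, continuous G x) -> jcontinuous (fun s x => G (x + sg * (s - s0))).
Proof.
  intros CG s x; unfold jcont.
  apply (continuous_comp (fun r : R * R => snd r + sg * (fst r - s0)) G);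
    [cont|apply CG].
Qed.

Lemma travelling_derivatives (G G1 : R -> R) (sg s0 : R) :
  (forall x, is_derive G x (G1 x)) ->
  has_dx (fun s x => G (x + sg * (s - s0))) (fun s x => G1 (x + sg * (s - s0))) /\
  has_ds (fun s x => G (x + sg * (s - s0))) (fun s x => sg * G1 (x + sg * (s - s0))).
Proof.
  intros H; split; intros s x.
  - eapply is_derive_eq.
    + apply (is_derive_compose G G1 (fun x => x + sg * (s - s0)) x 1); [apply H|].
      auto_derive; [exact I|ring].
    + ring.
  - eapply is_derive_eq.
    + apply (is_derive_compose G G1 (fun s => x + sg * (s - s0)) s sg); [apply H|].
      auto_derive; [exact I|ring].
    + ring.
Qed.

Lemma has_dx_plus (f g fx gx : R -> R -> R) : has_dx f fx -> has_dx g gx ->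
  has_dx (fun s x => f s x + g s x) (fun s x => fx s x + gx s x).
Proof. intros Hf Hg s x; apply (is_derive_plus (V := R_NormedModule)); [apply Hf|apply Hg]. Qed.

Lemma has_ds_plus (f g fs gs : R -> R -> R) : has_ds f fs -> has_ds g gs ->
  has_ds (fun s x => f s x + g s x) (fun s x => fs s x + gs s x).
Proof. intros Hf Hg s x; apply (is_derive_plus (V := R_NormedModule)); [apply Hf|apply Hg]. Qed.

Lemma has_dx_scal (k : R) (f fx : R -> R -> R) : has_dx f fx ->
  has_dx (fun s x => k * f s x) (fun s x => k * fx s x).
Proof. intros Hf s x; apply is_derive_scal, Hf. Qed.

Lemma has_ds_scal (k : R) (f fs : R -> R -> R) : has_ds f fs ->
  has_ds (fun s x => k * f s x) (fun s x => k * fs s x).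
Proof. intros Hf s x; apply is_derive_scal, Hf. Qed.

Lemma jcontinuous_plus (f g : R -> R -> R) : jcontinuous f -> jcontinuous g ->
  jcontinuous (fun s x => f s x + g s x).
Proof. intros Hf Hg s x; unfold jcont; apply cont_plus; [apply Hf|apply Hg]. Qed.

Record wave_solution (s0 : R) (q v0 v1 : R -> R) (h v vs vx vss vsx vxx : R -> R -> R)
  : Prop := {
  ws_c : jcontinuous v; ws_cs : jcontinuous vs; ws_cx : jcontinuous vx;
  ws_css : jcontinuous vss; ws_csx : jcontinuous vsx; ws_cxx : jcontinuous vxx;
  ws_s : has_ds v vs; ws_x : has_dx v vx;
  ws_ss : has_ds vs vss; ws_sx : has_dx vs vsx;
  ws_xs : has_ds vx vsx; ws_xx : has_dx vx vxx;
  ws_eq : forall s x, s0 <= s -> vss s x - vxx s x + q s * v s x = h s x;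
  ws_v0 : forall x, v s0 x = v0 x;
  ws_v1 : forall x, vs s0 x = v1 x }.

(** [v = c + D (h - q p)], where [p] is the fixed point; both agree for [s >= s0], but [v] is
    [C^2] across [s0], whereas [p] is frozen in the past. *)
Lemma wave_solution_exists (s0 : R) (q v0 v01 v02 v1 v11 : R -> R) (h hx : R -> R -> R) :
  (forall s, continuous q s) ->
  (forall x, is_derive v0 x (v01 x)) -> (forall x, is_derive v01 x (v02 x)) ->
  (forall x, continuous v02 x) ->
  (forall x, is_derive v1 x (v11 x)) -> (forall x, continuous v11 x) ->
  jcontinuous h -> jcontinuous hx -> has_dx h hx ->
  exists v vs vx vss vsx vxx, wave_solution s0 q v0 v1 h v vs vx vss vsx vxx.
Proof.
  intros Cq D0 D01 C02 D1 C11 Ch Chx Hh.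
  assert (C1 : forall x, continuous v1 x)
    by (intros x; apply (ex_derive_continuous v1); eexists; apply D1).
  set (V1 := fun x => RInt v1 0 x).
  assert (DV : forall x, is_derive V1 x (v1 x)).
  { intros x; apply (is_derive_RInt (V := R_CompleteNormedModule) v1 V1 0);
      [|apply C1].
    exists (mkposreal 1 Rlt_0_1); intros y _.
    apply (RInt_correct (V := R_CompleteNormedModule)), ex_RInt_cont, C1. }
  (* D'Alembert's left- and right-moving profiles. *)
  set (Gp := fun x => 1 / 2 * (v0 x + V1 x)).
  set (Gp1 := fun x => 1 / 2 * (v01 x + v1 x)).
  set (Gp2 := fun x => 1 / 2 * (v02 x + v11 x)).
  set (Gm := fun x => 1 / 2 * (v0 x - V1 x)).
  set (Gm1 := fun x => 1 / 2 * (v01 x - v1 x)).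
  set (Gm2 := fun x => 1 / 2 * (v02 x - v11 x)).
  assert (Dp : forall x, is_derive Gp x (Gp1 x))
    by (intros; apply is_derive_half_sum; auto).
  assert (Dp1 : forall x, is_derive Gp1 x (Gp2 x))
    by (intros; apply is_derive_half_sum; auto).
  assert (Dm : forall x, is_derive Gm x (Gm1 x))
    by (intros; apply is_derive_half_diff; auto).
  assert (Dm1 : forall x, is_derive Gm1 x (Gm2 x))
    by (intros; apply is_derive_half_diff; auto).
  assert (dc : forall f f' : R -> R, (forall x, is_derive f x (f' x)) ->
     forall x, continuous f x).
  { intros f f' H x; apply (ex_derive_continuous f); eexists; apply H. }
  assert (Cp2 : forall x, continuous Gp2 x) by (intros x; unfold Gp2; specialize (C02 x);
    specialize (C11 x); apply cont_mult; [cont|apply cont_plus; assumption]).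
  assert (Cm2 : forall x, continuous Gm2 x) by (intros x; unfold Gm2; specialize (C02 x);
    specialize (C11 x); apply cont_mult; [cont|apply cont_minus; assumption]).
  set (wv := fun (G : R -> R) sg s x => G (x + sg * (s - s0))).
  set (c := fun s x => wv Gp 1 s x + wv Gm (-1) s x).
  set (cx := fun s x => wv Gp1 1 s x + wv Gm1 (-1) s x).
  set (cs := fun s x => 1 * wv Gp1 1 s x + -1 * wv Gm1 (-1) s x).
  set (cxx := fun s x => wv Gp2 1 s x + wv Gm2 (-1) s x).
  set (csx := fun s x => 1 * wv Gp2 1 s x + -1 * wv Gm2 (-1) s x).
  assert (Cc : jcontinuous c).
  { apply jcontinuous_plus; apply jcontinuous_travelling; eapply dc; eassumption. }
  assert (Ccx : jcontinuous cx).
  { apply jcontinuous_plus; apply jcontinuous_travelling; eapply dc; eassumption. }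
  assert (Ccs : jcontinuous cs).
  { apply jcontinuous_comb; apply jcontinuous_travelling; eapply dc; eassumption. }
  assert (Ccxx : jcontinuous cxx).
  { apply jcontinuous_plus; apply jcontinuous_travelling; assumption. }
  assert (Ccsx : jcontinuous csx).
  { apply jcontinuous_comb; apply jcontinuous_travelling; assumption. }
  assert (Hcx : has_dx c cx).
  { apply has_dx_plus; apply travelling_derivatives; assumption. }
  assert (Hcs : has_ds c cs).
  { apply has_ds_plus; apply travelling_derivatives; assumption. }
  assert (Hcxx : has_dx cx cxx).
  { apply has_dx_plus; apply travelling_derivatives; assumption. }
  assert (Hcxs : has_ds cx csx).
  { apply has_ds_plus; apply travelling_derivatives; assumption. }
  assert (Hcsx : has_dx cs csx).
  { apply has_dx_plus; apply has_dx_scal, travelling_derivatives; assumption. }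
  assert (Hcss : has_ds cs cxx).
  { intros s x; eapply is_derive_eq.
    - apply (has_ds_plus (fun s x => 1 * wv Gp1 1 s x) (fun s x => -1 * wv Gm1 (-1) s x)
        (fun s x => 1 * (1 * wv Gp2 1 s x)) (fun s x => -1 * (-1 * wv Gm2 (-1) s x))).
      + apply (has_ds_scal 1 (wv Gp1 1) (fun s x => 1 * wv Gp2 1 s x)).
        apply travelling_derivatives, Dp1.
      + apply (has_ds_scal (-1) (wv Gm1 (-1)) (fun s x => -1 * wv Gm2 (-1) s x)).
        apply travelling_derivatives, Dm1.
    - unfold cxx; ring. }
  set (p := picard_limit s0 q c h); set (px := picard_limit s0 q cx hx).
  assert (Cpl : jcontinuous p) by (apply jcontinuous_picard_limit; assumption).
  assert (Cplx : jcontinuous px) by (apply jcontinuous_picard_limit; assumption).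
  assert (Hpx : has_dx p px) by (apply picard_limit_dx; assumption).
  set (F := fun s x => h s x - q s * p s x).
  set (Fx := fun s x => hx s x - q s * px s x).
  assert (CF : jcontinuous F) by (apply jcontinuous_source; assumption).
  assert (CFx : jcontinuous Fx) by (apply jcontinuous_source; assumption).
  assert (HF : has_dx F Fx).
  { intros s x; apply (is_derive_minus (V := R_NormedModule)); [apply Hh|].
    apply is_derive_scal, Hpx. }
  exists (fun s x => c s x + duhamel s0 F s x), (fun s x => cs s x + duhamel_s s0 F s x),
    (fun s x => cx s x + duhamel_x s0 F s x),
    (fun s x => cxx s x + (F s x + duhamel_x s0 Fx s x)),
    (fun s x => csx s x + duhamel_s s0 Fx s x),
    (fun s x => cxx s x + duhamel_x s0 Fx s x).
  split.
  - apply jcontinuous_plus; [exact Cc|apply jcontinuous_duhamel, CF].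
  - apply jcontinuous_plus; [exact Ccs|apply jcontinuous_duhamel_s, CF].
  - apply jcontinuous_plus; [exact Ccx|apply jcontinuous_duhamel_x, CF].
  - apply jcontinuous_plus; [exact Ccxx|apply jcontinuous_plus; [exact CF|]].
    apply jcontinuous_duhamel_x, CFx.
  - apply jcontinuous_plus; [exact Ccsx|apply jcontinuous_duhamel_s, CFx].
  - apply jcontinuous_plus; [exact Ccxx|apply jcontinuous_duhamel_x, CFx].
  - apply has_ds_plus; [exact Hcs|apply duhamel_ds, CF].
  - apply has_dx_plus; [exact Hcx|apply duhamel_dx, CF].
  - apply has_ds_plus; [exact Hcss|apply duhamel_ss; assumption].
  - apply has_dx_plus; [exact Hcsx|apply duhamel_sx; assumption].
  - apply has_ds_plus; [exact Hcxs|apply duhamel_xs; assumption].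
  - apply has_dx_plus; [exact Hcxx|apply duhamel_xx; assumption].
  - intros s x Hs.
    assert (E : p s x = c s x + duhamel s0 F s x).
    { unfold p at 1; rewrite picard_limit_fixed by assumption.
      unfold picard_map; rewrite Rmax_right by exact Hs; reflexivity. }
    rewrite <- E; unfold F at 1; ring.
  - intros x; rewrite (proj1 (duhamel_at_start s0 F x)).
    unfold c, wv, Gp, Gm; replace (x + 1 * (s0 - s0)) with x by ring.
    replace (x + -1 * (s0 - s0)) with x by ring; field.
  - intros x; rewrite (proj2 (duhamel_at_start s0 F x)).
    unfold cs, wv, Gp1, Gm1; replace (x + 1 * (s0 - s0)) with x by ring.
    replace (x + -1 * (s0 - s0)) with x by ring; field.
Qed.

(** * Reduction of the kernels to the Riemann function *)

Definition Cexp (z : C) : C := (exp (Re z) * cos (Im z), exp (Re z) * sin (Im z)).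

Lemma Cexp_plus (z w : C) : Cexp (z + w) = (Cexp z * Cexp w)%C.
Proof.
  destruct z as [a b], w as [c d]; unfold Cexp, Cmult, Cplus; simpl.
  rewrite exp_plus, cos_plus, sin_plus.
  apply injective_projections; simpl; ring.
Qed.

Lemma Cexp_RtoC (r : R) : Cexp (RtoC r) = RtoC (exp r).
Proof. unfold Cexp, RtoC; simpl; rewrite cos_0, sin_0, Rmult_0_r, Rmult_1_r; reflexivity. Qed.

Lemma RCpower_Cexp (x : R) (w : C) : RCpower x w = Cexp (w * RtoC (ln x)).
Proof.
  destruct w as [a b]; unfold RCpower, Cexp, Cmult, RtoC; simpl.
  rewrite !Rmult_0_r, Rminus_0_r, Rplus_0_l; reflexivity.
Qed.

Lemma RCpower_mult_base (x y : R) (w : C) : 0 < x -> 0 < y ->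
  RCpower (x * y) w = (RCpower x w * RCpower y w)%C.
Proof.
  intros Hx Hy; rewrite !RCpower_Cexp, <- Cexp_plus, ln_mult, RtoC_plus by assumption.
  f_equal; ring.
Qed.

Lemma phi_pos (k t : R) : k < 1 -> 0 < phi k t.
Proof. intros Hk; apply Rdiv_lt_0_compat; [apply exp_pos|lra]. Qed.

Lemma ln_phi (k t : R) : k < 1 -> ln (phi k t) = (1 - k) * ln t - ln (1 - k).
Proof.
  intros Hk; unfold phi; rewrite ln_div by (apply exp_pos || lra).
  unfold Rpower; rewrite ln_exp; reflexivity.
Qed.

(** The coefficient [N] of the potential [N / s^2] of the reduced equation. *)
Definition reduced_mass (k mu nu2 : R) : R :=
  (1 - delta mu nu2 / ((1 - k) * (1 - k))) / 4.

(** [gam (1 - gam)] is even in [sd]: it depends on [sd^2] only, which is real whatever the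
    sign of [delta]. *)
Lemma gam_reduced_mass (k mu nu2 : R) (sd : C) : k < 1 ->
  is_sqrt (delta mu nu2) sd ->
  (gam k sd * (1 - gam k sd))%C = RtoC (reduced_mass k mu nu2).
Proof.
  intros Hk [Hsd _]; unfold gam, reduced_mass.
  assert (H1 : RtoC (1 - k) <> 0%C) by (apply RtoC_neq0; lra).
  assert (E : RtoC ((1 - delta mu nu2 / ((1 - k) * (1 - k))) / 4)
    = ((1 - sd * sd / (RtoC (1 - k) * RtoC (1 - k))) / 4)%C).
  { rewrite Hsd, <- RtoC_mult, <- RtoC_div, <- RtoC_minus, <- RtoC_div by nra.
    reflexivity. }
  rewrite E, RtoC_mult, RtoC_div by lra.
  generalize dependent (RtoC (1 - k)); intros c Hc _.
  field; exact Hc.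
Qed.

(** Adding exponents, every occurrence of [sd] cancels; this is what the constant [cst] is
    chosen for. *)
Lemma kernel_prefactor (k mu : R) (sd : C) (t b : R) : k < 1 -> 0 < t -> 0 < b ->
  (cst k sd
   * RCpower t (RtoC (- (mu / 2)) + (RtoC 1 - sd) / RtoC 2)
   * RCpower b (RtoC (mu / 2) + (RtoC 1 - sd) / RtoC 2)
   * RCpower (4 * phi k t * phi k b) (- gam k sd))%C
  = RtoC (1 / 2 * Rpower t ((k - mu) / 2) * Rpower b ((k + mu) / 2)).
Proof.
  intros Hk Ht Hb.
  assert (L : ln (4 * phi k t * phi k b)
    = 2 * ln 2 + (1 - k) * (ln t + ln b) - 2 * ln (1 - k)).
  { assert (H1 := phi_pos k t Hk); assert (H2 := phi_pos k b Hk).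
    rewrite ln_mult by nra; rewrite ln_mult by lra; rewrite !ln_phi by exact Hk.
    replace 4 with (2 * 2) by ring; rewrite ln_mult by lra; ring. }
  unfold cst; rewrite !RCpower_Cexp, L, <- !Cexp_plus.
  assert (H1 : RtoC (1 - k) <> 0%C) by (apply RtoC_neq0; lra).
  transitivity (Cexp (RtoC (- ln 2 + (k - mu) / 2 * ln t + (k + mu) / 2 * ln b))).
  - f_equal; unfold gam.
    replace ((k - mu) / 2) with (- (mu / 2) + (1 - (1 - k)) / 2) by field.
    replace ((k + mu) / 2) with (mu / 2 + (1 - (1 - k)) / 2) by field.
    clear L; generalize dependent (1 - k); intros c Hc; generalize (mu / 2); intros m.
    rewrite ?RtoC_plus, ?RtoC_minus, ?RtoC_mult, ?RtoC_opp, ?RtoC_plus, ?RtoC_mult,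
      ?RtoC_minus, ?RtoC_div, ?RtoC_opp, ?RtoC_minus, ?RtoC_plus, ?RtoC_mult,
      ?RtoC_opp by lra.
    field; exact Hc.
  - rewrite Cexp_RtoC, !exp_plus, exp_Ropp, exp_ln by lra.
    unfold Rpower; f_equal; field.
Qed.

(** With [M] and [P] as in the definition of the kernel, [P = 4 phi(t) phi(b) (1 + zeta)] and
    [M / P = zeta / (1 + zeta)]: Pfaff's variable appears by itself. *)
Lemma kernelE_riemann (k mu : R) (sd : C) (Phi : R -> R) (t x b y : R) :
  k < 1 -> 0 < t -> 0 < b ->
  (forall z, 0 <= z ->
      (RCpower (1 + z) (- gam k sd)
       * hypergeom (gam k sd) (gam k sd) (RtoC 1) (RtoC (z / (1 + z))))%C
      = RtoC (Phi z)) ->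
  Rabs (y - x) <= Rabs (phi k t - phi k b) ->
  kernelE k mu sd t x b y
  = RtoC (1 / 2 * Rpower t ((k - mu) / 2) * Rpower b ((k + mu) / 2)
          * riemann Phi (phi k t) (phi k b) (y - x)).
Proof.
  intros Hk Ht Hb HPhi Hy.
  assert (H1 := phi_pos k t Hk); assert (H2 := phi_pos k b Hk).
  assert (H4 : 0 < 4 * phi k t * phi k b) by nra.
  set (M := (phi k t - phi k b) ^ 2 - (y - x) ^ 2).
  set (P := (phi k t + phi k b) ^ 2 - (y - x) ^ 2).
  assert (HM : 0 <= M).
  { apply Rsqr_le_abs_1 in Hy; unfold M, Rsqr in *; simpl; lra. }
  assert (HPM : P = M + 4 * phi k t * phi k b) by (unfold P, M; ring).
  assert (Hz : zeta (phi k t) (phi k b) (y - x) = M / (4 * phi k t * phi k b))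
    by (unfold zeta, M; field; lra).
  assert (Hz0 : 0 <= zeta (phi k t) (phi k b) (y - x)).
  { rewrite Hz; apply Rdiv_le_0_compat; assumption. }
  rewrite RtoC_mult; unfold riemann; rewrite <- HPhi by exact Hz0.
  unfold kernelE; fold M; fold P; cbv zeta.
  rewrite <- (kernel_prefactor k mu sd t b Hk Ht Hb).
  replace P with ((4 * phi k t * phi k b) * (1 + zeta (phi k t) (phi k b) (y - x)))
    at 1 by (rewrite Hz, HPM; field; lra).
  rewrite RCpower_mult_base by lra.
  replace (M / P) with (zeta (phi k t) (phi k b) (y - x)
                        / (1 + zeta (phi k t) (phi k b) (y - x)))
    by (rewrite Hz, HPM; field; lra).
  ring.
Qed.

(** Only the open interval matters, so the kernels need not be evaluated on the
    characteristics. *)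
Lemma CRInt_RtoC (f : R -> C) (r : R -> R) (a b : R) :
  (forall y, Rmin a b < y < Rmax a b -> f y = RtoC (r y)) -> ex_RInt r a b ->
  CRInt f a b = RtoC (RInt r a b).
Proof.
  intros E X; apply (RInt_correct (V := R_CompleteNormedModule)) in X.
  unfold CRInt; apply (is_RInt_unique (V := C_R_CompleteNormedModule)).
  apply (is_RInt_ext (V := C_R_NormedModule) (fun y => RtoC (r y))).
  { intros y Hy; symmetry; apply E, Hy. }
  apply (is_RInt_fct_extend_pair (U := R_NormedModule) (V := R_NormedModule)); simpl.
  - exact X.
  - pose proof (is_RInt_const (V := R_NormedModule) a b 0) as Z.
    refine (eq_ind _ (fun l : R => is_RInt (fun _ : R => 0) a b l) Z 0 _).
    change ((b - a) * 0 = 0); ring.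
Qed.

Lemma CRDerive_RtoC (f : R -> C) (r : R -> R) (x l : R) :
  locally x (fun b => f b = RtoC (r b)) -> is_derive r x l ->
  CRDerive f x = RtoC l.
Proof.
  intros E D.
  assert (H : is_derive (K := R_AbsRing) (V := C_R_NormedModule) f x (RtoC l)).
  { apply (is_derive_ext_loc (V := C_R_NormedModule) (fun b => RtoC (r b))).
    { revert E; apply filter_imp; intros b Hb; symmetry; exact Hb. }
    assert (S : forall z : R, scal (V := C_R_NormedModule) z (RtoC 1) = RtoC z).
    { intros z; apply injective_projections; simpl; unfold scal; simpl;
        unfold mult; simpl; ring. }
    rewrite <- S.
    apply (is_derive_ext (V := C_R_NormedModule)
      (fun b => scal (V := C_R_NormedModule) (r b) (RtoC 1))).
    { intros b; apply S. }
    apply (is_derive_scal_l (V := C_R_NormedModule)), D. }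
  unfold CRDerive; apply (iota_unique (V := C_R_CompleteNormedModule)); [|exact H].
  intros y Hy.
  assert (P : forall g : C -> R, is_linear (U := C_R_NormedModule) (V := R_NormedModule) g ->
    g y = g (RtoC l)).
  { intros g Hg.
    assert (Q : forall z, is_derive (K := R_AbsRing) (V := C_R_NormedModule) f x z ->
              is_derive (fun b => g (f b)) x (g z)).
    { intros z Hz.
      assert (F := filterdiff_comp' (U := AbsRing_NormedModule R_AbsRing)
         (V := C_R_NormedModule) (W := R_NormedModule) f g x _ _ Hz
         (filterdiff_linear (U := C_R_NormedModule) (V := R_NormedModule)
           (F := locally (T := C_R_NormedModule) (f x)) g Hg)).
      eapply filterdiff_ext_lin; [exact F|].
      intros h; exact (linear_scal (U := C_R_NormedModule) (V := R_NormedModule) g Hg h z). }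
    rewrite <- (is_derive_unique _ _ _ (Q _ Hy)); apply is_derive_unique, Q, H. }
  apply injective_projections.
  - apply (P fst), is_linear_fst.
  - apply (P snd), is_linear_snd.
Qed.

(** * Time derivatives up to the boundary of the slab *)

Lemma slab_path {U : UniformSpace} (f : R -> R -> R) (a b : U -> R) (t : U) :
  slab_continuous f -> (forall t, 1 <= a t) -> continuous a t -> continuous b t ->
  continuous (fun t => f (a t) (b t)) t.
Proof.
  intros Hf Ha Ca Cb.
  assert (H := Hf (a t, b t) (Ha t)).
  intros P HP; specialize (H P HP).
  assert (Hp := cont_pair a b t Ca Cb _ H).
  unfold filtermap in *; revert Hp; apply filter_imp.
  intros q Hq; apply Hq; apply Ha.
Qed.

Lemma slab_continuous_of_jcont (f : R -> R -> R) :
  (forall t x, 1 <= t -> jcont f t x) -> slab_continuous f.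
Proof.
  intros H [t x] Ht P HP; specialize (H t x Ht P HP).
  unfold filtermap, within in *; revert H; apply filter_imp; tauto.
Qed.

Lemma is_dt_spec (f : R -> R -> R) (t x l : R) : 1 <= t ->
  is_dt f t x l <->
  forall eps : posreal, locally t (fun s => 1 <= s ->
    Rabs (f s x - f t x - (s - t) * l) <= eps * Rabs (s - t)).
Proof.
  intros Ht; split.
  - intros [_ H] eps.
    assert (L : is_filter_lim (within (fun s => 1 <= s) (locally t)) t).
    { intros P HP; unfold within; revert HP; apply filter_imp; tauto. }
    exact (H t L eps).
  - intros H; split; [apply (is_linear_scal_l (K := R_AbsRing) (V := R_NormedModule))|].
    intros z Hz.
    assert (E : z = t).
    { destruct (Req_dec z t) as [E|E]; [exact E|exfalso].
      assert (Hd : 0 < Rabs (t - z)) by (apply Rabs_pos_lt; lra).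
      destruct (Hz _ (locally_ball z (mkposreal _ Hd))) as [d Hd'].
      specialize (Hd' t (ball_center t d) Ht).
      change (Rabs (t - z) < Rabs (t - z)) in Hd'; lra. }
    subst z; intros eps; exact (H eps).
Qed.

Lemma is_dt_interior (f : R -> R -> R) (t x l : R) : 1 < t ->
  is_dt f t x l -> is_derive (fun s => f s x) t l.
Proof.
  intros Ht H; rewrite is_dt_spec in H by lra.
  split; [apply (is_linear_scal_l (K := R_AbsRing) (V := R_NormedModule))|].
  intros z Hz.
  apply (is_filter_lim_locally_unique (V := R_NormedModule)) in Hz; subst z.
  intros eps.
  assert (L : locally t (fun s => 1 <= s)).
  { assert (Hd : 0 < t - 1) by lra.
    exists (mkposreal _ Hd); intros s Hs.
    change (Rabs (s - t) < t - 1) in Hs; apply Rabs_def2 in Hs; lra. }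
  generalize (filter_and _ _ L (H eps)); apply filter_imp.
  intros s [h1 h2]; exact (h2 h1).
Qed.

Lemma is_dt_of_derive (f : R -> R -> R) (t x l : R) : 1 <= t ->
  is_derive (fun s => f s x) t l -> is_dt f t x l.
Proof.
  intros Ht [_ H]; apply is_dt_spec; [exact Ht|]; intros eps.
  assert (L : is_filter_lim (locally t) t) by (intros P HP; exact HP).
  generalize (H t L eps); apply filter_imp; intros s Hs _; exact Hs.
Qed.

(** The half-line [[1, +oo)] accumulates at its endpoint, so the one-sided derivative there
    is unique; this identifies the time derivative of a solution at [t = 1] with [u1]. *)
Lemma is_dt_unique (f : R -> R -> R) (t x l m : R) : 1 <= t ->
  is_dt f t x l -> is_dt f t x m -> l = m.
Proof.
  intros Ht H1 H2; rewrite is_dt_spec in H1, H2 by exact Ht.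
  destruct (Req_dec l m) as [E|E]; [exact E|exfalso].
  assert (He : 0 < Rabs (l - m) / 4).
  { assert (0 < Rabs (l - m)) by (apply Rabs_pos_lt; lra). lra. }
  destruct (filter_and _ _ (H1 (mkposreal _ He)) (H2 (mkposreal _ He))) as [d Hd].
  assert (Hd0 := cond_pos d).
  assert (Hb : ball t d (t + d / 2)).
  { change (Rabs (t + d / 2 - t) < d).
    replace (t + d / 2 - t) with (d / 2) by ring; rewrite Rabs_pos_eq; lra. }
  destruct (Hd _ Hb) as [A1 A2]; simpl in A1, A2.
  specialize (A1 ltac:(lra)); specialize (A2 ltac:(lra)).
  replace (t + d / 2 - t) with (d / 2) in A1, A2 by ring.
  rewrite (Rabs_pos_eq (d / 2)) in A1, A2 by lra.
  assert (A3 : Rabs (d / 2 * (l - m)) <= Rabs (l - m) / 2 * (d / 2)).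
  { replace (d / 2 * (l - m)) with
      ((f (t + d / 2) x - f t x - d / 2 * m) - (f (t + d / 2) x - f t x - d / 2 * l))
      by ring.
    eapply Rle_trans; [apply Rabs_triang|]; rewrite Rabs_Ropp; lra. }
  rewrite Rabs_mult, (Rabs_pos_eq (d / 2)) in A3 by lra.
  nra.
Qed.

(** * Change of time variable *)

Lemma is_derive_Rpower (a t : R) : 0 < t ->
  is_derive (fun t => Rpower t a) t (a * Rpower t a / t).
Proof.
  intros Ht; unfold Rpower; auto_derive; [exact Ht|]. field; lra.
Qed.

Lemma Rpower_pos (a t : R) : 0 < Rpower t a.
Proof. apply exp_pos. Qed.

Lemma Rpower_1_base (a : R) : Rpower 1 a = 1.
Proof. unfold Rpower; rewrite ln_1, Rmult_0_r; apply exp_0. Qed.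

Definition phi_inv (k s : R) : R := Rpower ((1 - k) * s) (/ (1 - k)).

Lemma phi_inv_phi (k t : R) : k < 1 -> 0 < t -> phi_inv k (phi k t) = t.
Proof.
  intros Hk Ht; unfold phi_inv, phi.
  replace ((1 - k) * (Rpower t (1 - k) / (1 - k))) with (Rpower t (1 - k))
    by (field; lra).
  rewrite Rpower_mult, Rinv_r, Rpower_1; lra.
Qed.

Lemma phi_phi_inv (k s : R) : k < 1 -> 0 < s -> phi k (phi_inv k s) = s.
Proof.
  intros Hk Hs; unfold phi_inv, phi.
  rewrite Rpower_mult, Rinv_l, Rpower_1 by nra. field; lra.
Qed.

Lemma Rpower_1_minus (k t : R) : 0 < t -> Rpower t (1 - k) = t / Rpower t k.
Proof.
  intros Ht; unfold Rminus; rewrite Rpower_plus, Rpower_Ropp, Rpower_1; auto.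
Qed.

Lemma is_derive_phi (k t : R) : k < 1 -> 0 < t ->
  is_derive (phi k) t (/ Rpower t k).
Proof.
  intros Hk Ht; unfold phi.
  apply (is_derive_ext (fun t => / (1 - k) * Rpower t (1 - k))).
  { intros s; unfold Rdiv; Rring. }
  eapply is_derive_eq; [apply is_derive_scal, is_derive_Rpower, Ht|].
  rewrite Rpower_1_minus by exact Ht.
  pose proof (Rpower_pos k t); field; lra.
Qed.

Lemma is_derive_phi_inv (k s : R) : k < 1 -> 0 < s ->
  is_derive (phi_inv k) s (Rpower (phi_inv k s) k).
Proof.
  intros Hk Hs.
  eapply is_derive_eq.
  - apply (is_derive_compose (fun z => Rpower z (/ (1 - k)))
      (fun z => / (1 - k) * Rpower z (/ (1 - k)) / z) (fun s => (1 - k) * s) s (1 - k)).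
    + apply is_derive_Rpower; nra.
    + auto_derive; [exact I|ring].
  - assert (E := Rpower_1_minus k (phi_inv k s) (Rpower_pos _ _)).
    assert (F : Rpower (phi_inv k s) (1 - k) = (1 - k) * s).
    { pose proof (phi_phi_inv k s Hk Hs) as P; unfold phi in P.
      rewrite <- P at 2; field; lra. }
    rewrite F in E; fold (phi_inv k s).
    pose proof (Rpower_pos k (phi_inv k s)).
    assert (E2 : phi_inv k s = (1 - k) * s * Rpower (phi_inv k s) k).
    { rewrite E; field; lra. }
    rewrite E2 at 1; field; nra.
Qed.

Lemma phi_increasing (k t t' : R) : k < 1 -> 0 < t -> t < t' -> phi k t < phi k t'.
Proof.
  intros Hk Ht Htt; unfold phi.
  apply Rmult_lt_compat_r; [apply Rinv_0_lt_compat; lra|].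
  unfold Rpower; apply exp_increasing, Rmult_lt_compat_l; [lra|].
  apply ln_increasing; assumption.
Qed.

Lemma phi_nondecreasing (k t t' : R) : k < 1 -> 0 < t -> t <= t' -> phi k t <= phi k t'.
Proof.
  intros Hk Ht [Htt|<-]; [left; apply phi_increasing; assumption|lra].
Qed.

Lemma phi_inv_gt_1 (k s : R) : k < 1 -> phi k 1 < s -> 1 < phi_inv k s.
Proof.
  intros Hk Hs; assert (H1 := phi_pos k 1 Hk).
  destruct (Rlt_le_dec 1 (phi_inv k s)) as [h|h]; [exact h|exfalso].
  assert (phi k (phi_inv k s) <= phi k 1)
    by (apply phi_nondecreasing; [exact Hk|apply Rpower_pos|exact h]).
  rewrite phi_phi_inv in H by lra; lra.
Qed.

(** The original time as a function of [s = phi k t], frozen at [1] for [s < phi k 1] so that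
    functions on the slab pull back to continuous functions on the plane. *)
Definition tau (k s : R) : R := phi_inv k (Rmax (phi k 1) s).

Lemma tau_ge_1 (k s : R) : k < 1 -> 1 <= tau k s.
Proof.
  intros Hk; unfold tau.
  destruct (Rle_lt_or_eq_dec _ _ (Rmax_l (phi k 1) s)) as [h|h].
  - left; apply phi_inv_gt_1; assumption.
  - rewrite <- h, phi_inv_phi; lra.
Qed.

Lemma tau_phi (k t : R) : k < 1 -> 1 <= t -> tau k (phi k t) = t.
Proof.
  intros Hk Ht; unfold tau; rewrite Rmax_right by (apply phi_nondecreasing; lra).
  apply phi_inv_phi; lra.
Qed.

Lemma cont_tau {U : UniformSpace} (k : R) (f : U -> R) (t : U) : k < 1 ->
  continuous f t -> continuous (fun t => tau k (f t)) t.
Proof.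
  intros Hk Hf; unfold tau.
  apply (continuous_comp (fun t => Rmax (phi k 1) (f t)) (phi_inv k)).
  - apply cont_Rmax, Hf.
  - apply (ex_derive_continuous (phi_inv k)); eexists; apply is_derive_phi_inv;
      [exact Hk|].
    pose proof (phi_pos k 1 Hk); pose proof (Rmax_l (phi k 1) (f t)); lra.
Qed.

Lemma cont_Rpower {U : UniformSpace} (a : R) (f : U -> R) (t : U) : 0 < f t ->
  continuous f t -> continuous (fun t => Rpower (f t) a) t.
Proof.
  intros Hp Hf; apply (continuous_comp f (fun z => Rpower z a)); [exact Hf|].
  apply (ex_derive_continuous (fun z => Rpower z a)); eexists.
  apply is_derive_Rpower, Hp.
Qed.

Lemma is_derive_tau (k : R) (W W1 : R -> R) (s : R) : k < 1 -> phi k 1 < s ->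
  (forall t, 1 < t -> is_derive W t (W1 t)) ->
  is_derive (fun s => W (tau k s)) s (Rpower (tau k s) k * W1 (tau k s)).
Proof.
  intros Hk Hs HW.
  assert (Hp := phi_pos k 1 Hk).
  assert (E : forall z, phi k 1 < z -> tau k z = phi_inv k z).
  { intros z Hz; unfold tau; rewrite Rmax_right; lra. }
  apply (is_derive_ext_loc (fun s => W (phi_inv k s))).
  - assert (Hd : 0 < s - phi k 1) by lra.
    exists (mkposreal _ Hd); intros z Hz.
    change (Rabs (z - s) < s - phi k 1) in Hz; apply Rabs_def2 in Hz.
    rewrite E by lra; reflexivity.
  - rewrite !E by exact Hs; rewrite Rmult_comm.
    apply (is_derive_compose W W1 (phi_inv k)).
    + apply HW, phi_inv_gt_1; assumption.
    + apply is_derive_phi_inv; lra.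
Qed.

(** * Representation of a given solution *)

Lemma Derive_n_2 (f f1 : R -> R) (t l : R) :
  locally t (fun s => is_derive f s (f1 s)) -> is_derive f1 t l ->
  Derive_n f 2 t = l.
Proof.
  intros H1 H2; apply is_derive_unique.
  apply (is_derive_ext_loc f1); [|exact H2].
  revert H1; apply filter_imp; intros s Hs; symmetry.
  apply is_derive_unique; exact Hs.
Qed.

Lemma locally_gt (a t : R) : a < t -> locally t (fun s => a < s).
Proof.
  intros H; assert (Hd : 0 < t - a) by lra.
  exists (mkposreal _ Hd); intros z Hz.
  change (Rabs (z - t) < t - a) in Hz; apply Rabs_def2 in Hz; lra.
Qed.

Lemma is_derive_sum (f g : R -> R) (x l m : R) :
  is_derive f x l -> is_derive g x m -> is_derive (fun x => f x + g x) x (l + m).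
Proof. apply (is_derive_plus (V := R_NormedModule)). Qed.

Section Solution.
Variables (k mu nu2 : R) (u0 u1 : R -> R) (g u : R -> R -> R).
Hypothesis Hk : 0 < k < 1.
Variables ut ux utt uxx : R -> R -> R.
Hypothesis (Su : slab_continuous u) (Sut : slab_continuous ut)
  (Sutt : slab_continuous utt) (Suxx : slab_continuous uxx).
Hypothesis Dt : forall t x, 1 < t -> is_derive (fun t => u t x) t (ut t x).
Hypothesis Dx : forall t x, 1 < t -> is_derive (u t) x (ux t x).
Hypothesis Dtt : forall t x, 1 < t -> is_derive (fun t => ut t x) t (utt t x).
Hypothesis Dxx : forall t x, 1 < t -> is_derive (ux t) x (uxx t x).
Hypothesis Heq : forall t x, 1 < t ->
  utt t x - Rpower t (- (2 * k)) * uxx t x + mu * / t * ut t x + nu2 * / t ^ 2 * u t x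
  = g t x.
Hypothesis Hu0 : forall x, u 1 x = u0 x.
Hypothesis Hu1 : forall x, ut 1 x = u1 x.

Let beta := (mu - k) / 2.
Let N := reduced_mass k mu nu2.
Let s0 := phi k 1.

(** The reduced unknown and its derivatives, written with the powers that the chain rule
    produces; [reduced_source] is the left-hand side of the reduced equation. *)
Definition reduced (s x : R) : R := Rpower (tau k s) beta * u (tau k s) x.
Definition reduced_x (s x : R) : R := Rpower (tau k s) beta * ux (tau k s) x.
Definition reduced_xx (s x : R) : R := Rpower (tau k s) beta * uxx (tau k s) x.
Definition reduced_s (s x : R) : R :=
  beta * (Rpower (tau k s) (beta + k - 1) * u (tau k s) x)
  + Rpower (tau k s) (beta + k) * ut (tau k s) x.
Definition reduced_ss (s x : R) : R :=
  Rpower (tau k s) k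
  * (beta * ((beta + k - 1) * Rpower (tau k s) (beta + k - 1) / tau k s * u (tau k s) x
           + Rpower (tau k s) (beta + k - 1) * ut (tau k s) x)
     + ((beta + k) * Rpower (tau k s) (beta + k) / tau k s * ut (tau k s) x
        + Rpower (tau k s) (beta + k) * utt (tau k s) x)).
Definition reduced_source (s x : R) : R :=
  reduced_ss s x - reduced_xx s x + N / (Rmax s0 s * Rmax s0 s) * reduced s x.

Lemma tau_pos (s : R) : 0 < tau k s.
Proof. pose proof (tau_ge_1 k s (proj2 Hk)); lra. Qed.

Lemma Rpower_split (t : R) : 0 < t ->
  Rpower t (beta + k - 1) = Rpower t beta * Rpower t k / t /\
  Rpower t (beta + k) = Rpower t beta * Rpower t k.
Proof.
  intros Ht; split.
  - unfold Rminus; rewrite !Rpower_plus, Rpower_Ropp, Rpower_1 by exact Ht; reflexivity.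
  - apply Rpower_plus.
Qed.

Lemma cont_tau_fst (s x : R) : continuous (fun r : R * R => tau k (fst r)) (s, x).
Proof. apply cont_tau; [lra|apply cont_fst]. Qed.

Lemma cont_tau_power (a s x : R) :
  continuous (fun r : R * R => Rpower (tau k (fst r)) a) (s, x).
Proof. apply cont_Rpower; [apply tau_pos|apply cont_tau_fst]. Qed.

Lemma cont_slab_tau (f : R -> R -> R) (s x : R) : slab_continuous f ->
  continuous (fun r : R * R => f (tau k (fst r)) (snd r)) (s, x).
Proof.
  intros Hf; apply (slab_path f (fun r : R * R => tau k (fst r)) snd); [exact Hf| | |].
  - intros r; apply tau_ge_1; lra.
  - apply cont_tau_fst.
  - apply cont_snd.
Qed.

Lemma reduced_continuous :
  jcontinuous reduced /\ jcontinuous reduced_s /\ jcontinuous reduced_ss /\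
  jcontinuous reduced_xx /\ jcontinuous reduced_source.
Proof.
  assert (Cv : jcontinuous reduced).
  { intros s x; apply cont_mult; [apply cont_tau_power|apply cont_slab_tau, Su]. }
  assert (Cvxx : jcontinuous reduced_xx).
  { intros s x; apply cont_mult; [apply cont_tau_power|apply cont_slab_tau, Suxx]. }
  assert (Cvss : jcontinuous reduced_ss).
  { intros s x; unfold jcont, reduced_ss.
    assert (P := fun a => cont_tau_power a s x).
    assert (T := cont_tau_fst s x).
    assert (Q := fun f Hf => cont_slab_tau f s x Hf).
    pose proof (tau_pos s).
    apply cont_mult; [apply P|]; apply cont_plus.
    - apply cont_mult; [apply continuous_const|]; apply cont_plus; apply cont_mult.
      + apply cont_div; [simpl; lra| |exact T].
        apply cont_mult; [apply continuous_const|apply P].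
      + apply Q, Su.
      + apply P.
      + apply Q, Sut.
    - apply cont_plus; apply cont_mult.
      + apply cont_div; [simpl; lra| |exact T].
        apply cont_mult; [apply continuous_const|apply P].
      + apply Q, Sut.
      + apply P.
      + apply Q, Sutt. }
  repeat split; try assumption.
  - intros s x; unfold jcont, reduced_s; apply cont_plus.
    + apply cont_mult; [apply continuous_const|].
      apply cont_mult; [apply cont_tau_power|apply cont_slab_tau, Su].
    + apply cont_mult; [apply cont_tau_power|apply cont_slab_tau, Sut].
  - intros s x; unfold jcont, reduced_source; apply cont_plus.
    + apply cont_minus; [apply Cvss|apply Cvxx].
    + apply cont_mult; [|apply Cv].
      assert (0 < Rmax s0 s).
      { pose proof (phi_pos k 1 (proj2 Hk)); pose proof (Rmax_l s0 s).
        unfold s0 in *; lra. }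
      apply cont_div; [simpl; nra|apply continuous_const|].
      apply cont_mult; apply cont_Rmax, cont_fst.
Qed.

Lemma reduced_derivatives (s x : R) : s0 < s ->
  is_derive (fun s => reduced s x) s (reduced_s s x) /\
  is_derive (fun s => reduced_s s x) s (reduced_ss s x) /\
  is_derive (reduced s) x (reduced_x s x) /\
  is_derive (reduced_x s) x (reduced_xx s x).
Proof.
  intros Hs.
  assert (Ht : 1 < tau k s).
  { unfold tau; rewrite Rmax_right by (unfold s0 in Hs; lra).
    apply phi_inv_gt_1; [lra|exact Hs]. }
  split; [|split; [|split]].
  - eapply is_derive_eq.
    + apply (is_derive_tau k (fun t => Rpower t beta * u t x)
        (fun t => beta * Rpower t beta / t * u t x + Rpower t beta * ut t x)); [lra|exact Hs|].
      intros t Ht1.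
      apply (Derive.is_derive_mult (fun t => Rpower t beta) (fun t => u t x));
        [apply is_derive_Rpower; lra|apply Dt, Ht1].
    + unfold reduced_s; destruct (Rpower_split (tau k s)) as [-> ->]; [lra|].
      field; lra.
  - apply (is_derive_tau k
      (fun t => beta * (Rpower t (beta + k - 1) * u t x) + Rpower t (beta + k) * ut t x)
      (fun t => beta * ((beta + k - 1) * Rpower t (beta + k - 1) / t * u t x
           + Rpower t (beta + k - 1) * ut t x)
        + ((beta + k) * Rpower t (beta + k) / t * ut t x + Rpower t (beta + k) * utt t x)));
      [lra|exact Hs|].
    intros t Ht1; apply is_derive_sum; [apply is_derive_scal|].
    + apply (Derive.is_derive_mult (fun t => Rpower t (beta + k - 1)) (fun t => u t x));
        [apply is_derive_Rpower; lra|apply Dt, Ht1].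
    + apply (Derive.is_derive_mult (fun t => Rpower t (beta + k)) (fun t => ut t x));
        [apply is_derive_Rpower; lra|apply Dtt, Ht1].
  - apply is_derive_scal, Dx, Ht.
  - apply is_derive_scal, Dxx, Ht.
Qed.

(** The exponent [beta] is the one that removes the first-order term, and the remaining
    zeroth-order coefficient is [N / s^2]. *)
Lemma reduced_source_eq (t x : R) : 1 < t ->
  reduced_source (phi k t) x = Rpower t beta * (Rpower t k * Rpower t k) * g t x.
Proof.
  intros Ht; unfold reduced_source, reduced_ss, reduced_xx, reduced.
  rewrite tau_phi by lra.
  rewrite Rmax_right by (apply phi_nondecreasing; lra).
  rewrite <- Heq by exact Ht.
  destruct (Rpower_split t) as [-> ->]; [lra|].
  assert (E : Rpower t (- (2 * k)) = / (Rpower t k * Rpower t k)).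
  { rewrite Rpower_Ropp; replace (2 * k) with (k + k) by ring.
    rewrite Rpower_plus; reflexivity. }
  rewrite E; unfold phi; rewrite Rpower_1_minus by lra.
  pose proof (Rpower_pos k t) as H1; pose proof (Rpower_pos beta t) as H2.
  unfold N, reduced_mass, delta, beta in *.
  set (p := Rpower t ((mu - k) / 2)) in *; set (T := Rpower t k) in *.
  field; lra.
Qed.

Variables Phi Phi1 Phi2 : R -> R.
Hypothesis HPhi : riemann_profile N Phi Phi1 Phi2.

(** [real_E] and [real_K0] are the real numbers to which the kernels [kernelE] and
    [kernelK0] reduce. *)
Definition real_E (t x b y : R) : R :=
  1 / 2 * Rpower t ((k - mu) / 2) * Rpower b ((k + mu) / 2)
  * riemann Phi (phi k t) (phi k b) (y - x).
Definition real_K0 (t x y : R) : R :=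
  1 / 2 * Rpower t ((k - mu) / 2)
  * (beta * riemann Phi (phi k t) s0 (y - x) - riemann_b Phi1 (phi k t) s0 (y - x)).

Definition real_source (t x b : R) : R :=
  RInt (fun y => g b y * real_E t x b y)
    (x - phi k t + phi k b) (x + phi k t - phi k b).

Lemma riemann_integrable (t x b : R) (f : R -> R) : 1 <= b -> b <= t ->
  (forall y, continuous f y) ->
  ex_RInt (fun y => f y * riemann Phi (phi k t) (phi k b) (y - x))
    (x - (phi k t - phi k b)) (x + (phi k t - phi k b)) /\
  ex_RInt (fun y => f y * riemann_b Phi1 (phi k t) (phi k b) (y - x))
    (x - (phi k t - phi k b)) (x + (phi k t - phi k b)).
Proof.
  intros Hb Hbt Cf.
  assert (H1 := phi_pos k b (proj2 Hk)).
  assert (H2 : phi k b <= phi k t) by (apply phi_nondecreasing; lra).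
  assert (X : forall y, Rmin (x - (phi k t - phi k b)) (x + (phi k t - phi k b)) <= y
     <= Rmax (x - (phi k t - phi k b)) (x + (phi k t - phi k b)) ->
     continuous (fun y => riemann Phi (phi k t) (phi k b) (y - x)) y /\
     continuous (fun y => riemann_b Phi1 (phi k t) (phi k b) (y - x)) y).
  { rewrite Rmin_left, Rmax_right by lra; intros y Hy.
    destruct (cont_riemann N Phi Phi1 Phi2 HPhi (phi k t) (fun _ => phi k b)
      (fun y => y - x) y) as (c1 & c2 & _).
    - exact H1.
    - apply Rabs_def1; lra.
    - apply continuous_const.
    - cont.
    - split; assumption. }
  split; apply (ex_RInt_continuous (V := R_CompleteNormedModule)); intros y Hy;
    destruct (X y Hy); apply cont_mult; auto.
Qed.

Lemma slab_continuous_x (f : R -> R -> R) (t y : R) : 1 <= t -> slab_continuous f ->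
  continuous (f t) y.
Proof.
  intros Ht Hf.
  apply (slab_path f (fun _ => t) (fun y => y)); [exact Hf|auto|cont|cont].
Qed.

Lemma real_source_eq (t x b : R) : 1 < b -> b <= t ->
  real_source t x b
  = Rpower t (- beta) * (/ Rpower b k * source Phi reduced_source (phi k t) x (phi k b)).
Proof.
  intros Hb Hbt; unfold real_source, source.
  destruct reduced_continuous as (_ & _ & _ & _ & Ch).
  destruct (riemann_integrable t x b (reduced_source (phi k b))) as [X _]; [lra|exact Hbt| |].
  { intros y; apply jcontinuous_snd, Ch. }
  replace (x - phi k t + phi k b) with (x - (phi k t - phi k b)) by ring.
  replace (x + phi k t - phi k b) with (x + (phi k t - phi k b)) by ring.
  rewrite <- !Rmult_assoc.
  symmetry.
  set (K := Rpower t (- beta) * / Rpower b k * (1 / 2)).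
  transitivity (RInt (fun y => scal K
     (reduced_source (phi k b) y * riemann Phi (phi k t) (phi k b) (y - x)))
     (x - (phi k t - phi k b)) (x + (phi k t - phi k b))).
  { symmetry; apply (RInt_scal (V := R_CompleteNormedModule)), X. }
  apply (RInt_ext (V := R_CompleteNormedModule)); intros y _.
  rewrite reduced_source_eq by exact Hb; unfold K, real_E, beta, scal; simpl; unfold mult; simpl.
  replace (- ((mu - k) / 2)) with ((k - mu) / 2) by field.
  replace (Rpower b ((k + mu) / 2)) with (Rpower b ((mu - k) / 2) * Rpower b k).
  2: { rewrite <- Rpower_plus; f_equal; field. }
  pose proof (Rpower_pos k b); field; lra.
Qed.

(** Change of variable [s = phi b] in the outer integral. The source is clamped because it
    is continuous only on the closed time interval. *)
Lemma integral_real_source (t x : R) : 1 <= t ->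
  ex_RInt (real_source t x) 1 t /\
  RInt (real_source t x) 1 t
  = Rpower t (- beta) * RInt (source Phi reduced_source (phi k t) x) s0 (phi k t).
Proof.
  intros Ht.
  assert (Hk1 := proj2 Hk).
  assert (Hs0 : 0 < s0) by apply phi_pos, Hk1.
  assert (HS : s0 <= phi k t) by (apply phi_nondecreasing; lra).
  destruct reduced_continuous as (_ & _ & _ & _ & Ch).
  set (sc := fun z => source Phi reduced_source (phi k t) x (clamp s0 (phi k t) z)).
  assert (Csc : forall z, continuous sc z).
  { intros z; apply (continuous_source N s0 Phi Phi1 Phi2 HPhi Hs0 reduced_source Ch), HS. }
  assert (Pr : forall z, Rmin 1 t <= z <= Rmax 1 t -> 0 < z).
  { rewrite Rmin_left by lra; intros z Hz; lra. }
  assert (Pc : forall z, 0 < z -> continuous (fun b => / Rpower b k) z).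
  { intros z Hz; apply (continuous_comp (fun b => Rpower b k) Rinv).
    - apply cont_Rpower; [exact Hz|apply continuous_id].
    - apply continuous_Rinv, Rgt_not_eq, Rpower_pos. }
  pose proof (RInt_comp (V := R_CompleteNormedModule) sc (phi k)
    (fun b => / Rpower b k) 1 t (fun z _ => Csc (phi k z))
    (fun z Hz => conj (is_derive_phi k z Hk1 (Pr z Hz)) (Pc z (Pr z Hz)))) as P.
  assert (Es : RInt sc s0 (phi k t) = RInt (source Phi reduced_source (phi k t) x) s0 (phi k t)).
  { apply (RInt_ext (V := R_CompleteNormedModule)).
    rewrite Rmin_left, Rmax_right by exact HS; intros z Hz.
    unfold sc; rewrite clamp_id by lra; reflexivity. }
  change (phi k 1) with s0 in P; rewrite <- Es, <- P.
  assert (X : ex_RInt (fun b => scal (/ Rpower b k) (sc (phi k b))) 1 t).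
  { apply (ex_RInt_continuous (V := R_CompleteNormedModule)); intros z Hz.
    apply (cont_mult (fun b => / Rpower b k)); [apply Pc, Pr, Hz|].
    apply (continuous_comp (phi k) sc); [|apply Csc].
    apply (ex_derive_continuous (phi k)); eexists.
    apply is_derive_phi; [exact Hk1|apply Pr, Hz]. }
  assert (E : forall b, Rmin 1 t < b < Rmax 1 t ->
    scal (Rpower t (- beta)) (scal (/ Rpower b k) (sc (phi k b))) = real_source t x b).
  { rewrite Rmin_left, Rmax_right by exact Ht; intros b Hb.
    rewrite real_source_eq by lra.
    unfold sc; rewrite clamp_id.
    - reflexivity.
    - split; apply phi_nondecreasing; lra. }
  split.
  - apply (ex_RInt_ext (V := R_NormedModule) _ _ _ _ E).
    apply (ex_RInt_scal (V := R_NormedModule)), X.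
  - rewrite <- (RInt_ext (V := R_CompleteNormedModule) _ _ _ _ E).
    apply (RInt_scal (V := R_CompleteNormedModule)), X.
Qed.

Lemma real_representation (t x : R) : 1 <= t ->
  u t x = 1 / 2 * Rpower t ((k - mu) / 2) * (u0 (x + A k t) + u0 (x - A k t))
    + RInt (fun y => u0 y * real_K0 t x y) (x - A k t) (x + A k t)
    + RInt (fun y => u1 y * real_E t x 1 y) (x - A k t) (x + A k t)
    + RInt (real_source t x) 1 t.
Proof.
  intros Ht.
  assert (Hk1 := proj2 Hk).
  assert (Hs0 : 0 < s0) by apply phi_pos, Hk1.
  assert (HS : s0 <= phi k t) by (apply phi_nondecreasing; lra).
  destruct reduced_continuous as (Cv & Cvs & Cvss & Cvxx & Ch).
  assert (Rep := riemann_representation N s0 Phi Phi1 Phi2 HPhi Hs0 reduced reduced_s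
    reduced_x reduced_ss reduced_xx reduced_source Cv Cvs Cvss Cvxx Ch
    (fun s x Hs => proj1 (reduced_derivatives s x Hs))
    (fun s x Hs => proj1 (proj2 (reduced_derivatives s x Hs)))
    (fun s x Hs => proj1 (proj2 (proj2 (reduced_derivatives s x Hs))))
    (fun s x Hs => proj2 (proj2 (proj2 (reduced_derivatives s x Hs))))).
  assert (HW : forall s x, s0 < s ->
    reduced_ss s x - reduced_xx s x + N / (s * s) * reduced s x = reduced_source s x).
  { intros s y Hs; unfold reduced_source; rewrite Rmax_right by lra; reflexivity. }
  specialize (Rep HW (phi k t) x HS).
  assert (Hp1 := Rpower_pos beta t); assert (Hp2 := Rpower_pos (- beta) t).
  assert (Hpp : Rpower t (- beta) * Rpower t beta = 1).
  { rewrite <- Rpower_plus; replace (- beta + beta) with 0 by ring.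
    apply Rpower_O; lra. }
  assert (Ex : (k - mu) / 2 = - beta) by (unfold beta; field).
  assert (Eu : u t x = Rpower t (- beta) * reduced (phi k t) x).
  { unfold reduced; rewrite tau_phi, <- Rmult_assoc, Hpp by lra; ring. }
  assert (T1 : tau k s0 = 1) by (apply tau_phi; lra).
  assert (E0 : forall y, reduced s0 y = u0 y).
  { intros y; unfold reduced; rewrite T1, Rpower_1_base, Hu0; ring. }
  assert (E1 : forall y, reduced_s s0 y = beta * u0 y + u1 y).
  { intros y; unfold reduced_s; rewrite T1, !Rpower_1_base, Hu0, Hu1; ring. }
  assert (C0 : forall y, continuous u0 y).
  { intros y; apply (continuous_ext (u 1)); [apply Hu0|].
    apply slab_continuous_x; [lra|exact Su]. }
  assert (C1 : forall y, continuous u1 y).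
  { intros y; apply (continuous_ext (ut 1)); [apply Hu1|].
    apply slab_continuous_x; [lra|exact Sut]. }
  destruct (riemann_integrable t x 1 u0) as [I1 I2]; [lra|lra|exact C0|].
  destruct (riemann_integrable t x 1 u1) as [I3 _]; [lra|lra|exact C1|].
  change (phi k 1) with s0 in I1, I2, I3.
  set (K := Rpower t (- beta) * (1 / 2)).
  assert (J0 : RInt (fun y => u0 y * real_K0 t x y) (x - A k t) (x + A k t)
    + RInt (fun y => u1 y * real_E t x 1 y) (x - A k t) (x + A k t)
    = K * RInt (green_density Phi Phi1 reduced reduced_s (phi k t) x s0)
        (x - (phi k t - s0)) (x + (phi k t - s0))).
  { unfold A; fold s0.
    assert (X0 : ex_RInt (fun y => u0 y * real_K0 t x y)
       (x - (phi k t - s0)) (x + (phi k t - s0))).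
    { apply (ex_RInt_ext (V := R_NormedModule) (fun y => minus
        (scal (K * beta) (u0 y * riemann Phi (phi k t) s0 (y - x)))
        (scal K (u0 y * riemann_b Phi1 (phi k t) s0 (y - x))))).
      - intros y _; unfold K, real_K0; rewrite Ex.
        unfold minus, plus, opp, scal; simpl; unfold mult; simpl; ring.
      - apply (ex_RInt_minus (V := R_NormedModule));
          apply (ex_RInt_scal (V := R_NormedModule)); assumption. }
    assert (X1 : ex_RInt (fun y => u1 y * real_E t x 1 y)
       (x - (phi k t - s0)) (x + (phi k t - s0))).
    { apply (ex_RInt_ext (V := R_NormedModule)
        (fun y => scal K (u1 y * riemann Phi (phi k t) s0 (y - x)))).
      - intros y _; unfold K, real_E; rewrite Ex, Rpower_1_base; fold s0.
        unfold scal; simpl; unfold mult; simpl; ring.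
      - apply (ex_RInt_scal (V := R_NormedModule)); assumption. }
    assert (XG : ex_RInt (green_density Phi Phi1 reduced reduced_s (phi k t) x s0)
       (x - (phi k t - s0)) (x + (phi k t - s0))).
    { apply (ex_RInt_ext (V := R_NormedModule) (fun y => plus (minus
        (scal beta (u0 y * riemann Phi (phi k t) s0 (y - x)))
        (u0 y * riemann_b Phi1 (phi k t) s0 (y - x)))
        (u1 y * riemann Phi (phi k t) s0 (y - x)))).
      - intros y _; unfold green_density; rewrite E0, E1.
        unfold minus, plus, opp, scal; simpl; unfold mult; simpl; ring.
      - apply (ex_RInt_plus (V := R_NormedModule)); [|assumption].
        apply (ex_RInt_minus (V := R_NormedModule)); [|assumption].
        apply (ex_RInt_scal (V := R_NormedModule)); assumption. }
    pose proof (RInt_plus (V := R_CompleteNormedModule) _ _ _ _ X0 X1) as P.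
    pose proof (RInt_scal (V := R_CompleteNormedModule) _ _ _ K XG) as Q.
    unfold plus at 2 in P; simpl in P.
    change (RInt (fun y => u0 y * real_K0 t x y) (x - (phi k t - s0)) (x + (phi k t - s0))
      + RInt (fun y => u1 y * real_E t x 1 y) (x - (phi k t - s0)) (x + (phi k t - s0))
      = scal K (RInt (green_density Phi Phi1 reduced reduced_s (phi k t) x s0)
        (x - (phi k t - s0)) (x + (phi k t - s0)))).
    rewrite <- Q, <- P.
    apply (RInt_ext (V := R_CompleteNormedModule)); intros y _.
    unfold real_K0, real_E, green_density, K; rewrite E0, E1, Ex, Rpower_1_base.
    fold s0; unfold plus, scal; simpl; unfold mult; simpl; ring. }
  destruct (integral_real_source t x Ht) as [_ J1].
  rewrite J1, Eu, Rep; unfold green; rewrite !E0.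
  match goal with |- _ = ?a + ?b + ?c + ?d =>
    replace (a + b + c + d) with (a + (b + c) + d) by ring end.
  rewrite J0, Ex; unfold K, A; fold s0; ring.
Qed.

End Solution.

(** * Existence in the original variables *)

(** The form of all terms obtained by returning to the original variables. *)
Definition weighted (k a : R) (F : R -> R -> R) (t x : R) : R :=
  Rpower t a * F (phi k t) x.

Lemma weighted_dt (k a : R) (F Fs : R -> R -> R) (t x : R) : k < 1 -> 0 < t ->
  has_ds F Fs ->
  is_derive (fun t => weighted k a F t x) t
    (a * weighted k (a - 1) F t x + weighted k (a - k) Fs t x).
Proof.
  intros Hk Ht HF; unfold weighted; eapply is_derive_eq.
  - apply (Derive.is_derive_mult (fun t => Rpower t a) (fun t => F (phi k t) x)).
    + apply is_derive_Rpower, Ht.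
    + apply (is_derive_compose (fun s => F s x) (fun s => Fs s x) (phi k)); [apply HF|].
      apply is_derive_phi; assumption.
  - unfold Rminus; rewrite !Rpower_plus, !Rpower_Ropp, Rpower_1 by exact Ht.
    pose proof (Rpower_pos k t); field; lra.
Qed.

Lemma weighted_dx (k a : R) (F Fx : R -> R -> R) (t x : R) : has_dx F Fx ->
  is_derive (fun x => weighted k a F t x) x (weighted k a Fx t x).
Proof. intros HF; apply is_derive_scal, HF. Qed.

Lemma jcont_weighted (k a : R) (F : R -> R -> R) (t x : R) : k < 1 -> 0 < t ->
  jcontinuous F -> jcont (weighted k a F) t x.
Proof.
  intros Hk Ht CF; unfold jcont, weighted; apply cont_mult.
  - apply cont_Rpower; [exact Ht|apply cont_fst].
  - apply (jcont_path F (fun r : R * R => phi k (fst r)) snd); [exact CF| |apply cont_snd].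
    apply (continuous_comp fst (phi k)); [apply cont_fst|].
    apply (ex_derive_continuous (phi k)); eexists.
    apply is_derive_phi; [exact Hk|exact Ht].
Qed.

(** Inverts the reduction: [u = t ^ (- beta) v (phi t, x)], with reduced data [u0] and
    [beta u0 + u1]. *)
Lemma solution_exists (k mu nu2 : R) (u0 u1 : R -> R) (g : R -> R -> R) :
  0 < k < 1 -> C_line 2 u0 -> C_line 1 u1 -> C01_slab g ->
  exists u, is_solution k mu nu2 u0 u1 g u.
Proof.
  intros Hk Hu0 Hu1 [Sg [gx [Dg Sgx]]].
  assert (Hk1 := proj2 Hk).
  set (beta := (mu - k) / 2); set (N := reduced_mass k mu nu2); set (s0 := phi k 1).
  set (q := fun s => N / (Rmax s0 s * Rmax s0 s)).
  set (wt := fun (f : R -> R -> R) s x =>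
    Rpower (tau k s) beta * (Rpower (tau k s) k * Rpower (tau k s) k) * f (tau k s) x).
  assert (Hs0 : 0 < s0) by apply phi_pos, Hk1.
  assert (Cwt : forall f, slab_continuous f -> jcontinuous (wt f)).
  { intros f Sf s x; unfold jcont, wt.
    apply cont_mult; [apply cont_mult; [|apply cont_mult]|];
      try apply (cont_tau_power k Hk).
    apply (cont_slab_tau k Hk f s x Sf). }
  assert (Cq : forall s, continuous q s).
  { intros s; unfold q; pose proof (Rmax_l s0 s).
    assert (Cm : continuous (fun s => Rmax s0 s) s) by apply cont_Rmax, continuous_id.
    apply cont_div; [nra|cont|apply cont_mult; exact Cm]. }
  assert (D00 : forall x, is_derive u0 x (Derive u0 x)).
  { intros x; apply Derive_correct; apply (Hu0 1%nat x); auto. }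
  assert (D01 : forall x, is_derive (Derive u0) x (Derive_n u0 2 x)).
  { intros x; apply Derive_correct; apply (Hu0 2%nat x); auto. }
  assert (D10 : forall x, is_derive u1 x (Derive u1 x)).
  { intros x; apply Derive_correct; apply (Hu1 1%nat x); auto. }
  assert (C02 : forall x, continuous (Derive_n u0 2) x).
  { intros x; apply (Hu0 2%nat x); auto. }
  assert (C01 : forall x, continuous (Derive u0) x).
  { intros x; apply (Hu0 1%nat x); auto. }
  assert (C11 : forall x, continuous (Derive u1) x).
  { intros x; apply (Hu1 1%nat x); auto. }
  destruct (wave_solution_exists s0 q u0 (Derive u0) (Derive_n u0 2)
    (fun x => beta * u0 x + u1 x) (fun x => beta * Derive u0 x + Derive u1 x)
    (wt g) (wt gx) Cq D00 D01 C02) as (v & vs & vx & vss & vsx & vxx & W).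
  - intros x; apply is_derive_sum; [apply is_derive_scal, D00|apply D10].
  - intros x; apply cont_plus; [apply cont_mult; [cont|apply C01]|apply C11].
  - apply Cwt, Sg.
  - apply Cwt, Sgx.
  - intros s x; apply is_derive_scal, Dg, tau_ge_1, Hk1.
  - destruct W as [Cv Cvs Cvx Cvss Cvsx Cvxx Ds Dx Dss Dsx Dxs Dxx HW Hv0 Hv1].
    set (u := weighted k (- beta) v).
    set (ut := fun t x => - beta * weighted k (- beta - 1) v t x
                          + weighted k (- beta - k) vs t x).
    set (ux := weighted k (- beta) vx).
    set (utt := fun t x => - beta * ((- beta - 1) * weighted k (- beta - 1 - 1) v t x
                                   + weighted k (- beta - 1 - k) vs t x)
        + ((- beta - k) * weighted k (- beta - k - 1) vs t x
           + weighted k (- beta - k - k) vss t x)).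
    set (utx := fun t x => - beta * weighted k (- beta - 1) vx t x
                          + weighted k (- beta - k) vsx t x).
    set (uxx := weighted k (- beta) vxx).
    assert (Dt : forall t x, 0 < t -> is_derive (fun t => u t x) t (ut t x)).
    { intros t x Ht; apply weighted_dt; assumption. }
    assert (Dtt : forall t x, 0 < t -> is_derive (fun t => ut t x) t (utt t x)).
    { intros t x Ht; apply is_derive_sum; [apply is_derive_scal|];
        apply weighted_dt; assumption. }
    assert (Dxt : forall t x, 0 < t -> is_derive (fun t => ux t x) t (utx t x)).
    { intros t x Ht; apply weighted_dt; assumption. }
    assert (Dux : forall t x, is_derive (u t) x (ux t x)).
    { intros t x; apply weighted_dx, Dx. }
    assert (Duxx : forall t x, is_derive (ux t) x (uxx t x)).
    { intros t x; apply weighted_dx, Dxx. }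
    assert (Dutx : forall t x, is_derive (ut t) x (utx t x)).
    { intros t x; apply is_derive_sum; [apply is_derive_scal|]; apply weighted_dx;
        assumption. }
    assert (Sw : forall a F, jcontinuous F -> forall t x, 1 <= t ->
      jcont (weighted k a F) t x) by (intros; apply jcont_weighted; [exact Hk1|lra|assumption]).
    assert (Sl : forall a b c F G, jcontinuous F -> jcontinuous G -> forall t x, 1 <= t ->
      jcont (fun t x => c * weighted k a F t x + weighted k b G t x) t x).
    { intros a b c F G CF CG t x Ht; unfold jcont; apply cont_plus.
      - apply cont_mult; [apply continuous_const|apply (Sw a F CF t x Ht)].
      - apply (Sw b G CG t x Ht). }
    exists u; split; [|split; [|split]].
    + split.
      { apply slab_continuous_of_jcont, Sw, Cv. }
      exists ut, ux; split; [|split].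
      * intros t x Ht; split; [apply is_dt_of_derive; [exact Ht|apply Dt; lra]|apply Dux].
      * split.
        { apply slab_continuous_of_jcont, Sl; assumption. }
        exists utt, utx; split; [|split; (split; [|exact I])].
        -- intros t x Ht; split;
             [apply is_dt_of_derive; [exact Ht|apply Dtt; lra]|apply Dutx].
        -- apply slab_continuous_of_jcont; intros t x Ht; unfold jcont, utt.
           apply cont_plus; [apply cont_mult; [apply continuous_const|]|];
             apply (Sl _ _ _ _ _); assumption.
        -- apply slab_continuous_of_jcont, Sl; assumption.
      * split.
        { apply slab_continuous_of_jcont, Sw, Cvx. }
        exists utx, uxx; split; [|split; (split; [|exact I])].
        -- intros t x Ht; split;
             [apply is_dt_of_derive; [exact Ht|apply Dxt; lra]|apply Duxx].
        -- apply slab_continuous_of_jcont, Sl; assumption.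
        -- apply slab_continuous_of_jcont, Sw, Cvxx.
    + intros t x Ht.
      rewrite (Derive_n_2 _ (fun t => ut t x) t (utt t x)).
      2: { generalize (locally_gt 0 t ltac:(lra)); apply filter_imp.
           intros s Hs; apply Dt, Hs. }
      2: apply Dtt; lra.
      rewrite (Derive_n_2 _ (ux t) x (uxx t x)).
      2: { apply filter_forall; intros y; apply Dux. }
      2: apply Duxx.
      rewrite (Derive_val _ _ _ (Dt t x ltac:(lra))).
      assert (HP : s0 <= phi k t) by (apply phi_nondecreasing; lra).
      pose proof (HW (phi k t) x HP) as E.
      unfold wt, q in E; rewrite tau_phi, Rmax_right in E by lra.
      assert (Hp := Rpower_pos beta t); assert (HT := Rpower_pos k t).
      assert (Eg : g t x = (vss (phi k t) x - vxx (phi k t) x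
         + N / (phi k t * phi k t) * v (phi k t) x)
         / (Rpower t beta * (Rpower t k * Rpower t k))) by (rewrite E; field; lra).
      rewrite Eg; clear E Eg.
      unfold utt, uxx, ut, u, weighted; unfold Rminus.
      rewrite ?Rpower_plus, ?Rpower_Ropp, ?Rpower_1 by lra.
      replace (2 * k) with (k + k) by ring; rewrite Rpower_plus.
      generalize (vss (phi k t) x) (vs (phi k t) x) (v (phi k t) x) (vxx (phi k t) x).
      intros a1 a2 a3 a4.
      unfold phi; rewrite Rpower_1_minus by lra.
      unfold N, reduced_mass, delta, beta in *.
      set (p := Rpower t ((mu - k) / 2)) in *; set (T := Rpower t k) in *.
      field; lra.
    + intros x; unfold u, weighted; rewrite Rpower_1_base; fold s0; rewrite Hv0; ring.
    + intros x; apply is_dt_of_derive; [lra|].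
      eapply is_derive_eq; [apply Dt; lra|].
      unfold ut, weighted; rewrite !Rpower_1_base; fold s0; rewrite Hv0, Hv1; ring.
Qed.

(** * The representation formula *)

Section Kernels.
Variables (k mu nu2 : R) (sd : C) (Phi Phi1 Phi2 : R -> R).
Hypothesis Hk : 0 < k < 1.
Hypothesis HPhi : riemann_profile (reduced_mass k mu nu2) Phi Phi1 Phi2.
Hypothesis Hgauss : forall z, 0 <= z ->
  (RCpower (1 + z) (- gam k sd)
   * hypergeom (gam k sd) (gam k sd) (RtoC 1) (RtoC (z / (1 + z))))%C
  = RtoC (Phi z).

Lemma kernelE_real_E (t x b y : R) : 1 <= b -> b <= t ->
  Rabs (y - x) <= phi k t - phi k b ->
  kernelE k mu sd t x b y = RtoC (real_E k mu Phi t x b y).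
Proof.
  intros Hb Hbt Hy; apply kernelE_riemann; try lra; [exact Hgauss|].
  rewrite (Rabs_pos_eq (phi k t - phi k b)); [exact Hy|].
  pose proof (Rabs_pos (y - x)); lra.
Qed.

(** Strictly inside the interval the kernel is real for all [b] near [1] on both sides, so the
    complex derivative is that of a real function. *)
Lemma kernelK0_real_K0 (t x y : R) : 1 <= t ->
  Rabs (y - x) < phi k t - phi k 1 ->
  kernelK0 k mu sd t x y = RtoC (real_K0 k mu Phi Phi1 t x y).
Proof.
  intros Ht Hy.
  assert (Hk1 := proj2 Hk).
  assert (H1 := phi_pos k 1 Hk1).
  set (r := fun b => 1 / 2 * Rpower t ((k - mu) / 2) * (Rpower b ((k + mu) / 2)
             * riemann Phi (phi k t) (phi k b) (y - x))).
  set (l := 1 / 2 * Rpower t ((k - mu) / 2)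
     * ((k + mu) / 2 * riemann Phi (phi k t) (phi k 1) (y - x)
        + riemann_b Phi1 (phi k t) (phi k 1) (y - x))).
  assert (D : CRDerive (fun b => kernelE k mu sd t x b y) 1 = RtoC l).
  { apply (CRDerive_RtoC _ r).
    - assert (C : continuous (phi k) 1).
      { apply (ex_derive_continuous (phi k)); eexists; apply is_derive_phi; lra. }
      assert (L1 : locally (phi k 1) (fun z => z < phi k t - Rabs (y - x))).
      { assert (Hd : 0 < phi k t - Rabs (y - x) - phi k 1) by lra.
        exists (mkposreal _ Hd); intros z Hz.
        change (Rabs (z - phi k 1) < phi k t - Rabs (y - x) - phi k 1) in Hz.
        apply Rabs_def2 in Hz; lra. }
      specialize (C _ L1); unfold filtermap in C.
      generalize (filter_and _ _ C (locally_gt 0 1 Rlt_0_1)); apply filter_imp.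
      intros b [Hb Hb0].
      rewrite (kernelE_riemann k mu sd Phi) by
        (lra || exact Hgauss || (rewrite (Rabs_pos_eq (phi k t - phi k b));
          pose proof (Rabs_pos (y - x)); lra)).
      unfold r; f_equal; ring.
    - eapply is_derive_eq.
      + apply is_derive_scal, (Derive.is_derive_mult (fun b => Rpower b ((k + mu) / 2))
          (fun b => riemann Phi (phi k t) (phi k b) (y - x))).
        * apply is_derive_Rpower; lra.
        * apply (is_derive_compose (fun b => riemann Phi (phi k t) b (y - x))
            (fun b => riemann_b Phi1 (phi k t) b (y - x)) (phi k)).
          -- apply (is_derive_riemann_b (reduced_mass k mu nu2) Phi Phi1 Phi2 HPhi);
               [exact H1|lra].
          -- apply is_derive_phi; lra.
      + unfold l; rewrite !Rpower_1_base; field. }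
  unfold kernelK0; rewrite D, kernelE_real_E by lra.
  rewrite <- RtoC_mult, <- RtoC_minus; f_equal.
  unfold real_E, real_K0, l; rewrite Rpower_1_base; field.
Qed.

Lemma representation_real (u0 u1 : R -> R) (g : R -> R -> R) (t x : R) : 1 <= t ->
  (forall y, continuous u0 y) -> (forall y, continuous u1 y) ->
  (forall b y, 1 <= b -> continuous (g b) y) ->
  ex_RInt (real_source k mu g Phi t x) 1 t ->
  representation k mu sd u0 u1 g t x
  = RtoC (1 / 2 * Rpower t ((k - mu) / 2) * (u0 (x + A k t) + u0 (x - A k t))
    + RInt (fun y => u0 y * real_K0 k mu Phi Phi1 t x y) (x - A k t) (x + A k t)
    + RInt (fun y => u1 y * real_E k mu Phi t x 1 y) (x - A k t) (x + A k t)
    + RInt (real_source k mu g Phi t x) 1 t).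
Proof.
  intros Ht C0 C1 Cg Xs.
  assert (Hk1 := proj2 Hk).
  assert (Hmon : forall b, 1 <= b <= t -> 0 <= phi k t - phi k b).
  { intros b Hb; assert (phi k b <= phi k t) by (apply phi_nondecreasing; lra); lra. }
  assert (HA : 0 <= A k t) by (apply Hmon; lra).
  assert (Cont : forall b y, 1 <= b <= t -> Rabs (y - x) <= phi k t - phi k b ->
     continuous (fun y => riemann Phi (phi k t) (phi k b) (y - x)) y /\
     continuous (fun y => riemann_b Phi1 (phi k t) (phi k b) (y - x)) y).
  { intros b y Hb Hy.
    assert (H1 := phi_pos k b Hk1).
    destruct (cont_riemann _ Phi Phi1 Phi2 HPhi (phi k t) (fun _ => phi k b)
      (fun y => y - x) y) as (c1 & c2 & _);
      [exact H1|lra|apply continuous_const|cont|split; assumption]. }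
  assert (XE : forall b f, 1 <= b <= t -> (forall y, continuous f y) ->
    ex_RInt (fun y => f y * real_E k mu Phi t x b y)
      (x - (phi k t - phi k b)) (x + (phi k t - phi k b))).
  { intros b f Hb Cf; apply (ex_RInt_continuous (V := R_CompleteNormedModule)).
    specialize (Hmon b Hb); rewrite Rmin_left, Rmax_right by lra; intros y Hy.
    destruct (Cont b y Hb) as [c1 c2]; [apply Rabs_le; lra|].
    apply cont_mult; [apply Cf|]; unfold real_E.
    apply cont_mult; [apply continuous_const|exact c1]. }
  assert (X0 : ex_RInt (fun y => u0 y * real_K0 k mu Phi Phi1 t x y)
     (x - A k t) (x + A k t)).
  { apply (ex_RInt_continuous (V := R_CompleteNormedModule)).
    rewrite Rmin_left, Rmax_right by lra; intros y Hy.
    destruct (Cont 1 y) as [c1 c2]; [lra|apply Rabs_le; unfold A in *; lra|].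
    apply cont_mult; [apply C0|]; unfold real_K0.
    apply cont_mult; [apply continuous_const|].
    apply cont_minus; [apply cont_mult; [apply continuous_const|exact c1]|exact c2]. }
  unfold representation.
  rewrite (CRInt_RtoC _ (fun y => u0 y * real_K0 k mu Phi Phi1 t x y)); [| |exact X0].
  2: { rewrite Rmin_left, Rmax_right by lra; intros y Hy.
       rewrite kernelK0_real_K0, RtoC_mult; [reflexivity|exact Ht|].
       apply Rabs_def1; unfold A in *; lra. }
  rewrite (CRInt_RtoC _ (fun y => u1 y * real_E k mu Phi t x 1 y));
    [| |apply XE; [lra|exact C1]].
  2: { rewrite Rmin_left, Rmax_right by lra; intros y Hy.
       unfold kernelK1; rewrite kernelE_real_E, RtoC_mult; [reflexivity|lra|lra|].
       apply Rabs_le; unfold A in *; lra. }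
  rewrite (CRInt_RtoC _ (real_source k mu g Phi t x)); [| |exact Xs].
  2: { rewrite Rmin_left, Rmax_right by exact Ht; intros b Hb.
       specialize (Hmon b ltac:(lra)).
       apply CRInt_RtoC.
       - rewrite Rmin_left, Rmax_right by lra; intros y Hy.
         rewrite kernelE_real_E, RtoC_mult; [reflexivity|lra|lra|].
         apply Rabs_le; lra.
       - replace (x - phi k t + phi k b) with (x - (phi k t - phi k b)) by ring.
         replace (x + phi k t - phi k b) with (x + (phi k t - phi k b)) by ring.
         apply XE; [lra|intros; apply Cg; lra]. }
  rewrite !RtoC_plus; reflexivity.
Qed.

End Kernels.

Theorem theorem2p1 (k mu nu2 : R) (sd : C) (u0 u1 : R -> R) (g : R -> R -> R)
  (hk : 0 < k < 1) (hmu : 0 <= mu) (hnu2 : 0 <= nu2)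
  (hsd : is_sqrt (delta mu nu2) sd)
  (hu0 : C_line 2 u0) (hu1 : C_line 1 u1) (hg : C01_slab g) :
  (exists u : R -> R -> R, is_solution k mu nu2 u0 u1 g u) /\
  (forall u : R -> R -> R, is_solution k mu nu2 u0 u1 g u ->
     forall t x : R, 1 <= t ->
       RtoC (u t x) = representation k mu sd u0 u1 g t x).
Proof.
  split; [apply solution_exists; assumption|].
  intros u [[Su [ut [ux [D [[Sut [utt [utx [Dut [[Sutt _] _]]]]]
    [_ [uxt [uxx [Dux [_ [Suxx _]]]]]]]]]]] [Heq [Hu0 Hu1]]] t x Ht.
  destruct (riemann_profile_exists (gam k sd) (reduced_mass k mu nu2))
    as (Phi & Phi1 & Phi2 & HPhi & Hgauss).
  { apply gam_reduced_mass; [lra|exact hsd]. }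
  assert (Dt : forall t x, 1 < t -> is_derive (fun t => u t x) t (ut t x)).
  { intros s y Hs; apply is_dt_interior; [exact Hs|apply D; lra]. }
  assert (Dtt : forall t x, 1 < t -> is_derive (fun t => ut t x) t (utt t x)).
  { intros s y Hs; apply is_dt_interior; [exact Hs|apply Dut; lra]. }
  assert (Dx : forall t x, 1 < t -> is_derive (u t) x (ux t x)).
  { intros s y Hs; apply D; lra. }
  assert (Dxx : forall t x, 1 < t -> is_derive (ux t) x (uxx t x)).
  { intros s y Hs; apply Dux; lra. }
  assert (HE : forall t x, 1 < t ->
    utt t x - Rpower t (- (2 * k)) * uxx t x + mu * / t * ut t x + nu2 * / t ^ 2 * u t x
    = g t x).
  { intros s y Hs; rewrite <- Heq by exact Hs.
    rewrite (Derive_n_2 _ (fun t => ut t y) s (utt s y)); [|  |apply Dtt, Hs].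
    2: { generalize (locally_gt 1 s Hs); apply filter_imp; intros z Hz; apply Dt, Hz. }
    rewrite (Derive_n_2 _ (ux s) y (uxx s y)); [| |apply Dxx, Hs].
    2: { apply filter_forall; intros z; apply Dx, Hs. }
    rewrite (Derive_val _ _ _ (Dt s y Hs)); reflexivity. }
  assert (Hut : forall y, ut 1 y = u1 y).
  { intros y; apply (is_dt_unique u 1 y); [lra|apply D; lra|apply Hu1]. }
  rewrite (representation_real k mu nu2 sd Phi Phi1 Phi2 hk HPhi Hgauss);
    [f_equal; apply (real_representation k mu nu2 u0 u1 g u hk ut ux utt uxx) with (Phi2 := Phi2); assumption
    |exact Ht| | | |].
  - intros y; apply (ex_derive_continuous u0), (hu0 1%nat y); auto.
  - intros y; apply (ex_derive_continuous u1), (hu1 1%nat y); auto.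
  - intros b y Hb; apply slab_continuous_x; [exact Hb|apply hg].
  - apply (integral_real_source k mu nu2 g u hk ut utt uxx) with (1 := Su) (Phi1 := Phi1)
      (Phi2 := Phi2); assumption.
Qed.
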